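(* Let $z\in\mathbb{C}\setminus\{0,-1/2,-1,-3/2,\dots\}$. 1) The family $(\mathfrak{C}_n(z))_{n\ge0}$ is a martingale with mean 1, and $$\lim_{n\to\infty}\mathfrak{C}_n(z)=\frac{\xi^{2z-1}}{\Gamma(2z)}\qquad\text{almost surely}.$$ Moreover, if the real part $\Re z$ of $z$ is positive, the convergence is in $L^1$. 2) The two martingales $(\mathfrak{C}_n(z))_{n\ge0}$ and $(\mathcal{M}_n(z))_{n\ge0}$ are independent and $$M(\tau_n,z)=\mathfrak{C}_n(z)\,\mathcal{M}_n(z)\qquad\text{for all } n\ge 0.$$
   Context: Let $\mathbb{U}=\{\emptyset\}\cup\bigcup_{n\ge1}\{0,1\}^n$ be the set of finite words on $\{0,1\}$; $|u|$ denotes the length (depth) of $u$. A complete binary tree is a finite subset $T\subset\mathbb{U}$ such that $\emptyset\in T$; $uv\in T\Rightarrow u\in T$; $u1\in T\Leftrightarrow u0\in T$. Its leaves, forming the set $\partial T$, are the nodes of $T$ with no strict descendants in $T$. Yule tree process $(\mathbb{T}_t)_{t\ge0}$: $\mathbb{T}_0=\{\emptyset\}$; each leaf $u$ carries an independent exponential clock of parameter 1, and when it rings $u$ becomes an internal node and two new leaves $u0,u1$ (with fresh independent clocks) are added. Let $\mathcal{F}_t=\sigma(\mathbb{T}_s,s\le t)$, $N_t=\#\partial\mathbb{T}_t$ and $\tau_n=\inf\{t: N_t=n+1\}$ ($\tau_0=0$). The binary search tree (BST) process is constructed on the same probability space by $\mathcal{T}_n:=\mathbb{T}_{\tau_n}$,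 $n\ge0$; it is a Markov chain started at $\{\emptyset\}$ in which a uniformly chosen leaf $u$ among the $n+1$ leaves of $\mathcal{T}_n$ is replaced by an internal node with two leaf children $u0,u1$. $M(t,z):=\sum_{u\in\partial\mathbb{T}_t}z^{|u|}e^{t(1-2z)}$ (the Yule martingale) and $\mathcal{M}_n(z):=\frac1{C_n(z)}\sum_{u\in\partial\mathcal{T}_n}z^{|u|}$ (the BST martingale), with $C_0(z)=1$, $C_n(z)=\prod_{k=0}^{n-1}\frac{k+2z}{k+1}$. $\mathfrak{C}_n(z):=e^{\tau_n(1-2z)}C_n(z)$; it is adapted to the filtration $(\mathcal{F}_{\tau_n})_{n\ge0}$. $\xi:=\lim_{t\to\infty}e^{-t}N_t$ almost surely; $\xi$ is exponential of parameter 1.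
   Formalization: The claim ''martingale with mean 1'' is stated only for Re z > 0, since for Re z ≤ 0 the variable 𝔠_1(z) is not integrable; the uncompleted σ-algebras F_{τ_n} are taken as nested only up to null sets. *)

(* Defs.v *)
From HB Require Import structures.
From mathcomp Require Import all_boot all_order all_algebra.
From mathcomp Require Import finmap.
From mathcomp Require Import complex.
From mathcomp Require Import all_classical all_reals all_analysis.
Set Implicit Arguments.
Unset Strict Implicit.
Unset Printing Implicit Defensive.
Import Order.TTheory GRing.Theory Num.Theory.
Import numFieldNormedType.Exports.
Local Open Scope classical_set_scope.
Local Open Scope ring_scope.
Local Open Scope complex_scope.

Section complex_analysis.
Context {R : realType}.

Definition cexp (w : R[i]) : R[i] :=
  (expR (complex.Re w) * cos (complex.Im w)) +i*
  (expR (complex.Re w) * sin (complex.Im w)).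

(* Principal value; meaningful for 0 < x only. *)
Definition cpow (x : R) (w : R[i]) : R[i] := cexp (w * (ln x)%:C).

Definition cintegrable d (T : measurableType d)
    (mu : {measure set T -> \bar R}) (D : set T) (f : T -> R[i]) : Prop :=
  mu.-integrable D (EFin \o (fun x => complex.Re (f x))) /\
  mu.-integrable D (EFin \o (fun x => complex.Im (f x))).

Definition cintegral d (T : measurableType d)
    (mu : {measure set T -> \bar R}) (D : set T) (f : T -> R[i]) : R[i] :=
  (\int[mu]_(x in D) complex.Re (f x))%R +i*
  (\int[mu]_(x in D) complex.Im (f x))%R.

(* Meaningful for 0 < Re w only. *)
Definition Euler_integral (w : R[i]) : R[i] :=
  cintegral (@lebesgue_measure R) `]0, +oo[
    (fun t : R => cpow t (w - 1) * (expR (- t))%:C).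

Definition Gamma_shift (w : R[i]) : nat :=
  if 0 < complex.Re w then 0%N else (Num.truncn (- complex.Re w)).+1.

(* Euler's integral on 0 < Re w, continued to the complex numbers that are not
   nonpositive integers by Gamma (w + 1) = w * Gamma w; the number m of shifts
   is chosen so that 0 < Re (w + m). *)
Definition Gamma (w : R[i]) : R[i] :=
  let m := Gamma_shift w in
  Euler_integral (w + m%:R) / \prod_(k < m) (w + k%:R).

End complex_analysis.

Section probability_notions.
Context d (Omega : measurableType d) (R : realType) (P : probability Omega R).

Definition mutually_independent (I : choiceType) (X : I -> {RV P >-> R}) :
    Prop :=
  forall (s : {fset I}) (B : I -> set R),
    (forall i, measurable (B i)) ->
    P (\bigcap_(i in [set` s]) (X i @^-1` B i)) =
    (\prod_(i <- s) P (X i @^-1` B i))%E.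

(* The sets f^-1(B), for B in a generating family of the Borel sets of C. *)
Definition cpreimages (f : Omega -> R[i]) : set (set Omega) :=
  [set A | exists2 B : set R, measurable B &
     A = (fun w => complex.Re (f w)) @^-1` B \/
     A = (fun w => complex.Im (f w)) @^-1` B].

Definition cmeasurable_wrt (G : set (set Omega)) (f : Omega -> R[i]) : Prop :=
  cpreimages f `<=` G.

Definition sigma_seq (X : nat -> Omega -> R[i]) : set (set Omega) :=
  <<s \bigcup_n cpreimages (X n) >>.

Definition independent_seqs (X Y : nat -> Omega -> R[i]) : Prop :=
  [/\ sigma_seq X `<=` measurable, sigma_seq Y `<=` measurable &
      forall A B, sigma_seq X A -> sigma_seq Y B ->
        P (A `&` B) = (P A * P B)%E].

Definition is_cond_exp (G : set (set Omega)) (X Y : Omega -> R[i]) : Prop :=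
  [/\ cmeasurable_wrt G Y, cintegrable P setT Y &
      forall A, G A -> cintegral P A Y = cintegral P A X].

(* Inclusion F m <= F n, for m <= n, is required up to P-null sets: the
   stopped sigma-algebras used below are not completed, and are nested only up
   to the null event that two clocks ring at the same time. *)
Definition filtration_mod_null (F : nat -> set (set Omega)) : Prop :=
  (forall n, sigma_algebra setT (F n) /\ F n `<=` measurable) /\
  (forall m n A, (m <= n)%N -> F m A ->
     exists2 B, F n B & P ((A `\` B) `|` (B `\` A)) = 0%E).

Definition martingale (F : nat -> set (set Omega)) (X : nat -> Omega -> R[i]) :
    Prop :=
  [/\ filtration_mod_null F,
      forall n, cmeasurable_wrt (F n) (X n),
      forall n, cintegrable P setT (X n) &
      forall m n, (m <= n)%N -> is_cond_exp (F m) (X n) (X m)].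

Definition cvg_L1 (X : nat -> Omega -> R[i]) (L : Omega -> R[i]) : Prop :=
  (\int[P]_w (ComplexField.Normc.normc (X n w - L w))%:E)%E
    @[n --> \oo] --> 0%E.

End probability_notions.

(* Words on {0,1} are boolean sequences, 0 being false: u0 is rcons u false,
   and the strict ancestors of u are its prefixes take k u with k < size u. *)
Definition leaves (T : set (seq bool)) : set (seq bool) :=
  [set u | T u /\ forall v, v != [::] -> ~ T (u ++ v)].

Section yule.
Context d (Omega : measurableType d) (R : realType) (P : probability Omega R).

Definition yule_clocks (E : seq bool -> {RV P >-> R}) : Prop :=
  mutually_independent E /\
  forall u (B : set R), measurable B ->
    distribution P (E u) B = exponential_prob 1 B.

Variable E : seq bool -> {RV P >-> R}.

(* E u is the lifetime of u as a leaf; u becomes a leaf when its parent rings,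
   so that u rings at the sum of the clocks from the root to u, u included. *)
Definition ring_time (u : seq bool) (w : Omega) : R :=
  \sum_(k < (size u).+1) E (take k u) w.

Definition yule_tree (t : R) (w : Omega) : set (seq bool) :=
  [set u | forall k, (k < size u)%N -> ring_time (take k u) w <= t].

(* 0 when there are infinitely many leaves, a null event. *)
Definition yule_N (t : R) (w : Omega) : nat :=
  #|` fset_set (leaves (yule_tree t w))|.

(* +oo on the null event that N never takes the value n + 1. *)
Definition yule_tau (n : nat) (w : Omega) : \bar R :=
  ereal_inf [set t%:E | t in [set t : R | 0 <= t /\ yule_N t w = n.+1]].

Definition yule_filtration (t : R) : set (set Omega) :=
  <<s [set A | exists s u, 0 <= s <= t /\ A = [set w | yule_tree s w u]] >>.

Definition stopped_filtration (n : nat) : set (set Omega) :=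
  [set A | measurable A /\ forall t : R, 0 <= t ->
     yule_filtration t (A `&` [set w | (yule_tau n w <= t%:E)%E])].

Definition bst (n : nat) (w : Omega) : set (seq bool) :=
  yule_tree (fine (yule_tau n w)) w.

Definition yule_M (t : R) (z : R[i]) (w : Omega) : R[i] :=
  \sum_(u \in leaves (yule_tree t w)) (z ^+ size u * cexp (t%:C * (1 - 2 * z))).

Definition bst_C (n : nat) (z : R[i]) : R[i] :=
  \prod_(k < n) ((k%:R + 2 * z) / k.+1%:R).

Definition bst_M (n : nat) (z : R[i]) (w : Omega) : R[i] :=
  (bst_C n z)^-1 * \sum_(u \in leaves (bst n w)) z ^+ size u.

Definition frakC (n : nat) (z : R[i]) (w : Omega) : R[i] :=
  cexp ((fine (yule_tau n w))%:C * (1 - 2 * z)) * bst_C n z.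

End yule.

(* Main.v *)
Require Import Defs.
From HB Require Import structures.
From mathcomp Require Import all_boot all_order all_algebra.
From mathcomp Require Import finmap.
From mathcomp Require Import complex.
From mathcomp Require Import all_classical all_reals all_analysis.
From mathcomp Require Import measurable_realfun.
From mathcomp Require Import ring lra.
Set Implicit Arguments.
Unset Strict Implicit.
Unset Printing Implicit Defensive.
Import Order.TTheory GRing.Theory Num.Theory.
Import numFieldNormedType.Exports.
Local Open Scope classical_set_scope.
Local Open Scope ring_scope.
Local Open Scope complex_scope.

(** Put [w = 2 z] and let [tau n] be the time of the n-th split.  While the tree
has n + 1 leaves, the residual lifetimes of these leaves are independent
exponential variables of parameter 1, because the exponential law has no
memory.  Hence, given the past, the leaf that splits next is uniform, the
waiting time [gap n] is exponential of parameter n + 1, and the two are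
independent ([jump_step]).  The whole proposition follows from this.

A history is the list of the leaves that split first, last one in front.  The
events [hevent h], for the histories h of a given length, form a partition of
the space up to a null set, and on [hevent h] the tree and the splitting times
are explicit sums of clocks.  An event belongs to the past of the n-th split
([past n]) when on each piece [hevent h] of level n it coincides with an event
of the clocks of the words of h; the stopped sigma-algebra at [tau n] is
included in [past n] ([stopped_past]).

Martingale.  One has [frakC n z = C_n(z) exp ((1 - w) tau n)], the mean of
[exp ((1 - w) gap n)] is [(n + 1) / (n + w)], and [C_(n+1) / C_n] is
[(n + w) / (n + 1)] ([frakC_step]).  The condition [0 < Re z] is integrability
of the first of these exponentials.

Limit.  The value [frakC (n+1) z] is the product of [C_(n+1)(z) (n+1)^(1-w)],
which tends to [1 / Gamma w] by Euler's limit formula ([scaled_ratio_cvg]), and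
of the power [w - 1] of [(n+1) exp (- tau (n+1))], which tends to [xi] since
there are n + 1 leaves at time [tau n] and [tau n] tends to infinity.  That
[tau n] is unbounded and that [xi] is positive both come from Fatou's lemma and
from the boundedness of [E ((n exp (- tau n))^(-s))] for each [s < 1]
([scaled_size_moment]).  The same bound controls a moment of order
[p = 1 + Re w / 2 > 1] of [frakC n z] when [0 < Re w], which gives the
convergence in L1 ([frakC_L1]).

Independence.  Iterating [jump_step], the waiting times are independent of the
successive splitting leaves ([indep_gap_hevent]).  Off a null set, [frakC n z]
is a function of the waiting times and [bst_M n z] of the shape of the tree. *)

(** * Sigma-algebras generated by families of events *)

Section generated.
Context d (Omega : measurableType d) (G : set (set Omega)).

Lemma gen_set0 : <<s G >> set0.
Proof. exact: (@measurable0 _ (g_sigma_algebraType G)). Qed.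

Lemma gen_setT : <<s G >> setT.
Proof. exact: (@measurableT _ (g_sigma_algebraType G)). Qed.

Lemma gen_setC A : <<s G >> A -> <<s G >> (~` A).
Proof. exact: (@measurableC _ (g_sigma_algebraType G)). Qed.

Lemma gen_setI A B : <<s G >> A -> <<s G >> B -> <<s G >> (A `&` B).
Proof. exact: (@measurableI _ (g_sigma_algebraType G)). Qed.

Lemma gen_setD A B : <<s G >> A -> <<s G >> B -> <<s G >> (A `\` B).
Proof. exact: (@measurableD _ (g_sigma_algebraType G)). Qed.

Lemma gen_bigcup (F : nat -> set Omega) : (forall k, <<s G >> (F k)) ->
  <<s G >> (\bigcup_k F k).
Proof. exact: (@bigcupT_measurable _ (g_sigma_algebraType G)). Qed.

Lemma gen_countable_bigcup (I : Type) (F : I -> set Omega) : countable [set: I] ->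
  (forall i, <<s G >> (F i)) -> <<s G >> (\bigcup_i F i).
Proof. exact: (@countable_bigcupT_measurable _ (g_sigma_algebraType G)). Qed.

End generated.

(** * Independence from pi-systems *)

Section indep.
Context d (Omega : measurableType d) (R : realType) (P : probability Omega R).

(** Finite probabilities as real numbers, so that they can be handled by
linear arithmetic. *)
Definition pr (A : set Omega) : R := fine (P A).

Lemma prE A : measurable A -> P A = (pr A)%:E.
Proof. by move=> mA; rewrite fineK// fin_num_measure. Qed.

Lemma pr_ge0 A : 0 <= pr A.
Proof. by rewrite fine_ge0. Qed.

Lemma le_pr A B : measurable A -> measurable B -> A `<=` B -> pr A <= pr B.
Proof.
by move=> mA mB AB; rewrite -lee_fin -!prE// le_measure// inE.
Qed.

Lemma pr_split A B : measurable A -> measurable B ->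
  pr A = pr (A `&` B) + pr (A `\` B).
Proof.
move=> mA mB; apply: EFin_inj; rewrite EFinD -!prE//.
- by rewrite addeC -measureDI.
- exact: measurableD.
- exact: measurableI.
Qed.

(** For fixed B, both sides are finite measures in A of the same total mass,
so that they agree on the sigma-algebra as soon as they agree on the
pi-system. *)
Lemma indep_gen1 (G : set (set Omega)) (B : set Omega) :
  setI_closed G -> G setT -> G `<=` measurable -> measurable B ->
  (forall A, G A -> P (A `&` B) = (P A * P B)%E) ->
  forall A, <<s G >> A -> P (A `&` B) = (P A * P B)%E.
Proof.
move=> GI GT Gm mB GB A sA.
have pB0 : 0 <= pr B by exact: pr_ge0.
have -> : P (A `&` B) = mrestr P mB A by [].
have -> : (P A * P B)%E = mscale (NngNum pB0) P A.
  by rewrite /mscale/= -prE// muleC.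
apply: (@g_sigma_algebra_measure_unique _ _ _ G Gm (fun=> setT)) => //.
- exact: bigcup_const.
- move=> C GC; change (P (C `&` B) = (pr B)%:E * P C)%E.
  by rewrite GB// -prE// muleC.
- move=> _; change (P (setT `&` B) < +oo)%E.
  by rewrite setTI ltey_eq fin_num_measure.
Qed.

Lemma sigma_sub_measurable (G : set (set Omega)) :
  G `<=` measurable -> <<s G >> `<=` measurable.
Proof.
move=> Gm; apply: smallest_sub => //; exact: sigma_algebra_measurable.
Qed.

Lemma indep_gen (G1 G2 : set (set Omega)) :
  setI_closed G1 -> G1 setT -> G1 `<=` measurable ->
  setI_closed G2 -> G2 setT -> G2 `<=` measurable ->
  (forall A B, G1 A -> G2 B -> P (A `&` B) = (P A * P B)%E) ->
  forall A B, <<s G1 >> A -> <<s G2 >> B -> P (A `&` B) = (P A * P B)%E.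
Proof.
move=> I1 T1 m1 I2 T2 m2 ind A B sA sB.
have mA : measurable A by exact: sigma_sub_measurable sA.
rewrite setIC muleC; apply: (indep_gen1 (G := G2)) => // C C2.
rewrite setIC muleC; apply: (indep_gen1 (G := G1)) => //; first exact: m2.
by move=> D D1; apply: ind.
Qed.

End indep.

(** * Independence of the clocks *)

Section clocks.
Context d (Omega : measurableType d) (R : realType) (P : probability Omega R).
Variable E : seq bool -> {RV P >-> R}.

Definition clock_sets (U : set (seq bool)) : set (set Omega) :=
  [set A | exists x B, [/\ U x, measurable B & A = E x @^-1` B]].

(** The pi-system that generates the same sigma-algebra as [clock_sets U]:
mutual independence is a statement about its elements. *)
Definition cylinders (U : set (seq bool)) : set (set Omega) :=
  [set A | exists (s : {fset seq bool}) (B : seq bool -> set R),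
     [/\ [set` s] `<=` U, forall i, measurable (B i) &
         A = \bigcap_(i in [set` s]) (E i @^-1` B i)]].

Lemma measurable_clock x (B : set R) : measurable B -> measurable (E x @^-1` B).
Proof. by move=> mB; rewrite -[X in measurable X]setTI; exact: measurable_funP. Qed.

Lemma clock_sets_measurable U : clock_sets U `<=` measurable.
Proof. by move=> _ [x [B [_ mB ->]]]; exact: measurable_clock. Qed.

Lemma cylinders_measurable U : cylinders U `<=` measurable.
Proof.
move=> _ [s [B [_ mB ->]]]; apply: fin_bigcap_measurable => //.
by move=> i _; exact: measurable_clock.
Qed.

Lemma clock_sets_cylinders U : clock_sets U `<=` cylinders U.
Proof.
move=> _ [x [B [Ux mB ->]]]; exists [fset x]%fset, (fun=> B); split => //.
- by move=> y /=; rewrite inE => /eqP ->.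
- by rewrite set_fset1 bigcap_set1.
Qed.

Lemma cylinders_setT U : cylinders U setT.
Proof.
exists fset0, (fun=> setT); split => //.
by rewrite set_fset0 bigcap_set0.
Qed.

Lemma cylindersI U : setI_closed (cylinders U).
Proof.
move=> _ _ [s [B [sU mB ->]]] [t [C [tU mC ->]]].
exists (s `|` t)%fset, (fun i => (if i \in s then B i else setT) `&`
  (if i \in t then C i else setT)); split.
- by move=> i; rewrite /= inE => /orP[/sU|/tU].
- by move=> i; apply: measurableI; case: ifP.
- apply/seteqP; split.
    move=> w [wB wC] i /=; rewrite inE => _; split.
      by case: ifPn => // /wB.
    by case: ifPn => // /wC.
  move=> w h; split=> i /= it; have := h i; rewrite /= inE it ?orbT => /(_ isT).
    by case.
  by case.
Qed.

Hypothesis hE : mutually_independent E.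

(** Adding u to a finite index set adds one factor to the product rule of
mutual independence; the pi-system argument extends this from cylinders to
all events of the clocks in U. *)
Lemma clocks_indep U u (B : set R) A : ~ U u -> measurable B ->
  <<s clock_sets U >> A -> P (A `&` E u @^-1` B) = (P A * P (E u @^-1` B))%E.
Proof.
move=> Uu mB sA.
apply: (indep_gen1 (@cylindersI U) (@cylinders_setT U) (@cylinders_measurable U) (measurable_clock _ mB)); last first.
  by apply: (sub_smallest2r _ (@clock_sets_cylinders U)) sA; exact: smallest_sigma_algebra.
move=> _ [s [C [sU mC ->]]].
have us : u \notin s by apply/negP => /sU.
have := hE (u |` s)%fset (B := fun i => if i == u then B else C i).
rewrite big_fsetU1//= eqxx => h.
have -> : \bigcap_(i in [set` s]) E i @^-1` C i `&` E u @^-1` B =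
   \bigcap_(i in [set` (u |` s)%fset]) E i @^-1` (if i == u then B else C i).
  apply/seteqP; split.
    move=> w [wC wB] i /=; rewrite in_fset1U => /orP[/eqP ->|is_]; first by rewrite eqxx.
    by case: eqP => [->//|_]; exact: wC.
  move=> w h'; split.
    move=> i /= is_; have := h' i; rewrite /= in_fset1U is_ orbT => /(_ isT).
    by case: eqP => // iu; rewrite -iu is_ in us.
  by have := h' u; rewrite /= fset1U1 eqxx => /(_ isT).
rewrite h; last by move=> i; case: ifP.
rewrite (hE _ mC) muleC; congr (_ * _)%E.
by apply: eq_fbigr => i is_ _; case: eqP => // iu; rewrite -iu is_ in us.
Qed.

End clocks.

(** * The exponential law and its lack of memory *)

Section exptail.
Context (R : realType).

Lemma exponential_prob_tail (x : R) : 0 <= x ->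
  exponential_prob 1 `]x, +oo[ = (expR (- x))%:E.
Proof.
move=> x0; set f : measurableTypeR R -> \bar R := (fun y : R => (exponential_pdf 1 y)%:E).
have mf : measurable_fun setT f.
  by apply/measurable_EFinP; exact: measurable_exponential_pdf.
have f0 y : (0 <= f y)%E by rewrite lee_fin exponential_pdf_ge0.
have h1 : (\int[lebesgue_measure]_(y in `]-oo, x]) f y +
           \int[lebesgue_measure]_(y in `]x, +oo[) f y = 1)%E.
  rewrite -ge0_integral_setU//.
  - rewrite -(@integral_exponential_pdf R 1)//; congr integral.
    apply/seteqP; split => // y _; rewrite /= !in_itv/= andbT.
    by case: (leP y x) => h; [left|right].
  - exact: measurable_funTS.
  - apply/disj_setPS => y /=; rewrite !in_itv/= andbT => -[yx xy].
    by have := lt_le_trans xy yx; rewrite ltxx.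
have h2 : (\int[lebesgue_measure]_(y in `]-oo, x]) f y =
   1 - (expR (- x))%:E)%E.
  have -> : `]-oo, x]%classic = `]-oo, 0[%classic `|` `[0, x]%classic.
    apply/seteqP; split => y /=; rewrite !in_itv/=.
      by move=> yx; case: (ltP y 0) => h; [left|right].
    by case=> [/ltW y0|/andP[]//]; apply: le_trans x0.
  rewrite ge0_integral_setU//; last 2 first.
  - exact: measurable_funTS.
  - apply/disj_setPS => y /=; rewrite !in_itv/= => -[y0 /andP[y1 _]].
    by have := lt_le_trans y0 y1; rewrite ltxx.
  rewrite integral0_eq ?add0e; last first.
    by move=> y; rewrite /= in_itv/= => y0; rewrite /f lt0_exponential_pdf.
  move: x0; rewrite le_eqVlt => /orP[/eqP <-|x0].
    by rewrite set_itv1 integral_set1 oppr0 expR0 subee.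
  by have := exponential_prob_itv0c 1 x0; rewrite mulN1r.
move: h1; rewrite h2 => h1.
have : (\int[lebesgue_measure]_(y in `]x, +oo[) f y = 1 - (1 - (expR (- x))%:E))%E.
  move: h1; rewrite -!EFinB; case: (\int[_]_(_ in _) _)%E => [r| |]//= [h].
  by congr EFin; lra.
rewrite /exponential_prob => ->.
by rewrite -!EFinB; congr EFin; lra.
Qed.

End exptail.

Section memoryless.
Context d (Omega : measurableType d) (R : realType) (P : probability Omega R).
Variable E : seq bool -> {RV P >-> R}.
Hypothesis hE : yule_clocks E.
Notation pr := (pr P).
Notation sclk U := (<<s clock_sets E U >>).
Notation mclk U W := (measurable_fun (setT : set (g_sigma_algebraType (clock_sets E U))) (W : _ -> R)).

Lemma clock_tail u (x : R) : 0 <= x ->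
  P [set w | x < E u w] = (expR (- x))%:E.
Proof.
move=> x0; have [_ h] := hE.
have := h u `]x, +oo[%classic (measurable_itv _).
rewrite exponential_prob_tail// => <-; congr (P _).
by apply/seteqP; split => w /=; rewrite in_itv/= andbT.
Qed.

Lemma clock_tail_indep U u A (x : R) : ~ U u -> sclk U A -> 0 <= x ->
  P (A `&` [set w | x < E u w]) = (P A * (expR (- x))%:E)%E.
Proof.
move=> Uu sA x0; rewrite -(clock_tail u x0).
have -> : [set w | x < E u w] = E u @^-1` `]x, +oo[.
  by apply/seteqP; split => w /=; rewrite in_itv/= andbT.
by apply: (clocks_indep hE.1 Uu) => //; exact: measurable_itv.
Qed.

Lemma sclk_measurable U : sclk U `<=` measurable.
Proof. exact/sigma_sub_measurable/clock_sets_measurable. Qed.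

Lemma mclk_measurable U (W : Omega -> R) : mclk U W -> measurable_fun setT W.
Proof.
move=> mW _ B mB; rewrite setTI; apply: (@sclk_measurable U).
by have := mW measurableT B mB; rewrite setTI.
Qed.

Lemma mclk_set U (W : Omega -> R) (B : set R) : mclk U W -> measurable B -> sclk U (W @^-1` B).
Proof. by move=> mW mB; have := mW measurableT B mB; rewrite setTI. Qed.

Lemma mclk_E U u : U u -> mclk U (E u).
Proof.
move=> Uu _ B mB; rewrite setTI; apply: sub_sigma_algebra.
by exists u, B.
Qed.

Lemma measurable_gtE u (W : Omega -> R) : measurable_fun setT W ->
  measurable [set w | W w < E u w].
Proof.
move=> mW; rewrite -[X in measurable X]setTI.
have := measurable_fun_ltr mW (measurable_funP (E u)) => /(_ measurableT [set true] _).
by apply.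
Qed.
(** When the threshold W is replaced by its approximation from above with
values in the multiples of 1 / (N + 1), the event splits into countably many
pieces on which the threshold is constant, and on each of them the memoryless
property is the functional equation of the exponential. *)
Lemma memoryless_step U u G (W : Omega -> R) (r : R) N : ~ U u -> sclk U G -> mclk U W ->
  (forall w, G w -> 0 <= W w) -> 0 <= r ->
  let WN := fun w => ((Num.truncn (N.+1%:R * W w)).+1%:R / N.+1%:R : R) in
  P (G `&` [set w | WN w + r < E u w]) =
  (P (G `&` [set w | (WN w < E u w)%R]) * (expR (- r))%:E)%E.
Proof.
move=> Uu sG mW W0 r0 WN.
pose Gj j := G `&` [set w | Num.truncn (N.+1%:R * W w) = j].
have mGj j : sclk U (Gj j).
  pose I := if j == 0%N then `]-oo, (1 : R)[%classic else `[(j%:R : R), (j.+1%:R : R)[%classic.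
  have -> : Gj j = G `&` (fun w => N.+1%:R * W w) @^-1` I.
    apply/seteqP; split => w [Gw] /= h; split => //.
      rewrite /I -h; case: ifPn => [/eqP h0|_] /=.
        rewrite in_itv/=.
        have := @Num.Theory.truncn_itv R (N.+1%:R * W w).
        by rewrite h0 mulr_ge0 ?W0// => /(_ isT) /andP[].
      by rewrite in_itv/=; apply: Num.Theory.truncn_itv; rewrite mulr_ge0 ?W0.
    move: h; rewrite /I; case: ifPn => [/eqP ->|_] /=; rewrite in_itv/= => h.
      apply/eqP; rewrite Num.Theory.truncn_eq; last by rewrite mulr_ge0 ?W0.
      by rewrite h mulr_ge0 ?W0.
    by apply/eqP; rewrite Num.Theory.truncn_eq// mulr_ge0 ?W0.
  apply: gen_setI => //; apply: mclk_set; last by rewrite /I; case: ifP.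
  exact: (@measurable_funM _ (g_sigma_algebraType (clock_sets E U)) R setT (cst N.+1%:R) W).
have key s : 0 <= s -> P (G `&` [set w | WN w + s < E u w]) =
   (\sum_(0 <= j <oo) (P (Gj j) * (expR (- (j.+1%:R / N.+1%:R + s)))%:E))%E.
  move=> s0.
  have -> : G `&` [set w | WN w + s < E u w] =
    \bigcup_j (Gj j `&` [set w | j.+1%:R / N.+1%:R + s < E u w]).
    apply/seteqP; split.
      by move=> w [Gw] /= h; exists (Num.truncn (N.+1%:R * W w)).
    by move=> w [j _] [[Gw] /= <-] h.
  rewrite measure_bigcup//.
  - rewrite (eq_eseriesl (Q := xpredT)); last by move=> j; rewrite in_setT.
    apply: eq_eseriesr => j _.
    apply: (@clock_tail_indep U) => //.
    by rewrite addr_ge0// divr_ge0.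
  - move=> j _; apply: measurableI; first exact: sclk_measurable (mGj j).
    exact: measurable_gtE.
  - apply/trivIsetP => i j _ _ ij; apply/seteqP; split => // w /= [[[_ hi] _] [[_ hj] _]].
    by move: ij; rewrite -hi -hj eqxx.
rewrite key//.
have -> : [set w | WN w < E u w] = [set w | WN w + 0 < E u w].
  by apply/seteqP; split => w /=; rewrite addr0.
rewrite key// muleC -nneseriesZl; last first.
  by move=> j _; rewrite mule_ge0// lee_fin expR_ge0.
apply: eq_eseriesr => j _.
rewrite muleCA -EFinM -expRD; congr (_ * (expR _)%:E)%E.
by rewrite addr0 opprD addrC.
Qed.

Lemma tail_cvg u (G : set Omega) (W : Omega -> R) (r : R) : measurable G -> measurable_fun setT W ->
  P (G `&` [set w | W w + r + n.+1%:R^-1 < E u w]) @[n --> \oo] -->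
  P (G `&` [set w | W w + r < E u w]).
Proof.
move=> mG mW.
have -> : G `&` [set w | W w + r < E u w] =
  \bigcup_n (G `&` [set w | W w + r + n.+1%:R^-1 < E u w]).
  apply/seteqP; split.
    move=> w [Gw] /= h.
    have h0 : 0 < E u w - (W w + r) by lra.
    exists (Num.truncn ((E u w - (W w + r))^-1)) => //; split => //=.
    rewrite -ltrBrDl -[ltRHS]invrK ltf_pV2 ?posrE ?invr_gt0//.
    by apply: truncnS_gt.
  move=> w [n _] [Gw] /= h; split => //=.
  by apply: lt_trans h; rewrite ltrDl invr_gt0.
apply: nondecreasing_cvg_mu.
- move=> n; apply: measurableI => //.
  apply: measurable_gtE; apply: measurable_funD => //; exact: measurable_funD.
- apply: bigcup_measurable => n _; apply: measurableI => //.
  apply: measurable_gtE; apply: measurable_funD => //; exact: measurable_funD.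
- move=> m n mn; apply/subsetPset => w [Gw] /= h; split => //=.
  apply: le_lt_trans h; rewrite lerD2l lef_pV2 ?posrE// ler_nat ltnS//.
Qed.

(** Lack of memory at a random level W that depends only on other clocks:
limit of [memoryless_step], the discretised levels being squeezed between W
and W + 1 / (N + 1). *)
Lemma memoryless U u G (W : Omega -> R) (r : R) : ~ U u -> sclk U G -> mclk U W ->
  (forall w, G w -> 0 <= W w) -> 0 <= r ->
  P (G `&` [set w | W w + r < E u w]) =
  (P (G `&` [set w | (W w < E u w)%R]) * (expR (- r))%:E)%E.
Proof.
move=> Uu sG mW W0 r0.
have mG := sclk_measurable sG; have mW' := mclk_measurable mW.
pose WN N w := ((Num.truncn (N.+1%:R * W w)).+1%:R / N.+1%:R : R).
have WN1 N w : G w -> W w < WN N w.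
  by move=> Gw; rewrite /WN ltr_pdivlMr// mulrC; apply: truncnS_gt.
have WN2 N w : G w -> WN N w <= W w + N.+1%:R^-1.
  move=> Gw; rewrite /WN ler_pdivrMr// mulrDl mulVf// -natr1 lerD2r mulrC.
  by rewrite Num.Theory.truncn_le// mulr_ge0// W0.
have mWN N : measurable_fun setT (WN N).
  pose g (x : R) : R := (Num.truncn (N.+1%:R * x)).+1%:R / N.+1%:R.
  have mg : measurable_fun setT g.
    apply: nondecreasing_measurable => // x y xy.
    rewrite /g ler_pM2r ?invr_gt0// ler_nat ltnS.
    by apply: le_truncn; rewrite ler_pM2l.
  exact: (measurableT_comp mg mW').
have mT s (V : Omega -> R) : measurable_fun setT V -> measurable (G `&` [set w | V w + s < E u w]).
  move=> mV; apply: measurableI => //; apply: measurable_gtE.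
  exact: measurable_funD.
have mT0 (V : Omega -> R) : measurable_fun setT V -> measurable (G `&` [set w | V w < E u w]).
  by move=> mV; apply: measurableI => //; apply: measurable_gtE.
have c0 := @tail_cvg u G W 0 mG mW'.
have cr := @tail_cvg u G W r mG mW'.
have e0 : [set w | W w + 0 < E u w] = [set w | W w < E u w].
  by apply/seteqP; split => w /=; rewrite addr0.
rewrite e0 in c0.
have step N : P (G `&` [set w | WN N w + r < E u w]) =
  (P (G `&` [set w | (WN N w < E u w)%R]) * (expR (- r))%:E)%E.
  exact: memoryless_step Uu sG mW W0 r0.
have e1 n : [set w | W w + 0 + n.+1%:R^-1 < E u w] = [set w | W w + n.+1%:R^-1 < E u w].
  by apply/seteqP; split => w /=; rewrite addr0.
have mono (V V' : Omega -> R) : measurable_fun setT V -> measurable_fun setT V' ->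
   (forall w, G w -> V w <= V' w) ->
   (P (G `&` [set w | (V' w < E u w)%R]) <= P (G `&` [set w | (V w < E u w)%R]))%E.
  move=> mV mV' VV'; apply: le_measure; rewrite ?inE; [exact: mT0|exact: mT0|].
  by move=> w [Gw] /= h; split => //=; apply: le_lt_trans h; exact: VV'.
have er0 : (0 <= (expR (- r))%:E)%E by rewrite lee_fin expR_ge0.
have mWs s : measurable_fun setT (fun w => W w + s).
  exact: measurable_funD.
have mWs2 s s' : measurable_fun setT (fun w => W w + s + s').
  exact: measurable_funD.
have mWNs N s : measurable_fun setT (fun w => WN N w + s).
  exact: measurable_funD.
apply/eqP; rewrite eq_le; apply/andP; split.
- apply: (cvge_to_le cr); near=> n.
  apply: le_trans (_ : (P (G `&` [set w | (WN n w + r < E u w)%R]) <= _)%E).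
    apply: mono => // w Gw; rewrite addrAC lerD2r; exact: WN2.
  rewrite step lee_wpmul2r//; apply: mono => // w Gw; exact/ltW/WN1.
- have c1 : (P (G `&` [set w | (W w + 0 + n.+1%:R^-1 < E u w)%R]) * (expR (- r))%:E)%E @[n --> \oo] -->
    (P (G `&` [set w | (W w < E u w)%R]) * (expR (- r))%:E)%E.
    apply: cvgeM => //; last exact: cvg_cst.
    by rewrite prE ?mule_def_fin//; exact: mT0.
  apply: (cvge_to_le c1); near=> n.
  apply: le_trans (_ : (P (G `&` [set w | (WN n w + r < E u w)%R]) <= _)%E).
    rewrite step lee_wpmul2r// e1; apply: mono => // w Gw; exact: WN2.
  apply: mono => // w Gw; rewrite lerD2r; exact/ltW/WN1.
Unshelve. all: by end_near. Qed.

End memoryless.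

(** * Histories of a binary tree *)

(** Leaves of the tree obtained from the root by splitting the words of h, the
head of h last. *)
Fixpoint hleaves (h : seq (seq bool)) : seq (seq bool) :=
  if h is v :: h' then rcons v false :: rcons v true :: rem v (hleaves h')
  else [:: [::]].

(** Each word of h is a leaf of the tree built by the words that follow it. *)
Fixpoint hist (h : seq (seq bool)) : bool :=
  if h is v :: h' then (v \in hleaves h') && hist h' else true.

Lemma size_hleaves h : hist h -> size (hleaves h) = (size h).+1.
Proof.
elim: h => //= v h IH /andP[vh hh]; rewrite size_rem// IH//.
Qed.

Lemma hleaves_spec h : hist h ->
  [/\ uniq (hleaves h),
      forall u, (u \in hleaves h) <-> ((forall k, (k < size u)%N -> take k u \in h) /\ u \notin h) &
      forall v, v \in h -> forall k, (k < size v)%N -> take k v \in h].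
Proof.
elim: h => [|v h IH] /=.
  move=> _; split=> // u; rewrite inE; split; first by move=> /eqP ->.
  by case: u => // b u [/(_ 0%N isT)].
move=> /andP[vh hh]; have [U L C] := IH hh.
have [vp vnh] : (forall k, (k < size v)%N -> take k v \in h) /\ v \notin h.
  exact/L.
have rvh b : rcons v b \notin h.
  apply/negP => /C /(_ (size v)); rewrite size_rcons ltnSn => /(_ isT).
  by rewrite -cats1 take_size_cat// (negbTE vnh).
have rvv b : rcons v b != v.
  by apply/eqP => /(congr1 size); rewrite size_rcons => /eqP; rewrite eqn_leq ltnn.
have L2 u : (u \in [:: rcons v false, rcons v true & rem v (hleaves h)]) <->
  ((forall k, (k < size u)%N -> take k u \in v :: h) /\ u \notin v :: h).
  rewrite !in_cons mem_rem_uniq// !inE; split.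
    have rc b : (forall k, (k < size (rcons v b))%N ->
        take k (rcons v b) \in v :: h) /\ rcons v b \notin v :: h.
      split; last by rewrite in_cons (negbTE (rvv b)) (negbTE (rvh b)).
      move=> k; rewrite size_rcons ltnS leq_eqVlt => /orP[/eqP ->|kv].
        by rewrite -cats1 take_size_cat// mem_head.
      by rewrite -cats1 take_cat kv in_cons vp// orbT.
    case/or3P => [/eqP ->|/eqP ->|/andP[uv uh]]; [exact: rc|exact: rc|].
    have [up unh] := (L u).1 uh; split; last by rewrite negb_or uv.
    by move=> k ku; rewrite in_cons up// orbT.
  move=> [up]; rewrite negb_or => /andP[uv unh].
  have [[k [ku kv]]|nk] := pselect (exists k, (k < size u)%N /\ take k u = v).
    have sv : size v = k by rewrite -kv size_takel// ltnW.
    have e : take k.+1 u = rcons v (nth false u k) by rewrite (take_nth false)// kv.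
    have [ks|ks] := eqVneq k.+1 (size u).
      have -> : u = rcons v (nth false u k) by rewrite -e ks take_size.
      by case: (nth _ _ _); rewrite !eqxx ?orbT.
    have ks' : (k.+1 < size u)%N by rewrite ltn_neqAle ks.
    have := up _ ks'; rewrite e in_cons (negbTE (rvv _)) (negbTE (rvh _))//.
  apply/or3P; apply: Or33; rewrite uv /=; apply/L; split => // k ku.
  have := up k ku; rewrite in_cons => /orP[/eqP e|//].
  by case: nk; exists k.
split.
- rewrite /= !in_cons negb_or rem_uniq// andbT.
  have nr b : rcons v b \notin rem v (hleaves h).
    rewrite mem_rem_uniq// !inE negb_and; apply/orP; right; apply/negP => /L[+ _].
    move=> /(_ (size v)); rewrite size_rcons ltnSn => /(_ isT).
    by rewrite -cats1 take_size_cat// (negbTE vnh).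
  rewrite !nr !andbT.
  by apply/eqP => /(congr1 (last false)); rewrite !last_rcons.
- exact: L2.
- move=> x; rewrite in_cons => /orP[/eqP ->|xh] k kx.
    by rewrite in_cons vp// orbT.
  by rewrite in_cons (C x)// orbT.
Qed.

Lemma hleaves_uniq h : hist h -> uniq (hleaves h).
Proof. by case/hleaves_spec. Qed.

Lemma hleavesP h u : hist h ->
  (u \in hleaves h) <-> ((forall k, (k < size u)%N -> take k u \in h) /\ u \notin h).
Proof. by case/hleaves_spec. Qed.

Lemma hist_prefix h v k : hist h -> v \in h -> (k < size v)%N -> take k v \in h.
Proof. by case/hleaves_spec => _ _ H vh; exact: H. Qed.

(** * The event that the splits follow a given history *)

Section events.
Context d (Omega : measurableType d) (R : realType) (P : probability Omega R).
Variable E : seq bool -> {RV P >-> R}.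
Notation ring := (ring_time E).

(** Time at which u becomes a leaf. *)
Definition birth (u : seq bool) (w : Omega) : R := \sum_(k < size u) E (take k u) w.

Lemma ring_birth u w : ring u w = birth u w + E u w.
Proof. by rewrite /ring_time big_ord_recr/= take_size. Qed.

Lemma birth_rcons v b w : birth (rcons v b) w = ring v w.
Proof.
rewrite /birth /ring_time size_rcons; apply: eq_bigr => k _.
rewrite -cats1 take_cat; case: ltnP => // kv.
have -> : nat_of_ord k = size v by apply/eqP; rewrite eqn_leq kv -ltnS ltn_ord.
by rewrite subnn take0 cats0 take_size.
Qed.

Definition htime (h : seq (seq bool)) (w : Omega) : R :=
  if h is v :: _ then ring v w else 0.

(** The words of h ring in increasing order, the last one of h first. *)
Fixpoint hordered (h : seq (seq bool)) (w : Omega) : Prop :=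
  if h is v :: h' then htime h' w < ring v w /\ hordered h' w else True.

(** The first splits occur at the words of h, in that order, and no leaf of the
resulting tree has rung at the time of the last of them. *)
Definition hevent (h : seq (seq bool)) : set Omega :=
  [set w | hordered h w /\ forall u, u \in hleaves h -> htime h w < ring u w].

(** A leaf is born when its parent rings, and its parent is in h. *)
Lemma hordered_birth h w : hist h -> hordered h w ->
  0 <= htime h w /\ forall u, u \in hleaves h -> birth u w <= htime h w.
Proof.
elim: h => [_ _|v h IH /=].
  by split => // u; rewrite inE => /eqP ->; rewrite /birth big_ord0.
move=> /andP[vh hh] [lt /(IH hh)[h0 bh]]; split; first exact: le_trans (ltW lt).
move=> u; rewrite !in_cons => /or3P[/eqP ->|/eqP ->|/mem_rem /bh h1].
- by rewrite birth_rcons.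
- by rewrite birth_rcons.
- exact: le_trans h1 (ltW lt).
Qed.

Lemma hevent_cons v h : hist (v :: h) -> hevent (v :: h) `<=` hevent h.
Proof.
move=> /= /andP[vh hh] w [[/= lt o] lw]; split => // u uh.
have [->//|uv] := eqVneq u v; apply: lt_trans lt (lw _ _).
by rewrite !in_cons mem_rem_uniq ?hleaves_uniq// !inE uv uh !orbT.
Qed.

Notation sclk U := (<<s clock_sets E U >>).
Notation mclk U W := (measurable_fun (setT : set (g_sigma_algebraType (clock_sets E U))) (W : Omega -> R)).

Lemma mclk_sum (U : set (seq bool)) n (F : nat -> Omega -> R) :
  (forall k, (k < n)%N -> mclk U (F k)) -> mclk U (fun w => \sum_(k < n) F k w).
Proof.
elim: n => [_|n IH hF].
  under eq_fun do rewrite big_ord0; exact: measurable_cst.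
under eq_fun do rewrite big_ord_recr/=.
apply: (@measurable_funD _ (g_sigma_algebraType (clock_sets E U))).
  by apply: IH => k kn; apply: hF; rewrite ltnS ltnW.
exact: hF.
Qed.

Lemma mclk_ring (U : set (seq bool)) u : (forall k, (k <= size u)%N -> U (take k u)) ->
  mclk U (ring u).
Proof.
move=> h; apply: (mclk_sum (F := fun k => E (take k u))) => k.
rewrite ltnS => ku; apply: mclk_E; exact: h.
Qed.

Lemma mclk_birth (U : set (seq bool)) u : (forall k, (k < size u)%N -> U (take k u)) ->
  mclk U (birth u).
Proof.
move=> h; apply: (mclk_sum (F := fun k => E (take k u))) => k.
move=> ku; apply: mclk_E; exact: h.
Qed.

Lemma mclk_hring (U : set (seq bool)) h v : hist h -> [set` h] `<=` U -> v \in h -> mclk U (ring v).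
Proof.
move=> hh hU vh; apply: mclk_ring => k; rewrite leq_eqVlt => /orP[/eqP ->|kv].
  by rewrite take_size; apply: hU.
by apply: hU => /=; apply: (hist_prefix hh vh).
Qed.

Lemma mclk_htime (U : set (seq bool)) h : hist h -> [set` h] `<=` U -> mclk U (htime h).
Proof.
case: h => [_ _|v h hh hU]; first exact: measurable_cst.
by apply: (mclk_hring hh hU); rewrite mem_head.
Qed.

Lemma sclk_lt (U : set (seq bool)) (f g : Omega -> R) : mclk U f -> mclk U g ->
  sclk U [set w | f w < g w].
Proof.
move=> mf mg.
have := @measurable_fun_ltr _ (g_sigma_algebraType (clock_sets E U)) _ _ _ _ mf mg measurableT [set true] I.
by rewrite setTI.
Qed.

Lemma sclk_hordered (U : set (seq bool)) h : hist h -> [set` h] `<=` U -> sclk U [set w | hordered h w].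
Proof.
elim: h => [_ _|v h IH].
  exact: gen_setT.
move=> /= /[dup] hh' /andP[vh hh] hU.
have hU' : [set` h] `<=` U by move=> x xh; apply: hU => /=; rewrite in_cons xh orbT.
apply: gen_setI; last exact: IH.
apply: sclk_lt; first exact: mclk_htime.
by apply: (mclk_hring (h := v :: h)) => //; rewrite mem_head.
Qed.

Lemma sclk_all (U : set (seq bool)) (s : seq (seq bool)) (A : seq bool -> set Omega) :
  (forall u, u \in s -> sclk U (A u)) -> sclk U [set w | forall u, u \in s -> A u w].
Proof.
elim: s => [_|x s IH h].
  rewrite (_ : [set _ | _] = setT); last by apply/seteqP; split.
  exact: gen_setT.
rewrite (_ : [set _ | _] = A x `&` [set w | forall u, u \in s -> A u w]); last first.
  apply/seteqP; split => w /=.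
    by move=> H; split => [|u us]; apply: H; rewrite ?mem_head// in_cons us orbT.
  by move=> [Ax H] u; rewrite in_cons => /orP[/eqP ->//|]; exact: H.
apply: gen_setI.
  by apply: h; rewrite mem_head.
by apply: IH => u us; apply: h; rewrite in_cons us orbT.
Qed.

Lemma sub_sclk (U V : set (seq bool)) : U `<=` V -> sclk U `<=` sclk V.
Proof.
move=> UV; apply: sub_smallest2r; first exact: smallest_sigma_algebra.
by move=> _ [x [B [Ux mB ->]]]; exists x, B; split => //; exact: UV.
Qed.

Hypothesis hE : yule_clocks E.

(** The thresholds of the leaves can be chosen separately, which encodes the joint
law of their residual lifetimes at the last split of h. *)
Definition residual (h : seq (seq bool)) (D : set Omega) (rho : seq bool -> R) : set Omega :=
  D `&` [set w | hordered h w] `&` [set w | forall u, u \in hleaves h -> htime h w + rho u < ring u w].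

Lemma sclk_measurableT U : sclk U `<=` measurable.
Proof. exact: sclk_measurable. Qed.

Lemma residual_measurable h D rho : hist h -> sclk [set` h] D -> measurable (residual h D rho).
Proof.
move=> hh sD; apply: (@sclk_measurableT setT).
apply: gen_setI.
  apply: gen_setI.
    by apply: sub_sclk sD.
  exact: sclk_hordered.
apply: sclk_all => u _; apply: sclk_lt; last exact: mclk_ring.
apply: (@measurable_funD _ (g_sigma_algebraType (clock_sets E setT))) => //.
exact: mclk_htime.
Qed.

(** At the last split of h the residual lifetimes of the leaves are independent
exponential variables: by [memoryless] the thresholds rho u are introduced one
leaf at a time, the clock of that leaf being independent of all the others. *)
Lemma residual_tail h D rho : hist h -> sclk [set` h] D -> (forall u, 0 <= rho u) ->
  P (residual h D rho) = (P (residual h D (fun=> 0%R)) * (expR (- \sum_(u <- hleaves h) rho u))%:E)%E.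
Proof.
move=> hh sD rho0.
suff H s : uniq s -> {subset s <= hleaves h} ->
  P (residual h D (fun u => if u \in s then rho u else 0)) =
  (P (residual h D (fun=> 0%R)) * (expR (- \sum_(u <- s) rho u))%:E)%E.
  rewrite -H ?hleaves_uniq//; congr (P _); apply/seteqP; split => w [? h1]; split => // u uh;
    have := h1 u uh; by rewrite uh.
elim: s => [_ _|v s IH /= /andP[vs us] ss].
  by rewrite big_nil oppr0 expR0 mule1.
have vh : v \in hleaves h by apply: ss; rewrite mem_head.
have ss' : {subset s <= hleaves h} by move=> x xs; apply: ss; rewrite in_cons xs orbT.
have [vp vnh] := (hleavesP v hh).1 vh.
rewrite big_cons opprD expRD EFinM (muleC (expR _)%:E) muleA -IH//.
(* the clock of v is compared with a level that depends on the other clocks *)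
pose U := [set x : seq bool | x != v].
have hU : [set` h] `<=` U.
  by move=> x /= xh; apply/eqP => xv; rewrite -xv xh in vnh.
pose rs u := if u \in s then rho u else 0.
pose G := D `&` [set w | hordered h w] `&`
  [set w | forall u, u \in rem v (hleaves h) -> htime h w + rs u < ring u w].
pose W w := htime h w - birth v w.
have rsv : rs v = 0 by rewrite /rs (negbTE vs).
have memr x : (x \in rem v (hleaves h)) = (x != v) && (x \in hleaves h).
  by rewrite mem_rem_uniq ?hleaves_uniq.
have -> : residual h D (fun u => if u \in v :: s then rho u else 0) =
    G `&` [set w | W w + rho v < E v w].
  apply/seteqP; split=> w.
    move=> [? h1]; split; last first.
      have := h1 v vh; rewrite mem_head ring_birth /W/=; lra.
    split => // u; rewrite memr => /andP[uv uh]; have := h1 _ uh.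
    by rewrite in_cons (negbTE uv).
  move=> [[? h1] /= h2]; split => // u uh.
  have [->|uv] := eqVneq u v.
    by rewrite mem_head ring_birth; move: h2; rewrite /W; lra.
  rewrite in_cons (negbTE uv)/=; apply: h1; by rewrite memr uv.
have -> : residual h D (fun u => if u \in s then rho u else 0) =
    G `&` [set w | W w < E v w].
  apply/seteqP; split=> w.
    move=> [? h1]; split; last first.
      have := h1 v vh; rewrite (negbTE vs) ring_birth /W/=; lra.
    by split => // u; rewrite memr => /andP[uv uh]; have := h1 _ uh.
  move=> [[? h1] /= h2]; split => // u uh.
  have [->|uv] := eqVneq u v.
    by rewrite (negbTE vs) ring_birth; move: h2; rewrite /W; lra.
  by apply: h1; rewrite memr uv.
apply: (memoryless hE (U := U)) => //.
- by rewrite /U /= eqxx.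
- apply: gen_setI.
    apply: gen_setI.
      exact: sub_sclk sD.
    exact: sclk_hordered.
  apply: sclk_all => u; rewrite memr => /andP[uv uh]; apply: sclk_lt.
    apply: (@measurable_funD _ (g_sigma_algebraType (clock_sets E U))) => //.
    exact: mclk_htime.
  apply: mclk_ring => k; rewrite leq_eqVlt => /orP[/eqP ->|ku].
    by rewrite take_size.
  by apply: hU; have [+ _] := (hleavesP u hh).1 uh; apply.
- apply: (@measurable_funB _ (g_sigma_algebraType (clock_sets E U))).
    exact: mclk_htime.
  by apply: mclk_birth => k kv; apply: hU; exact: vp.
- move=> w [[_ /= ho] _]; rewrite subr_ge0.
  by have [_] := hordered_birth hh ho; apply.
Qed.

Lemma residual0 h D : residual h D (fun=> 0) = D `&` hevent h.
Proof.
rewrite /residual -setIA; congr (_ `&` _).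
apply/seteqP; split => w [ho h1]; split => // u uh.
  by have := h1 u uh; rewrite addr0.
by rewrite addr0; exact: h1.
Qed.

End events.

(** * The race between the leaves *)

Section quad.
Context (R : realType).

(** A function whose increments are quadratic is constant: cutting [r, r'] into N
pieces bounds the increment by a multiple of 1 / N. *)
Lemma quad_cst (f : R -> R) (C : R) :
  (forall r r', 0 <= r -> r <= r' -> `|f r - f r'| <= C * (r' - r) ^+ 2) ->
  forall r r', 0 <= r -> r <= r' -> f r = f r'.
Proof.
move=> hf r r' r0 rr'.
have [C0|C0] := leP C 0.
  apply/eqP; rewrite -subr_eq0 -normr_le0; apply: le_trans (hf _ _ r0 rr') _.
  by rewrite mulr_le0_ge0// sqr_ge0.
set L := r' - r; have L0 : 0 <= L by rewrite subr_ge0.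
have H N : `|f r - f r'| <= C * L ^+ 2 / N.+1%:R.
  pose dl := L / N.+1%:R.
  have dl0 : 0 <= dl by rewrite divr_ge0.
  have st k : `|f r - f (r + k%:R * dl)| <= k%:R * (C * dl ^+ 2).
    elim: k => [|k IH]; first by rewrite !mul0r addr0 subrr normr0.
    have -> : f r - f (r + k.+1%:R * dl) = (f r - f (r + k%:R * dl)) +
       (f (r + k%:R * dl) - f (r + k.+1%:R * dl)) by ring.
    apply: le_trans (ler_normD _ _) _.
    rewrite -natr1 [leRHS]mulrDl [X in _ <= _ + X]mul1r lerD//.
    have := hf (r + k%:R * dl) (r + (k%:R + 1) * dl).
    have -> : r + (k%:R + 1) * dl - (r + k%:R * dl) = dl by ring.
    apply; first by rewrite addr_ge0// mulr_ge0.
    by rewrite mulrDl mul1r lerD2l lerDl.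
  have er : r + N.+1%:R * dl = r' by rewrite /dl mulrCA mulfV// mulr1 /L; ring.
  have := st N.+1; rewrite er /dl => h.
  apply: le_trans h _; rewrite exprMn -/L.
  rewrite le_eqVlt; apply/orP; left; apply/eqP; field.
  by rewrite addrC natr1 pnatr_eq0.
apply/eqP; rewrite -subr_eq0 -normr_le0.
apply/ler_addgt0Pl => e e0; rewrite addr0.
set K := C * L ^+ 2 in H *.
have K0 : 0 <= K by rewrite mulr_ge0 ?sqr_ge0// ltW.
apply: le_trans (H (Num.truncn (K / e))) _.
rewrite ler_pdivrMr// mulrC -ler_pdivrMr//.
exact/ltW/truncnS_gt.
Qed.

Lemma expR_lin2 (x : R) : 0 <= x -> x - x ^+ 2 <= 1 - expR (- x) <= x.
Proof.
move=> x0; apply/andP; split; last by have := expR_ge1Dx (- x); lra.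
have h1 : expR (- x) <= (1 + x)^-1.
  by rewrite expRN lef_pV2 ?posrE ?expR_gt0 ?expR_ge1Dx//; lra.
apply: le_trans (_ : 1 - (1 + x)^-1 <= _); last by lra.
have -> : 1 - (1 + x)^-1 = x / (1 + x) by field; lra.
rewrite ler_pdivlMr; last by lra.
have : 0 <= x ^+ 3 by rewrite exprn_ge0.
nra.
Qed.

(** Infinitesimal form of the race between m + 1 exponential clocks.  Q r stands
for the probability that a given clock wins after time r; the hypothesis
bounds its increments by events that involve the marginal tails only.  The
bounds differ from the increments of the claimed solution by a quadratic
term, so that the difference is constant, and it vanishes at infinity. *)
Lemma race_solve (Q : R -> R) (p : R) (m : nat) : 0 <= p ->
  (forall r, 0 <= r -> 0 <= Q r <= p * expR (- r)) ->
  (forall r r', 0 <= r -> r <= r' ->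
    p * expR (- (r + m%:R * r')) - p * expR (- (r' + m%:R * r')) <= Q r - Q r' <=
    p * expR (- (r + m%:R * r)) - p * expR (- (r' + m%:R * r))) ->
  forall r, 0 <= r -> Q r = p * expR (- (m.+1%:R * r)) / m.+1%:R.
Proof.
move=> p0 Q0 HQ.
pose q r := p * expR (- (m.+1%:R * r)) / m.+1%:R.
pose f r := Q r - q r.
have M0 : 0 < m.+1%:R :> R by [].
have mM : m.+1%:R = m%:R + 1 :> R by rewrite natr1.
have hf : forall r r', 0 <= r -> r <= r' -> `|f r - f r'| <= (p * m.+1%:R) * (r' - r) ^+ 2.
  move=> r r' r0 rr'; set dl := r' - r.
  have dl0 : 0 <= dl by rewrite subr_ge0.
  have er' : r' = r + dl by rewrite /dl; ring.
  set e := expR (- (m.+1%:R * r)).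
  have e0 : 0 <= e by exact: expR_ge0.
  have e1 : e <= 1 by rewrite -expR0 ler_expR; rewrite oppr_le0 mulr_ge0.
  have q1 : q r - q r' = p * e * ((1 - expR (- (m.+1%:R * dl))) / m.+1%:R).
    rewrite /q er' mulrDr opprD expRD -/e; field; lra.
  have /andP[a1 a2] := expR_lin2 dl0.
  have Mdl0 : 0 <= m.+1%:R * dl by rewrite mulr_ge0.
  have /andP[b1 b2] := expR_lin2 Mdl0.
  have mdl0 : 0 <= m%:R * dl by rewrite mulr_ge0.
  have /andP[c1 c2] := expR_lin2 mdl0.
  have /andP[h1 h2] := HQ _ _ r0 rr'.
  have u1 : p * expR (- (r + m%:R * r)) - p * expR (- (r' + m%:R * r)) = p * e * (1 - expR (- dl)).
    have -> : r + m%:R * r = m.+1%:R * r by rewrite mM; ring.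
    have -> : - (r' + m%:R * r) = - (m.+1%:R * r) + (- dl) by rewrite er' mM; ring.
    by rewrite expRD -/e; ring.
  have l1 : p * expR (- (r + m%:R * r')) - p * expR (- (r' + m%:R * r')) =
      p * e * (expR (- (m%:R * dl)) * (1 - expR (- dl))).
    have -> : - (r + m%:R * r') = - (m.+1%:R * r) + (- (m%:R * dl)) by rewrite er' mM; ring.
    have -> : - (r' + m%:R * r') = - (m.+1%:R * r) + (- (m%:R * dl)) + (- dl) by rewrite er' mM; ring.
    by rewrite !expRD -/e; ring.
  rewrite u1 in h2; rewrite l1 in h1.
  have pe0 : 0 <= p * e by rewrite mulr_ge0.
  have pep : p * e <= p by rewrite ler_piMr.
  set A := 1 - expR (- dl) in a1 a2 h1 h2.
  have A0 : 0 <= A.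
    by rewrite /A subr_ge0 -expR0 ler_expR oppr_le0.
  set B := (1 - expR (- (m.+1%:R * dl))) / m.+1%:R in q1.
  have B2 : B <= dl by rewrite /B ler_pdivrMr// (mulrC dl).
  have B1 : dl - m.+1%:R * dl ^+ 2 <= B.
    rewrite /B ler_pdivlMr//; apply: le_trans b1.
    by rewrite le_eqVlt; apply/orP; left; apply/eqP; ring.
  have C1 : dl - m.+1%:R * dl ^+ 2 <= expR (- (m%:R * dl)) * A.
    apply: le_trans (_ : (1 - m%:R * dl) * A <= _); last by rewrite ler_wpM2r//; lra.
    rewrite mulrBl mul1r mM.
    have : m%:R * dl * A <= m%:R * dl * dl by rewrite ler_wpM2l.
    lra.
  have MD0 : 0 <= m.+1%:R * dl ^+ 2 by rewrite mulr_ge0 ?sqr_ge0.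
  have -> : f r - f r' = (Q r - Q r') - (q r - q r') by rewrite /f; ring.
  rewrite q1 -mulrA.
  have X1 : p * e * (m.+1%:R * dl ^+ 2) <= p * (m.+1%:R * dl ^+ 2) by rewrite ler_wpM2r.
  have X2 : p * e * A <= p * e * dl by rewrite ler_wpM2l.
  have X3 : p * e * B <= p * e * dl by rewrite ler_wpM2l.
  have X4 : p * e * (dl - m.+1%:R * dl ^+ 2) <= p * e * B by rewrite ler_wpM2l.
  have X5 : p * e * (dl - m.+1%:R * dl ^+ 2) <= p * e * (expR (- (m%:R * dl)) * A) by rewrite ler_wpM2l.
  rewrite mulrBr in X4 X5.
  rewrite ler_norml; apply/andP; split; lra.
have fc := quad_cst hf.
move=> r r0.
suff : f r = 0 by move/eqP; rewrite subr_eq0 => /eqP.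
apply/eqP; rewrite -normr_le0; apply/ler_addgt0Pl => e e0; rewrite addr0.
(* a time at which p * exp (- t), which bounds both functions, is at most e *)
pose t := r + 2 * p / e.
have t0 : 0 <= 2 * p / e by rewrite divr_ge0 ?mulr_ge0// ltW.
have rt : r <= t by rewrite /t lerDl.
have tt0 : 0 <= t by apply: le_trans rt.
rewrite (fc r t)//.
have q0 : 0 <= q t <= p * expR (- t).
  apply/andP; split; first by rewrite /q divr_ge0// mulr_ge0// expR_ge0.
  rewrite /q ler_pdivrMr//.
  have E1 : expR (- (m.+1%:R * t)) <= expR (- t).
    by rewrite ler_expR lerN2 ler_peMl// ler1n.
  have E2 : p * expR (- (m.+1%:R * t)) <= p * expR (- t) by rewrite ler_wpM2l.
  apply: le_trans E2 _; rewrite ler_peMr ?ler1n// mulr_ge0// expR_ge0.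
have [/andP[g1 g2] /andP[k1 k2]] := (Q0 t tt0, q0).
have Et : p * expR (- t) <= e.
  have P0 : 0 < 1 + t by lra.
  apply: le_trans (_ : p / (1 + t) <= _).
    by rewrite ler_wpM2l// expRN lef_pV2 ?posrE ?expR_gt0 ?expR_ge1Dx//.
  rewrite ler_pdivrMr// /t mulrDr mulr1 mulrDr.
  have -> : e * (2 * p / e) = 2 * p by field; lra.
  have : 0 <= e * r by rewrite mulr_ge0// ltW.
  lra.
rewrite /f ler_norml; apply/andP; split; lra.
Qed.

End quad.

Section race.
Context d (Omega : measurableType d) (R : realType) (P : probability Omega R).
Variable E : seq bool -> {RV P >-> R}.
Hypothesis hE : yule_clocks E.
Notation ring := (ring_time E).
Notation sclk U := (<<s clock_sets E U >>).
Notation mclk U W := (measurable_fun (setT : set (g_sigma_algebraType (clock_sets E U))) (W : Omega -> R)).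

(** Differs from [hevent (v :: h)] only in the conditions on the two leaves born
from v, which hold almost surely, and in the lower bound r on the waiting
time. *)
Definition race (h : seq (seq bool)) (v : seq bool) (D : set Omega) (r : R) : set Omega :=
  D `&` [set w | hordered E (v :: h) w] `&` [set w | htime E h w + r < ring v w] `&`
  [set w | forall u, u \in rem v (hleaves h) -> ring v w < ring u w].

Lemma race_measurable h v D r : hist (v :: h) -> sclk [set` h] D -> measurable (race h v D r).
Proof.
move=> hh sD; apply: (@sclk_measurableT _ _ _ _ E setT).
apply: gen_setI; last first.
  by apply: sclk_all => u _; apply: sclk_lt; exact: mclk_ring.
apply: gen_setI.
  apply: gen_setI.
    by apply: sub_sclk sD.
  exact: sclk_hordered.
apply: sclk_lt; last exact: mclk_ring.
apply: (@measurable_funD _ (g_sigma_algebraType (clock_sets E setT))) => //.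
by apply: mclk_htime => //; case/andP: hh.
Qed.

Lemma residual_pr h D rho : hist h -> sclk [set` h] D -> (forall u, 0 <= rho u) ->
  pr P (residual E h D rho) = pr P (D `&` hevent E h) * expR (- \sum_(u <- hleaves h) rho u).
Proof.
move=> hh sD r0; apply: EFin_inj; rewrite EFinM -!prE; last 2 first.
- by have := @residual_measurable _ _ _ _ E h D (fun=> 0) hh sD; rewrite residual0.
- exact: residual_measurable.
by rewrite (residual_tail hE)// residual0.
Qed.

(** The leaf v wins between r and r' if it rings in that interval while all other
leaves live until r', and only if they live until r.  Both events are
differences of events of [residual_tail], as [race_solve] requires. *)
Lemma race_pr h v D r : hist (v :: h) -> sclk [set` h] D -> 0 <= r ->
  pr P (race h v D r) = pr P (D `&` hevent E h) * expR (- ((size h).+1%:R * r)) / (size h).+1%:R.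
Proof.
move=> hvh sD; have /andP[vh hh] := hvh.
have mR := @race_measurable h v D _ hvh sD.
have mH := @residual_measurable _ _ _ _ E h D _ hh sD.
move: r; apply: race_solve; first exact: pr_ge0.
- move=> r r0; rewrite pr_ge0/=.
  pose rho u : R := if u == v then r else 0.
  have rhov : rho v = r by rewrite /rho eqxx.
  have := @residual_pr h D rho hh sD; rewrite (big_rem v vh)/= rhov.
  rewrite big1_seq ?addr0; last first.
    move=> u /andP[_]; rewrite mem_rem_uniq ?hleaves_uniq// !inE => /andP[uv _].
    by rewrite /rho (negbTE uv).
  move=> <-; last by move=> u; rewrite /rho; case: ifP.
  apply: le_pr => //.
  move=> w [[[Dw /= [lt o]] /= l2] h1]; split => // u uh.
  rewrite /rho; case: eqVneq => [->//|uv].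
  rewrite addr0; apply: lt_trans lt (h1 _ _).
  by rewrite mem_rem_uniq ?hleaves_uniq// !inE uv.
- move=> r r' r0 rr'.
  have r'0 : 0 <= r' by apply: le_trans rr'.
  have tail a b : 0 <= a -> 0 <= b ->
      pr P (residual E h D (fun u => if u == v then a else b)) =
      pr P (D `&` hevent E h) * expR (- (a + (size h)%:R * b)).
    move=> a0 b0; rewrite residual_pr//; last by move=> u; case: ifP.
    congr (_ * expR (- _)); rewrite (big_rem v vh)/= eqxx; congr (_ + _).
    under eq_big_seq => u.
      by rewrite mem_rem_uniq ?hleaves_uniq// !inE => /andP[uv _]; rewrite (negbTE uv); over.
    by rewrite big_const_seq count_predT size_rem// size_hleaves//= iter_addr addr0 mulr_natl.
  have raceD : pr P (race h v D r) - pr P (race h v D r') =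
     pr P (race h v D r `\` race h v D r').
    rewrite (@pr_split _ _ _ P (race h v D r) (race h v D r'))//.
    have -> : race h v D r `&` race h v D r' = race h v D r'.
      apply/seteqP; split => [w []//|w h1]; split => //; move: h1.
      move=> [[[Dw o] l2] h1]; split => //; split => //=; move: l2 => /=; lra.
    by rewrite addrAC subrr add0r.
  have residualD a b a' : a <= a' ->
     pr P (residual E h D (fun u => if u == v then a else b)) -
     pr P (residual E h D (fun u => if u == v then a' else b)) =
     pr P (residual E h D (fun u => if u == v then a else b) `\`
           residual E h D (fun u => if u == v then a' else b)).
    move=> aa'; rewrite (@pr_split _ _ _ P (residual E h D (fun u => if u == v then a else b))
      (residual E h D (fun u => if u == v then a' else b)))//.
    set X := (X in pr P X + _ - pr P _); set Y := (X in _ - pr P X).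
    have -> : X = Y.
      apply/seteqP; split => [w []//|w h1]; split => //; move: h1.
      move=> [? h1]; split => // u uh; have := h1 u uh; case: ifP => //; lra.
    by rewrite addrAC subrr add0r.
  have mDf (A B : set Omega) : measurable A -> measurable B -> measurable (A `\` B).
    by move=> *; exact: measurableD.
  rewrite raceD; apply/andP; split.
  + rewrite -!tail// residualD//; apply: le_pr; [exact: mDf|exact: mDf|].
    move=> w [[[Dw o] h1] h2].
    have h3 : ring v w <= htime E h w + r'.
      rewrite leNgt; apply/negP => h3; apply: h2; split => // u uh.
      by have := h1 u uh; case: eqVneq => // ->.
    have l1 := h1 v vh; rewrite eqxx in l1.
    split; last by move=> [[_ /=]]; lra.
    split.
      split => //; split => //=; split => //=; lra.
    move=> u; rewrite mem_rem_uniq ?hleaves_uniq// !inE => /andP[uv uh].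
    have := h1 u uh; rewrite (negbTE uv); lra.
  + rewrite -!tail// residualD//; apply: le_pr; [exact: mDf|exact: mDf|].
    move=> w [[[[Dw /= [l0 o]] /= l1] h1] h2].
    have h3 : ring v w <= htime E h w + r'.
      rewrite leNgt; apply/negP => h3; apply: h2; split => //; split => //.
    split; last by move=> [_ /(_ v vh)]; rewrite eqxx; lra.
    split => // u uh; case: eqVneq => [->//|uv].
    have := h1 u; rewrite mem_rem_uniq ?hleaves_uniq// !inE uv => /(_ uh); lra.
Qed.

(** Clocks are almost surely positive: this removes the event that a newborn
leaf rings at once, on which [race] and the next [hevent] differ. *)
Lemma clock_gt0 u : P [set w | E u w <= 0] = 0%E.
Proof.
have -> : [set w | E u w <= 0] = ~` [set w | 0 < E u w].
  by apply/seteqP; split => w /=; rewrite leNgt => /negP.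
rewrite probability_setC ?(clock_tail hE)//.
  by rewrite oppr0 expR0 subee.
by have := @measurable_gtE _ _ _ P E u (cst 0); apply.
Qed.
(** The next leaf to split is uniform among the n + 1 leaves and the waiting
time is exponential of parameter n + 1, independently of what is known of the
clocks of h. *)
Lemma hevent_step h v D r : hist (v :: h) -> sclk [set` h] D -> 0 <= r ->
  P (D `&` hevent E (v :: h) `&` [set w | htime E h w + r < ring v w]) =
  (pr P (D `&` hevent E h) * expR (- ((size h).+1%:R * r)) / (size h).+1%:R)%:E.
Proof.
move=> hvh sD r0; rewrite -(race_pr hvh sD r0) -prE; last exact: race_measurable.
set A := D `&` _ `&` _.
have mA : measurable A.
  apply: (@sclk_measurableT _ _ _ _ E setT).
  have hh : hist h by case/andP: hvh.
  apply: gen_setI; last first.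
    apply: sclk_lt; last exact: mclk_ring.
    apply: (@measurable_funD _ (g_sigma_algebraType (clock_sets E setT))) => //.
    by apply: mclk_htime => //; case/andP: hvh.
  apply: gen_setI.
    by apply: sub_sclk sD.
  apply: gen_setI.
    exact: (@sclk_hordered _ _ _ _ E setT (v :: h)).
  by apply: sclk_all => u _; apply: sclk_lt; exact: mclk_ring.
have mN u : measurable [set w | E u w <= 0].
  have -> : [set w | E u w <= 0] = E u @^-1` `]-oo, 0]%classic.
    by apply/seteqP; split => w /=; rewrite in_itv.
  exact: measurable_clock.
pose N := [set w | E (rcons v false) w <= 0] `|` [set w | E (rcons v true) w <= 0].
have mNN : measurable N by exact: measurableU.
have N0 : P N = 0%E.
  apply/eqP; rewrite -measure_le0.
  apply: le_trans (measureU2 _ _ _) _; rewrite ?mN//.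
  have cl b : (P [set w | (E (rcons v b) w <= 0)%R] <= 0)%E by rewrite clock_gt0.
  by rewrite -[leRHS]adde0; apply: leeD; exact: cl.
apply/eqP; rewrite eq_le; apply/andP; split.
  apply: le_measure; rewrite ?inE//; first exact: race_measurable.
  move=> w [[Dw [ho h1]] l]; split; first by split.
  by move=> u uh; apply: h1; rewrite !in_cons uh !orbT.
apply: le_trans (_ : (P (A `|` N) <= _)%E).
  apply: le_measure; rewrite ?inE; [exact: race_measurable|exact: measurableU|].
  move=> w [[[Dw o] l] h1].
  have [|nN] := pselect (N w); first by right.
  left; split => //; split => //; split => // u.
  rewrite !in_cons => /or3P[/eqP ->|/eqP ->|]; last exact: h1.
    rewrite (ring_birth E (rcons _ _)) birth_rcons ltrDl ltNge; apply/negP => h2.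
    by apply: nN; left.
  rewrite (ring_birth E (rcons _ _)) birth_rcons ltrDl ltNge; apply/negP => h2.
  by apply: nN; right.
apply: le_trans (measureU2 _ mA mNN) _.
by rewrite [X in (_ + X)%E]N0 adde0.
Qed.

End race.

(** * The tree as a function of the clocks *)

Lemma card_fset_set_seq (s : seq (seq bool)) : uniq s -> #|` fset_set [set` s]| = size s.
Proof.
move=> us; have -> : [set` s] = [set` [fset x in s]%fset].
  by apply/seteqP; split => x /=; rewrite inE.
by rewrite set_fsetK card_fseq undup_id.
Qed.

Section pathwise.
Context d (Omega : measurableType d) (R : realType) (P : probability Omega R).
Variable E : seq bool -> {RV P >-> R}.
Notation ring := (ring_time E).

Implicit Types (t s : R) (w : Omega) (u v : seq bool).

Lemma yule_tree_mono s t w : s <= t -> yule_tree E s w `<=` yule_tree E t w.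
Proof. by move=> st u h k ku; apply: le_trans (h k ku) st. Qed.

Lemma leavesE t w u : leaves (yule_tree E t w) u <-> yule_tree E t w u /\ t < ring u w.
Proof.
split=> [[Tu nT]|[Tu tu]]; split => //.
  rewrite ltNge; apply/negP => ut; apply: (nT [:: false]) => // k.
  rewrite size_cat addn1 ltnS leq_eqVlt => /orP[/eqP ->|ku].
    by rewrite take_size_cat.
  by rewrite take_cat ku; exact: Tu.
case=> // b v _ /(_ (size u)); rewrite size_cat/= -[X in (X < _)%N]addn0 ltn_add2l => /(_ isT).
by rewrite take_size_cat// leNgt tu.
Qed.

Lemma leaves_rcons t w u : leaves (yule_tree E t w) u <->
  yule_tree E t w u /\ ~ yule_tree E t w (rcons u false).
Proof.
rewrite leavesE; split=> -[Tu h]; split => //.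
  move=> /(_ (size u)); rewrite size_rcons ltnSn -cats1 take_size_cat// => /(_ isT).
  by rewrite leNgt h.
rewrite ltNge; apply/negP => ut; apply: h => k; rewrite size_rcons ltnS leq_eqVlt.
by move=> /orP[/eqP ->|ku]; rewrite -cats1 take_cat ?ku ?ltnn ?subnn ?cats0//; exact: Tu.
Qed.

Lemma leaves_persist s t w u : s <= t -> t < ring u w ->
  leaves (yule_tree E s w) u -> leaves (yule_tree E t w) u.
Proof.
move=> st tu /leavesE[Tu _]; apply/leavesE; split => //.
exact: yule_tree_mono Tu.
Qed.

(** The shortest prefix of u that has not rung at time s is a leaf at that time. *)
Lemma leaves_ancestor s t w u : s <= t -> leaves (yule_tree E t w) u ->
  exists k, leaves (yule_tree E s w) (take k u).
Proof.
move=> st /leavesE[Tu tu].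
have ex : exists k, s < ring (take k u) w.
  by exists (size u); rewrite take_size; exact: le_lt_trans tu.
exists (ex_minn ex); case: ex_minnP => k sk kmin; apply/leavesE; split => // j.
rewrite size_take_min leq_min => /andP[jk' _].
rewrite take_takel ?(ltnW jk')// leNgt; apply/negP => /kmin.
by rewrite leqNgt jk'.
Qed.

Lemma leaves_antichain t w u k : leaves (yule_tree E t w) u ->
  leaves (yule_tree E t w) (take k u) -> take k u = u.
Proof.
move=> [Tu _] [_ h]; apply/eqP; apply: contrapT => ku.
apply: (h (drop k u)); last by rewrite cat_take_drop.
apply: contra_not_neq ku => e.
by apply/eqP; rewrite -[RHS](cat_take_drop k u) e cats0.
Qed.

Lemma seq_delta t (s : seq (seq bool)) w : (forall u, u \in s -> t < ring u w) ->
  exists2 t', t < t' & forall u, u \in s -> t' <= ring u w.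
Proof.
elim: s => [_|x s IH h]; first by exists (t + 1) => //; rewrite ltrDl.
have [|t' tt' h'] := IH; first by move=> u us; apply: h; rewrite in_cons us orbT.
have tx : t < ring x w by apply: h; rewrite mem_head.
exists (Num.min t' (ring x w)); first by rewrite lt_min tt'.
move=> u; rewrite in_cons => /orP[/eqP ->|us]; rewrite ge_min ?lexx ?orbT//.
by rewrite h'.
Qed.

(** When there are finitely many leaves, none of them rings during a short time.
The other leaves of a later tree would descend from one of them. *)
Lemma leaves_right_cst t w : finite_set (leaves (yule_tree E t w)) ->
  exists2 t', t < t' & forall s, t <= s -> s < t' ->
    leaves (yule_tree E s w) = leaves (yule_tree E t w).
Proof.
move=> fL; set L := leaves _ in fL *.
have [|t' tt' h] := @seq_delta t (fset_set L) w.
  by move=> u; rewrite in_fset_set// inE => /leavesE[].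
exists t' => // s ts st'.
have LL : L `<=` leaves (yule_tree E s w).
  move=> u Lu; apply: (leaves_persist ts _ Lu); apply: lt_le_trans st' _.
  by apply: h; rewrite in_fset_set// inE.
apply/seteqP; split => // u Lu.
have [k Lk] := leaves_ancestor ts Lu.
by rewrite -(leaves_antichain Lu (LL _ Lk)).
Qed.

Lemma yule_N_fin t w n : yule_N E t w = n.+1 -> finite_set (leaves (yule_tree E t w)).
Proof.
move=> Ns; apply: contrapT => nf; move: Ns; rewrite /yule_N.
have -> : fset_set (leaves (yule_tree E t w)) = fset0.
  by rewrite /fset_set; case: pselect.
by rewrite cardfs0.
Qed.

(** Right-continuity of the event that there are n + 1 leaves, also on the paths
with infinitely many leaves: these have too many leaves just after t. *)
Lemma yule_N_right t w n : exists2 t', t < t' & forall s, t < s -> s < t' ->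
   (yule_N E s w == n.+1) = (yule_N E t w == n.+1).
Proof.
have [fL|iL] := pselect (finite_set (leaves (yule_tree E t w))).
  have [t' tt' h] := leaves_right_cst fL; exists t' => // s ts st'.
  by rewrite /yule_N h// ltW.
have [B BL Bn] := infinite_set_fset n.+2 iL.
have [|t' tt' h] := @seq_delta t B w.
  by move=> u uB; have := BL u uB => /leavesE[].
exists t' => // s ts st'.
rewrite [RHS](_ : _ = false); last by apply/negbTE/eqP => /yule_N_fin.
apply/negbTE/eqP => Ns.
have BLs : [set` B] `<=` leaves (yule_tree E s w).
  move=> u uB; apply: (leaves_persist (ltW ts) _ (BL u uB)).
  exact: lt_le_trans st' (h _ uB).
have fLs := yule_N_fin Ns.
have : (#|` B| <= yule_N E s w)%N.
  apply: fsubset_leq_card; apply/fsubsetP => u uB; rewrite in_fset_set// inE.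
  exact: BLs.
by rewrite Ns => h1; have := leq_trans Bn h1; rewrite ltnn.
Qed.

(** By right-continuity the infimum that defines the splitting time can be
sampled at rational times, so that it is a stopping time of the raw
filtration. *)
Lemma yule_tau_le n w t :  0 <= t -> (yule_tau E n w <= t%:E)%E <->
  exists s, [/\ 0 <= s, s <= t, yule_N E s w = n.+1 & s = t \/ exists q : rat, s = ratr q].
Proof.
move=> t0; split; last first.
  move=> [s [s0 st Ns _]]; apply: ge_ereal_inf; exists s%:E; last by rewrite lee_fin.
  by exists s.
move=> taut.
have [Nt|Nt] := eqVneq (yule_N E t w) n.+1.
  by exists t; split => //; left.
have [t' tt' ht'] := yule_N_right t w n.
have : (yule_tau E n w < t'%:E)%E by apply: le_lt_trans taut _; rewrite lte_fin.
move=> /ereal_inf_lt[_ [s [s0 Ns] <-]]; rewrite lte_fin => st'.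
have st : s < t.
  rewrite ltNge le_eqVlt; apply/negP => /orP[/eqP ts|ts].
    by move: Nt; rewrite ts Ns eqxx.
  by have := ht' s ts st'; rewrite Ns eqxx (negbTE Nt).
have [s' ss' hs'] := yule_N_right s w n.
have : s < Num.min s' t by rewrite lt_min ss'.
move=> /rat_in_itvoo[q]; rewrite in_itv/= lt_min => /and3P[sq qs' qt].
exists (ratr q); split.
- exact: le_trans (ltW sq).
- exact: ltW.
- by apply/eqP; rewrite hs'// Ns.
- by right; exists q.
Qed.

Definition yule_gen (t : R) : set (set Omega) :=
  [set A | exists s u, 0 <= s <= t /\ A = [set w | yule_tree E s w u]].

Notation yF t := (<<s yule_gen t >>).

Lemma yF_leaf t s u : 0 <= s <= t -> yF t [set w | leaves (yule_tree E s w) u].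
Proof.
move=> st; rewrite (_ : [set _ | _] =
    [set w | yule_tree E s w u] `\` [set w | yule_tree E s w (rcons u false)]); last first.
  by apply/seteqP; split => w /= /leaves_rcons.
apply: gen_setD;
  apply: sub_sigma_algebra; by eexists _, _; split; first exact: st.
Qed.

Lemma yF_N t s n : 0 <= s <= t -> yF t [set w | yule_N E s w = n.+1].
Proof.
move=> st.
rewrite (_ : [set _ | _] = \bigcup_(l : seq (seq bool)) (if uniq l && (size l == n.+1) then
   ~` \bigcup_(u : seq bool) (if u \in l then ~` [set w | leaves (yule_tree E s w) u]
     else [set w | leaves (yule_tree E s w) u]) else set0)).
  apply: gen_countable_bigcup.
    exact: countableP.
  move=> l; case: ifP => _; last exact: gen_set0.
  apply: gen_setC.
  apply: gen_countable_bigcup.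
    exact: countableP.
  move=> u; case: ifP => _; last exact: yF_leaf.
  by apply: gen_setC; exact: yF_leaf.
apply/seteqP; split => w /=.
  move=> Ns; have fLs := yule_N_fin Ns.
  exists (fset_set (leaves (yule_tree E s w))) => //.
  rewrite fset_uniq /= -[size _]/(#|` _|) -/(yule_N E s w) Ns eqxx.
  by move=> [u _]; case: ifPn; rewrite in_fset_set// ?inE ?notin_setE.
move=> [l _]; case: ifP => // /andP[ul /eqP sl] h.
rewrite /yule_N; have -> : leaves (yule_tree E s w) = [set` l].
  apply/seteqP; split => u /=.
    move=> Lu; apply: contrapT => /negP ul'; apply: h.
    by exists u => //; rewrite (negbTE ul').
  move=> ul'; apply: contrapT => nL; apply: h; exists u => //.
  by rewrite ul'.
by rewrite card_fset_set_seq.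
Qed.

Lemma yF_tau n t : 0 <= t -> yF t [set w | (yule_tau E n w <= t%:E)%E].
Proof.
move=> t0.
have -> : [set w | (yule_tau E n w <= t%:E)%E] = [set w | yule_N E t w = n.+1] `|`
  \bigcup_(q : rat) (if ((0 : R) <= ratr q) && ((ratr q : R) <= t) then
     [set w | yule_N E (ratr q) w = n.+1] else set0).
  apply/seteqP; split => w /=.
    move=> /(yule_tau_le _ _ t0)[s [s0 st Ns]] [<-|[q sq]]; first by left.
    by right; exists q => //; rewrite -sq s0 st.
  case=> [Nt|[q _]].
    by apply/(yule_tau_le _ _ t0); exists t; split => //; left.
  case: ifP => // /andP[q0 qt] /= Nq.
  by apply/(yule_tau_le _ _ t0); exists (ratr q); split => //; right; exists q.
apply: (@measurableU _ (g_sigma_algebraType (yule_gen t))).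
  by apply: yF_N; rewrite t0 lexx.
apply: gen_countable_bigcup.
  exact: countableP.
move=> q; case: ifPn => h; last exact: gen_set0.
exact: yF_N.
Qed.

Lemma measurable_ring u : measurable_fun setT (ring u).
Proof.
exact: (mclk_measurable (U := setT) (mclk_ring (U := setT) _)).
Qed.

Lemma measurable_tree t u : measurable [set w | yule_tree E t w u].
Proof.
rewrite (_ : [set _ | _] = \big[setI/setT]_(k < size u) [set w | ring (take k u) w <= t]).
  apply: bigsetI_measurable => k _.
  rewrite (_ : [set _ | _] = setT `&` ring (take k u) @^-1` `]-oo, t]%classic).
    exact: measurable_ring.
  by rewrite setTI; apply/seteqP; split => w /=; rewrite in_itv.
rewrite -(bigcap_mkord _ (fun k => [set w | ring (take k u) w <= t])).
by apply/seteqP; split.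
Qed.

Lemma yF_measurable t : yF t `<=` measurable.
Proof.
apply: sigma_sub_measurable => _ [s [u [_ ->]]]; exact: measurable_tree.
Qed.

Lemma measurable_tau n : measurable_fun setT (yule_tau E n).
Proof.
apply: (@measurability _ _ _ _ _ _ (@ErealGenOInfty.G R) (ErealGenOInfty.measurableE R)) => //.
move=> _ [_ [r ->] <-]; rewrite setTI.
have -> : yule_tau E n @^-1` `]r%:E, +oo[%classic = ~` [set w | (yule_tau E n w <= r%:E)%E].
  by apply/seteqP; split => w /=; rewrite in_itv/= ?andbT ltNge => /negP.
apply: measurableC; have [r0|r0] := leP (0 : R) r.
  exact: (yF_measurable (yF_tau n r0)).
have -> : [set w | (yule_tau E n w <= r%:E)%E] = set0; last exact: measurable0.
apply/seteqP; split => // w /= h.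
have t0 : (0%:E <= yule_tau E n w)%E by apply/ereal_infP => _ [s [s0 _] <-]; rewrite lee_fin.
by have := le_trans t0 h; rewrite lee_fin leNgt r0.
Qed.

(** Real-valued splitting times; the value 0 is taken on the null event that the
split never occurs. *)
Definition tau n w : R := fine (yule_tau E n w).

Lemma measurable_tauR n : measurable_fun setT (tau n).
Proof.
apply: (@measurableT_comp _ _ _ _ _ _ fine); first exact: fine_measurable.
exact: measurable_tau.
Qed.
Definition tree_of (h : seq (seq bool)) : set (seq bool) :=
  [set u | forall k, (k < size u)%N -> take k u \in h].

Lemma leaves_tree_of h : hist h -> leaves (tree_of h) = [set` hleaves h].
Proof.
move=> hh; apply/seteqP; split => u /=.
  move=> [Tu nT]; apply/(hleavesP u hh); split => //; apply/negP => uh.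
  apply: (nT [:: false]) => // k.
  rewrite size_cat addn1 ltnS leq_eqVlt => /orP[/eqP ->|ku].
    by rewrite take_size_cat.
  by rewrite take_cat ku; exact: Tu.
move=> /(hleavesP u hh)[Tu unh]; split => //.
case=> // b v _ /(_ (size u)); rewrite size_cat/= -[X in (X < _)%N]addn0 ltn_add2l => /(_ isT).
by rewrite take_size_cat// (negbTE unh).
Qed.

Lemma hordered_le h w x : hordered E h w -> x \in h -> ring x w <= htime E h w.
Proof.
elim: h => // v h IH /= [lt ho]; rewrite in_cons => /orP[/eqP ->//|xh].
exact: le_trans (IH ho xh) (ltW lt).
Qed.

Lemma yule_tree_hist h w t : hist h -> hordered E h w -> htime E h w <= t ->
  (forall u, u \in hleaves h -> t < ring u w) -> yule_tree E t w = tree_of h.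
Proof.
move=> hh ho ht hl; apply/seteqP; split => u Tu.
  move=> k; elim/ltn_ind: k => k IH ku.
  apply: contrapT => /negP nh.
  have : take k u \in hleaves h.
    apply/(hleavesP _ hh); split => // j; rewrite size_takel ?(ltnW ku)// => jk.
    rewrite take_takel ?(ltnW jk)//; apply: IH => //; exact: ltn_trans jk ku.
  by move=> /hl; rewrite ltNge Tu.
by move=> k ku; apply: le_trans ht; apply: hordered_le => //; exact: Tu.
Qed.

Lemma yule_N_hist h w t : hist h -> hordered E h w -> htime E h w <= t ->
  (forall u, u \in hleaves h -> t < ring u w) -> yule_N E t w = (size h).+1.
Proof.
move=> hh ho ht hl; rewrite /yule_N (yule_tree_hist hh ho ht hl) leaves_tree_of//.
by rewrite card_fset_set_seq ?hleaves_uniq// size_hleaves.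
Qed.

(** Between two consecutive splits of h the number of leaves is that of the shorter
history. *)
Lemma yule_N_lt h w t : hist h -> hevent E h w -> 0 <= t -> t < htime E h w ->
  (yule_N E t w < (size h).+1)%N.
Proof.
elim: h => [_ _ t0 /=|v h IH hvh hw t0 tv]; first by rewrite ltNge t0.
have /andP[vh hh] := hvh; have hw' := hevent_cons hvh hw.
have [ht|ht] := leP (htime E h w) t.
  rewrite (@yule_N_hist h)//; first by case: hw' => ho _.
  move=> u uh; apply: lt_le_trans tv _; rewrite /=.
  have [->//|uv] := eqVneq u v.
  case: hw => _ /(_ u); rewrite !in_cons mem_rem_uniq ?hleaves_uniq// !inE uv uh !orbT.
  by move=> /(_ isT)/ltW.
exact: ltn_trans (IH hh hw' t0 ht) _.
Qed.

Lemma yule_tau_hist h w : hist h -> hevent E h w -> yule_tau E (size h) w = (htime E h w)%:E.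
Proof.
move=> hh hw; have [ho hl] := hw; have [h0 _] := hordered_birth hh ho.
apply/eqP; rewrite eq_le; apply/andP; split.
  apply: ereal_inf_lbound; exists (htime E h w) => //; split => //.
  exact: yule_N_hist.
apply/ereal_infP => _ [s [s0 Ns] <-]; rewrite lee_fin leNgt; apply/negP => sh.
by have := yule_N_lt hh hw s0 sh; rewrite Ns ltnn.
Qed.

Lemma tau_hist h w : hist h -> hevent E h w -> tau (size h) w = htime E h w.
Proof. by move=> hh hw; rewrite /tau yule_tau_hist. Qed.

Lemma bst_hist h w : hist h -> hevent E h w -> bst E (size h) w = tree_of h.
Proof.
move=> hh hw; rewrite /bst -/(tau _ _) tau_hist//; have [ho hl] := hw.
exact: yule_tree_hist.
Qed.

End pathwise.

(** * Law of the next split given the past *)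

Section jump.
Context d (Omega : measurableType d) (R : realType) (P : probability Omega R).
Variable E : seq bool -> {RV P >-> R}.
Hypothesis hE : yule_clocks E.
Notation ring := (ring_time E).
Notation pr := (pr P).
Notation hevent := (hevent E).
Notation tau := (tau E).
Notation sclk U := (<<s clock_sets E U >>).
Notation mclk U W := (measurable_fun (setT : set (g_sigma_algebraType (clock_sets E U))) (W : Omega -> R)).

Lemma hevent_measurable h : hist h -> measurable (hevent h).
Proof.
move=> hh; have := @residual_measurable _ _ _ _ E h setT (fun=> 0) hh (@gen_setT _ _ (clock_sets E [set` h])).
by rewrite residual0 setTI.
Qed.

Lemma pr_set0 : pr set0 = 0.
Proof. by rewrite /pr measure0. Qed.

Definition next_events (s : seq (seq bool)) h : set Omega :=
  [set w | exists2 v, v \in s & hevent (v :: h) w].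

Lemma hevent_disj h v v' w : hist h -> v \in hleaves h -> v' \in hleaves h -> v != v' ->
  hevent (v :: h) w -> hevent (v' :: h) w -> False.
Proof.
move=> hh vh vh' vv' [_ h1] [_ h2]; have v'v : v' != v by rewrite eq_sym.
have := h1 v'; rewrite !in_cons mem_rem_uniq ?hleaves_uniq// !inE v'v vh' !orbT => /(_ isT) /= l1.
have := h2 v; rewrite !in_cons mem_rem_uniq ?hleaves_uniq// !inE vv' vh !orbT => /(_ isT) /= l2.
by have := lt_trans l1 l2; rewrite ltxx.
Qed.

Lemma next_events_measurable s h : hist h -> {subset s <= hleaves h} -> measurable (next_events s h).
Proof.
move=> hh; elim: s => [_|v s IH sl].
  by rewrite (_ : next_events _ _ = set0)//; apply/seteqP; split => // w [].
have -> : next_events (v :: s) h = hevent (v :: h) `|` next_events s h.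
  apply/seteqP; split => w.
    by move=> [x]; rewrite in_cons => /orP[/eqP ->|xs] hx; [left|right; exists x].
  case=> [hv|[x xs hx]]; first by exists v; rewrite ?mem_head.
  by exists x; rewrite // in_cons xs orbT.
apply: measurableU.
  by apply: hevent_measurable; rewrite /= hh sl// mem_head.
by apply: IH => x xs; apply: sl; rewrite in_cons xs orbT.
Qed.

Lemma pr_next_events s h A : hist h -> {subset s <= hleaves h} -> uniq s -> measurable A ->
  pr (A `&` next_events s h) = \sum_(v <- s) pr (A `&` hevent (v :: h)).
Proof.
move=> hh + + mA; elim: s => [_ _|v s IH sl /= /andP[vs us]].
  rewrite big_nil (_ : _ `&` _ = set0) ?pr_set0//.
  by apply/seteqP; split => // w [_ []].
have sl' : {subset s <= hleaves h} by move=> x xs; apply: sl; rewrite in_cons xs orbT.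
have vh : v \in hleaves h by apply: sl; rewrite mem_head.
have mv : measurable (hevent (v :: h)) by apply: hevent_measurable; rewrite /= hh vh.
rewrite big_cons -IH// (@pr_split _ _ _ P _ (hevent (v :: h)))//; last first.
  by apply: measurableI => //; exact: next_events_measurable.
congr (pr _ + pr _); apply/seteqP; split => w.
- by move=> [[? _] ?].
- by move=> [? hv]; do 2!split => //; exists v; rewrite ?mem_head.
- move=> [[Aw [x]]]; rewrite in_cons => /orP[/eqP ->//|xs] hx nv; split => //.
  by exists x.
- move=> [Aw [x xs hx]]; split.
    by split => //; exists x; rewrite // in_cons xs orbT.
  move=> hv; apply: (@hevent_disj h v x w) => //; first exact: sl'.
  by apply/eqP => vx; rewrite vx xs in vs.
Qed.

Lemma pr_hevent_cons v h : hist (v :: h) -> pr (hevent (v :: h)) = pr (hevent h) / (size h).+1%:R.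
Proof.
move=> hvh; have /andP[vh hh] := hvh.
have := @hevent_step _ _ _ _ _ hE h v setT 0 hvh (@gen_setT _ _ (clock_sets E [set` h])) (lexx _).
rewrite mulr0 oppr0 expR0 mulr1 !setTI.
have -> : hevent (v :: h) `&` [set w | htime E h w + 0 < ring v w] = hevent (v :: h).
  by apply/seteqP; split => [w []//|w hv]; split => //=; case: hv => -[/= l _] _; rewrite addr0.
by rewrite prE; [case|exact: hevent_measurable].
Qed.

Lemma sum_hleaves h (c : R) : hist h -> \sum_(v <- hleaves h) c = c * (size h).+1%:R.
Proof.
by move=> hh; rewrite big_const_seq count_predT size_hleaves// iter_addr addr0 mulr_natr.
Qed.

(** The events that the next split occurs at v are disjoint and their
probabilities add up to that of [hevent h], by [pr_hevent_cons]. *)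
Lemma pr_hevent_next h A : hist h -> measurable A ->
  pr (A `&` hevent h) = \sum_(v <- hleaves h) pr (A `&` hevent (v :: h)).
Proof.
move=> hh mA; have mN : measurable (next_events (hleaves h) h) by exact: next_events_measurable.
have mH := hevent_measurable hh.
have sub : next_events (hleaves h) h `<=` hevent h.
  by move=> w [v vh]; apply: hevent_cons; rewrite /= vh hh.
have z : pr (hevent h `\` next_events (hleaves h) h) = 0.
  have := @pr_split _ _ _ P (hevent h) _ mH mN.
  rewrite setIidr// -[next_events _ _ in X in X + _]setTI pr_next_events ?hleaves_uniq//.
  rewrite (eq_big_seq (fun=> pr (hevent h) / (size h).+1%:R)); last first.
    by move=> v vh; rewrite setTI pr_hevent_cons//= vh hh.
  rewrite sum_hleaves// divfK ?pnatr_eq0//.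
  by move=> /eqP; rewrite -subr_eq0 opprD addrA subrr sub0r oppr_eq0 => /eqP.
rewrite -pr_next_events ?hleaves_uniq// (@pr_split _ _ _ P (A `&` hevent h) (next_events (hleaves h) h))//; last first.
  exact: measurableI.
have -> : A `&` hevent h `&` next_events (hleaves h) h = A `&` next_events (hleaves h) h by rewrite -setIA (setIidr sub).
suff -> : pr (A `&` hevent h `\` next_events (hleaves h) h) = 0 by rewrite addr0.
apply/eqP; rewrite eq_le pr_ge0 andbT -z; apply: le_pr.
- by apply: measurableD => //; exact: measurableI.
- exact: measurableD.
- by move=> w [[_ hw] nw].
Qed.

Fixpoint hists n : seq (seq (seq bool)) :=
  if n is n'.+1 then flatten [seq [seq v :: h | v <- hleaves h] | h <- hists n'] else [:: [::]].

Lemma hists_hist n h : h \in hists n -> hist h /\ size h = n.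
Proof.
elim: n h => [h|n IH h /=]; first by rewrite inE => /eqP ->.
move=> /flattenP[s /mapP[h' /IH[hh' sh'] ->]] /mapP[v vh' ->].
by rewrite /= vh' hh' sh'.
Qed.

Lemma pr_hists n A : measurable A -> pr A = \sum_(h <- hists n) pr (A `&` hevent h).
Proof.
move=> mA; elim: n => [|n ->] /=.
  rewrite big_seq1 (@pr_split _ _ _ P A (hevent [::]))//; last exact: hevent_measurable.
  rewrite [X in _ + X](_ : _ = 0) ?addr0//.
  have e : hevent [::] = [set w | 0 < E [::] w].
    apply/seteqP; split => w.
      by move=> [_ /(_ [::])]; rewrite inE eqxx ring_birth /birth big_ord0 add0r => /(_ isT).
    by move=> h; split => // u; rewrite inE => /eqP ->; rewrite ring_birth /birth big_ord0 add0r.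
  apply/eqP; rewrite eq_le pr_ge0 andbT.
  have <- : pr (~` hevent [::]) = 0.
    rewrite /(pr _) probability_setC; last exact: hevent_measurable.
    by rewrite e (clock_tail hE)// oppr0 expR0 subee.
  apply: le_pr.
  - by apply: measurableD => //; exact: hevent_measurable.
  - by apply: measurableC; exact: hevent_measurable.
  - by move=> w [].
rewrite big_flatten/= big_map; apply: eq_big_seq => h /hists_hist[hh _].
by rewrite big_map pr_hevent_next.
Qed.

(** The probabilities of the n! events [hevent h] add up to 1. *)
Lemma hevent_ae n : P (~` [set w | exists h, [/\ hist h, size h = n & hevent h w]]) = 0%E /\
  measurable [set w | exists h, [/\ hist h, size h = n & hevent h w]].
Proof.
set B := [set w | _].
have mB : measurable B.
  rewrite (_ : B = \bigcup_(h : seq (seq bool)) (if hist h && (size h == n) then hevent h else set0)).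
    apply: countable_bigcupT_measurable; first exact: countableP.
    by move=> h; case: ifP => // /andP[hh _]; exact: hevent_measurable.
  apply/seteqP; split => w.
    by move=> [h [hh sh hw]]; exists h => //; rewrite hh sh eqxx.
  by move=> [h _]; case: ifP => // /andP[hh /eqP sh] hw; exists h.
split => //; have mC : measurable (~` B) by exact: measurableC.
rewrite prE// (pr_hists n)// big1_seq// => h /andP[_ /hists_hist[hh sh]].
rewrite (_ : _ `&` _ = set0) ?pr_set0//.
by apply/seteqP; split => // w [nB hw]; apply: nB; exists h.
Qed.

(** The paths on which the splits occur one at a time, at every level. *)
Definition good : set Omega :=
  [set w | forall n, exists h, [/\ hist h, size h = n & hevent h w]].

Lemma good_measurable : measurable good.
Proof.
rewrite (_ : good = \bigcap_n [set w | exists h, [/\ hist h, size h = n & hevent h w]]).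
  by apply: bigcapT_measurable => n; have [] := hevent_ae n.
by apply/seteqP; split => w h n; [move=> _|]; exact: h.
Qed.

Lemma good_ae : P (~` good) = 0%E.
Proof.
apply/eqP; rewrite -measure_le0.
rewrite (_ : ~` good = \bigcup_n ~` [set w | exists h, [/\ hist h, size h = n & hevent h w]]); last first.
  rewrite -setC_bigcap; congr (~` _).
  by apply/seteqP; split => w h n; [move=> _|]; exact: h.
have : P.-negligible (\bigcup_n ~` [set w | exists h, [/\ hist h, size h = n & hevent h w]]).
  apply: negligible_bigcup => n; apply/negligibleP; have [h1 h2] := hevent_ae n => //.
  exact: measurableC.
move/negligibleP => -> //; apply: bigcup_measurable => n _.
by apply: measurableC; have [] := hevent_ae n.
Qed.
(** Events determined by the first n splits: on each history of length n they
only depend on the clocks of its words. *)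
Definition past n (A : set Omega) := measurable A /\
  forall h, hist h -> size h = n -> exists2 D, sclk [set` h] D & A `&` hevent h = D `&` hevent h.

Lemma pastI n A B : past n A -> past n B -> past n (A `&` B).
Proof.
move=> [mA hA] [mB hB]; split; first exact: measurableI.
move=> h hh sh; have [D sD eD] := hA h hh sh; have [D' sD' eD'] := hB h hh sh.
exists (D `&` D').
  exact: gen_setI.
by rewrite [LHS]setIIl eD eD' -setIIl.
Qed.

Lemma pastT n : past n setT.
Proof. by split => // h _ _; exists setT => //; exact: gen_setT. Qed.

(** A longer history reveals the clock of one more word. *)
Lemma pastS n A : past n A -> past n.+1 A.
Proof.
move=> [mA hA]; split => // -[//|v h] hvh [sh]; have /andP[vh hh] := hvh.
have [D sD eD] := hA h hh sh; exists D.
  apply: sub_sclk sD => x /= xh; by rewrite in_cons xh orbT.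
have -> : hevent (v :: h) = hevent h `&` hevent (v :: h) by rewrite setIidr//; exact: hevent_cons.
by rewrite (setIA A) (setIA D) eD.
Qed.

Lemma past_tau n B : measurable B -> past n (tau n @^-1` B).
Proof.
move=> mB; split.
  by rewrite -[X in measurable X]setTI; exact: measurable_tauR.
move=> h hh sh; exists (htime E h @^-1` B).
  by apply: mclk_set => //; exact: mclk_htime.
apply/seteqP; split => w [h1 hw]; split => //; move: h1; rewrite /preimage/= -sh tau_hist//.
Qed.

Definition gap n (w : Omega) : R := tau n.+1 w - tau n w.

Lemma measurable_gap n : measurable_fun setT (gap n).
Proof. by apply: measurable_funB; exact: measurable_tauR. Qed.

Lemma gap_hist v h w : hist (v :: h) -> hevent (v :: h) w ->
  gap (size h) w = ring v w - htime E h w.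
Proof.
move=> hvh hw; rewrite /gap (tau_hist (h := v :: h))// tau_hist//; first by case/andP: hvh.
exact: hevent_cons hw.
Qed.

Lemma gap_gt0 n w : good w -> 0 < gap n w.
Proof.
move=> /(_ n.+1)[h [hvh sh hw]]; case: h hvh sh hw => [//|v h] hvh [sh] hw.
by rewrite -sh (gap_hist hvh hw) subr_gt0; case: hw => -[/= l _] _.
Qed.

Lemma past_gap n B : measurable B -> past n.+1 (gap n @^-1` B).
Proof.
move=> mB; split.
  by rewrite -[X in measurable X]setTI; exact: measurable_gap.
move=> [//|v h] hvh [sh]; have /andP[vh hh] := hvh.
exists ((fun w => ring v w - htime E h w) @^-1` B).
  apply: mclk_set => //; apply: (@measurable_funB _ (g_sigma_algebraType (clock_sets E [set` v :: h]))).
    by apply: (mclk_hring hvh) => //; rewrite mem_head.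
  by apply: mclk_htime => // x /= xh; rewrite in_cons xh orbT.
apply/seteqP; split => w [h1 hw]; split => //; move: h1; rewrite /preimage/= -sh (gap_hist hvh hw)//.
Qed.

(** The half-lines form a pi-system that generates the Borel sets. *)
Lemma measure_tail_unique (m1 m2 : {measure set R -> \bar R}) :
  (forall x : R, m1 `]x, +oo[%classic = m2 `]x, +oo[%classic) ->
  (forall x : R, (m1 `]x, +oo[%classic < +oo)%E) ->
  forall B, measurable B -> m1 B = m2 B.
Proof.
move=> m12 fin B mB.
apply: (@g_sigma_algebra_measure_unique _ _ _ (@RGenOInfty.G R) _ (fun k => `]- k%:R, +oo[%classic)).
- by move=> _ [x ->]; exact: measurable_itv.
- by move=> k; exists (- k%:R).
- apply/seteqP; split => // x _; exists (Num.truncn (- x)).+1 => //=.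
  by rewrite in_itv/= andbT ltrNl; exact: truncnS_gt.
- move=> _ _ [x ->] [y ->]; exists (Num.max x y).
  apply/seteqP; split => z /=; rewrite !in_itv/= !andbT gt_max; first by move=> [-> ->].
  by move=> /andP[].
- by move=> _ [x ->].
- by move=> k; exact: fin.
- have e : @measurable _ (measurableTypeR R) = <<s @RGenOInfty.G R >> := RGenOInfty.measurableE R.
  by rewrite -e.
Qed.

(** A variable with the exponential law of parameter n + 1 built from the clock
of the root. *)
Definition exp_gap n (w : Omega) : R := E [::] w / n.+1%:R.

Lemma measurable_exp_gap n : measurable_fun setT (exp_gap n).
Proof. by apply: measurable_funM. Qed.

Lemma exp_gap_tail n (r : R) : 0 <= r ->
  P [set w | r < exp_gap n w] = (expR (- (n.+1%:R * r)))%:E.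
Proof.
move=> r0; rewrite -(clock_tail hE [::]); last by rewrite mulr_ge0.
by congr (P _); apply/seteqP; split => w /=; rewrite /exp_gap ltr_pdivlMr// mulrC.
Qed.

Lemma preimage_gt (f : Omega -> R) x : f @^-1` `]x, +oo[%classic = [set w | x < f w].
Proof. by apply/seteqP; split => w /=; rewrite in_itv/= andbT. Qed.

Lemma exp_gap_gt0 n : P [set w | 0 < exp_gap n w] = 1%E.
Proof. by rewrite exp_gap_tail// mulr0 oppr0 expR0. Qed.
(** Both sides are finite measures in B; by [hevent_step] they have the same
tails. *)
Lemma jump_step n h v A (B : set R) : hist (v :: h) -> size h = n -> past n A ->
  measurable B ->
  P (A `&` hevent (v :: h) `&` gap n @^-1` B) =
  ((pr (A `&` hevent h) / n.+1%:R)%:E * P (exp_gap n @^-1` B))%E.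
Proof.
move=> hvh sh [mA hA] mB; have /andP[vh hh] := hvh.
have [D sD eD] := hA h hh sh.
have mv := hevent_measurable hvh.
have mAv : measurable (A `&` hevent (v :: h)) by exact: measurableI.
have eDv : A `&` hevent (v :: h) = D `&` hevent (v :: h).
  have -> : hevent (v :: h) = hevent h `&` hevent (v :: h) by rewrite setIidr//; exact: hevent_cons.
  by rewrite (setIA A) (setIA D) eD.
have p0 : 0 <= pr (A `&` hevent h) / n.+1%:R by rewrite divr_ge0// pr_ge0.
pose m1f : {measure set R -> \bar R} := pushforward (mrestr P mAv) (gap n).
pose m1 := m1f (measurable_gap n).
pose m2f : {measure set R -> \bar R} := mscale (NngNum p0) (pushforward P (exp_gap n)).
pose m2 := m2f (measurable_exp_gap n).
have key (r : R) : 0 <= r ->  m1 `]r, +oo[%classic = m2 `]r, +oo[%classic.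
  move=> r0; change (P (gap n @^-1` `]r, +oo[ `&` (A `&` hevent (v :: h))) =
    ((pr (A `&` hevent h) / n.+1%:R)%:E * P (exp_gap n @^-1` `]r, +oo[))%E).
  rewrite !preimage_gt setIC eDv exp_gap_tail//.
  have -> : D `&` hevent (v :: h) `&` [set w | r < gap n w] =
    D `&` hevent (v :: h) `&` [set w | htime E h w + r < ring v w].
    apply/seteqP; split => w [[Dw hw] h1]; split => //; move: h1; rewrite /= -sh (gap_hist hvh hw).
      by rewrite ltrBrDl.
    by rewrite ltrBrDl.
  rewrite hevent_step// eD sh -EFinM; congr EFin; by rewrite mulrAC.
suff m12 : m1 B = m2 B by rewrite setIC; exact: m12.
apply: measure_tail_unique => //.
  move=> r; have [r0|r0] := leP 0 r; first exact: key.
  have e1 : m1 `]r, +oo[%classic = m1 `]0, +oo[%classic.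
    rewrite /m1 /= /pushforward /mrestr /= !preimage_gt; congr (P _).
    apply/seteqP; split => w [h1 [Aw hw]]; split => //=; move: h1; rewrite /= -sh (gap_hist hvh hw).
      by move=> _; rewrite subr_gt0; case: hw => -[].
    exact: lt_trans.
  have e2 : m2 `]r, +oo[%classic = m2 `]0, +oo[%classic.
    change (((pr (A `&` hevent h) / n.+1%:R)%:E * P (exp_gap n @^-1` `]r, +oo[) =
      (pr (A `&` hevent h) / n.+1%:R)%:E * P (exp_gap n @^-1` `](0 : R)%R, +oo[))%E).
    congr (_ * _)%E; rewrite !preimage_gt exp_gap_gt0; apply/eqP; rewrite eq_le.
    rewrite probability_le1/=; last first.
      rewrite -preimage_gt -[X in measurable X]setTI; exact: measurable_exp_gap.
    rewrite -(exp_gap_gt0 n); apply: le_measure; rewrite ?inE.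
    - rewrite -preimage_gt -[X in measurable X]setTI; exact: measurable_exp_gap.
    - rewrite -preimage_gt -[X in measurable X]setTI; exact: measurable_exp_gap.
    - by move=> w; exact: lt_trans.
  by rewrite e1 e2 key.
move=> r; change (P (gap n @^-1` `]r, +oo[ `&` (A `&` hevent (v :: h))) < +oo)%E.
rewrite ltey_eq fin_num_measure//; apply: measurableI => //.
rewrite -[X in measurable X]setTI; exact: measurable_gap.
Qed.

(** Sum of [jump_step] over the histories of length n and over the next leaf. *)
Lemma gap_indep n A (B : set R) : past n A -> measurable B ->
  P (A `&` gap n @^-1` B) = (P A * P (exp_gap n @^-1` B))%E.
Proof.
move=> hA mB; have [mA _] := hA.
have mg : measurable (gap n @^-1` B).
  rewrite -[X in measurable X]setTI; exact: measurable_gap.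
have me : measurable (exp_gap n @^-1` B).
  rewrite -[X in measurable X]setTI; exact: measurable_exp_gap.
have mAg : measurable (A `&` gap n @^-1` B) by exact: measurableI.
rewrite !prE// -EFinM; congr EFin.
rewrite (pr_hists n mAg) (pr_hists n mA) mulr_suml.
apply: eq_big_seq => h /hists_hist[hh sh].
rewrite pr_hevent_next// (eq_big_seq (fun=> pr (A `&` hevent h) / n.+1%:R * pr (exp_gap n @^-1` B))); last first.
  move=> v vh; have hvh : hist (v :: h) by rewrite /= vh hh.
  apply: EFin_inj; rewrite EFinM -!prE//; last first.
    by apply: measurableI => //; exact: hevent_measurable.
  by rewrite -(jump_step hvh sh hA mB) setIAC.
rewrite sum_hleaves// sh.
by field; rewrite addrC natr1 pnatr_eq0.
Qed.

End jump.

(** * The stopped sigma-algebras *)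

Section stopped.
Context d (Omega : measurableType d) (R : realType) (P : probability Omega R).
Variable E : seq bool -> {RV P >-> R}.
Hypothesis hE : yule_clocks E.
Notation ring := (ring_time E).
Notation hevent := (hevent E).
Notation tau := (tau E).
Notation sclk U := (<<s clock_sets E U >>).
Notation yF t := (<<s yule_gen E t >>).
(** The splits up to time t are those of h. *)
Definition holding h (t : R) : set Omega :=
  [set w | [/\ hevent h w, htime E h w <= t & forall u, u \in hleaves h -> t < ring u w]].

(** Between two consecutive splits the tree up to time t is a function of the
clocks of its internal nodes: a word u is in the tree at time s only if its
strict prefixes belong to h, and then the event compares their ringing times
with s. *)
Lemma yF_trace h t C : hist h -> yF t C ->
  exists2 D, sclk [set` h] D & C `&` holding h t = D `&` holding h t.
Proof.
move=> hh yC.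
pose K : set (set Omega) := [set C | exists2 D, sclk [set` h] D & C `&` holding h t = D `&` holding h t].
suff : yF t `<=` K by apply.
apply: smallest_sub => [|_ [s [u [/andP[s0 st] ->]]]].
  split.
  - by exists set0 => //; exact: gen_set0.
  - move=> A [D sD e]; exists (setT `\` D).
      by rewrite setTD; exact: gen_setC.
    apply/seteqP; split => w [[_ nA] hw]; split => //; split => // Dw; apply: nA.
      have : (D `&` holding h t) w by [].
      by rewrite -e => -[].
    have : (A `&` holding h t) w by [].
    by rewrite e => -[].
  - move=> A hA; pose D n := projT1 (cid2 (hA n)).
    exists (\bigcup_n D n).
      apply: gen_bigcup => n.
      by rewrite /D; case: cid2.
    rewrite !setI_bigcupl; apply: eq_bigcupr => n _.
    by rewrite /D; case: cid2.
have [up|nup] := pselect (forall k, (k < size u)%N -> take k u \in h).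
  exists [set w | yule_tree E s w u] => //.
  rewrite (_ : [set _ | _] = [set w | forall k, k \in iota 0 (size u) -> ring (take k u) w <= s]).
    rewrite (_ : [set _ | _] = ~` [set w | exists2 k, k \in iota 0 (size u) & s < ring (take k u) w]).
      apply: gen_setC.
      rewrite (_ : [set _ | _] = \bigcup_k (if (k < size u)%N then [set w | s < ring (take k u) w] else set0)).
        apply: gen_bigcup => k.
        case: ifP => ku; last exact: gen_set0.
        apply: sclk_lt; first exact: measurable_cst.
        by apply: (mclk_hring hh) => //; exact: up.
      apply/seteqP; split => w /=.
        by move=> [k]; rewrite mem_iota/= add0n => ku sk; exists k => //; rewrite ku.
      by move=> [k _]; case: ifP => // ku sk; exists k => //; rewrite mem_iota/= add0n.
    apply/seteqP; split => w /=.
      by move=> H [k ku]; rewrite ltNge H.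
    by move=> H k ku; rewrite leNgt; apply/negP => sk; apply: H; exists k.
  by apply/seteqP; split => w /= H k; [rewrite mem_iota/= add0n|move=> ku]; apply: H;
    rewrite ?mem_iota/= ?add0n.
exists set0; first exact: gen_set0.
apply/seteqP; split => w; last by case=> -[].
move=> [/= Tu [[ho _] ht hl]]; case: nup.
have := yule_tree_mono st Tu; rewrite (yule_tree_hist hh ho ht hl); exact.
Qed.

(** On [hevent h] let t be a time slightly after the last split: there the event
is known up to the clocks of h by [yF_trace].  The time t has to be a
function of the clocks of h with countably many values, hence the
approximation from above of the last ringing time by the multiples of
1 / (k + 1), and a limit in k. *)
Lemma stopped_past n A : stopped_filtration E n A -> past E n A.
Proof.
move=> [mA hA]; split => // h hh sh.
have [D hD] : exists D : R -> set Omega, forall t, 0 <= t ->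
    sclk [set` h] (D t) /\ A `&` holding h t = D t `&` holding h t.
  have ex t : exists D, 0 <= t -> sclk [set` h] D /\ A `&` holding h t = D `&` holding h t.
    have [t0|t0] := leP 0 t; last by exists set0.
    have [D sD e] := yF_trace hh (hA t t0); exists D => _; split => //; rewrite -e.
    apply/seteqP; split => w [Aw hw]; split => //; last by case: Aw.
    split => //=; case: hw => hw ht _.
    by rewrite -sh yule_tau_hist.
  by exists (fun t => projT1 (cid (ex t))) => t t0; have := projT2 (cid (ex t)); apply.
(* strictly after the last split, with values in the multiples of 1 / (k + 1) *)
pose tk k w : R := (Num.truncn (k.+1%:R * htime E h w)).+1%:R / k.+1%:R.
pose Dk k := [set w | D (tk k w) w].
have sDk k : sclk [set` h] (Dk k).
  rewrite (_ : Dk k = \bigcup_j (((fun w => (Num.truncn (k.+1%:R * htime E h w))%:R : R) @^-1` [set j%:R])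
      `&` D (j.+1%:R / k.+1%:R))).
    apply: gen_bigcup => j.
    apply: gen_setI.
      pose g (x : R) : R := (Num.truncn (k.+1%:R * x))%:R.
      have mg : measurable_fun setT g.
        apply: nondecreasing_measurable => // x y xy.
        by rewrite /g ler_nat; apply: le_truncn; rewrite ler_pM2l.
      have := @measurableT_comp _ _ _ (g_sigma_algebraType (clock_sets E [set` h])) _ _ g _ _ mg
         (mclk_htime (P := P) (E := E) hh (fun _ h => h)).
      by move=> /(_ measurableT [set j%:R]); rewrite setTI; apply.
    by have [] := hD (j.+1%:R / k.+1%:R); first by rewrite divr_ge0.
  apply/seteqP; split => w.
    by move=> Dw; exists (Num.truncn (k.+1%:R * htime E h w)).
  by move=> [j _ [/= /eqP]]; rewrite eqr_nat /Dk/= /tk => /eqP ->.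
exists (\bigcup_K \bigcap_(k in [set k | (K <= k)%N]) Dk k).
  apply: gen_bigcup => K.
  apply: (@bigcap_measurable _ (g_sigma_algebraType (clock_sets E [set` h]))); first by exists K => /=.
  by move=> k _; exact: sDk.
have ev w : hevent h w -> exists K, forall k, (K <= k)%N -> holding h (tk k w) w.
  move=> hw; have [ho hl] := hw; have [h0 _] := hordered_birth hh ho.
  have [t' ht' hu] := seq_delta hl.
  have dd : 0 < t' - htime E h w by rewrite subr_gt0.
  exists (Num.truncn ((t' - htime E h w)^-1)) => k Kk.
  have k1 : (k.+1%:R)^-1 < t' - htime E h w.
    rewrite -[ltRHS]invrK ltf_pV2 ?posrE ?invr_gt0//.
    apply: lt_le_trans (truncnS_gt _) _; by rewrite ler_nat ltnS.
  have k2 : tk k w <= htime E h w + (k.+1%:R)^-1.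
    rewrite /tk ler_pdivrMr// mulrDl mulVf// -natr1 lerD2r mulrC.
    by rewrite Num.Theory.truncn_le// mulr_ge0.
  have k3 : htime E h w <= tk k w.
    by rewrite /tk ler_pdivlMr// mulrC; apply/ltW; apply: truncnS_gt.
  split => // u ul; apply: lt_le_trans (hu u ul).
  by apply: le_lt_trans k2 _; rewrite -ltrBrDl.
have tk0 k w : 0 <= tk k w by rewrite divr_ge0.
apply/seteqP; split => w [Aw hw]; split => //; have [K hK] := ev _ hw.
  exists K => // k /= Kk; have [_ e] := hD (tk k w) (tk0 k w).
  have : (A `&` holding h (tk k w)) w by split => //; exact: hK.
  by rewrite e => -[].
have [K' _ hK'] := Aw; pose k := maxn K K'.
have [_ e] := hD (tk k w) (tk0 k w).
have : (D (tk k w) `&` holding h (tk k w)) w.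
  split; first by apply: hK'; rewrite /= leq_maxr.
  by apply: hK; rewrite leq_maxl.
by rewrite -e => -[].
Qed.

Lemma stopped_salgebra n : sigma_algebra setT (stopped_filtration E n) /\
  stopped_filtration E n `<=` measurable.
Proof.
split; last by move=> A [].
split.
- split => // t t0; rewrite set0I; exact: gen_set0.
- move=> A [mA hA]; split; first exact: measurableD.
  move=> t t0; rewrite (_ : _ `&` _ = [set w | (yule_tau E n w <= t%:E)%E] `\`
     (A `&` [set w | (yule_tau E n w <= t%:E)%E])).
    apply: gen_setD; first exact: yF_tau.
    exact: hA.
  apply/seteqP; split => w.
    by move=> [[_ nA] h]; split => // -[].
  by move=> [h nA]; split => //; split => // Aw; exact: nA.
- move=> A hA; split; first by apply: bigcupT_measurable => k; case: (hA k).
  move=> t t0; rewrite setI_bigcupl.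
  apply: gen_bigcup => k.
  by case: (hA k) => _; apply.
Qed.

Lemma yF_mono s t : s <= t -> yF s `<=` yF t.
Proof.
move=> st; apply: sub_smallest2r; first exact: smallest_sigma_algebra.
move=> _ [s' [u [/andP[a b] ->]]]; exists s', u; split => //.
by rewrite a (le_trans b).
Qed.

Lemma good_tau w m : good E w -> yule_tau E m w = (tau m w)%:E /\ 0 <= tau m w.
Proof.
move=> /(_ m)[h [hh <- hw]]; rewrite tau_hist// yule_tau_hist//; split => //.
by have [ho _] := hw; have [] := hordered_birth hh ho.
Qed.

Lemma tau_mono m n w : good E w -> (m <= n)%N -> tau m w <= tau n w.
Proof.
move=> gw /subnKC <-; elim: (n - m)%N => [|k IH]; first by rewrite addn0.
by rewrite addnS; apply: le_trans IH _; rewrite -subr_ge0; exact/ltW/(gap_gt0 _ gw).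
Qed.

(** The intersection of A and of the event that the m-th split precedes the n-th
belongs to the stopped sigma-algebra of the n-th; good paths lie in that
event. *)
Lemma stopped_nested m n A : (m <= n)%N -> stopped_filtration E m A ->
  exists2 B, stopped_filtration E n B & P ((A `\` B) `|` (B `\` A)) = 0%E.
Proof.
move=> mn [mA hA].
pose L := [set w | (yule_tau E m w <= yule_tau E n w)%E].
have mL : measurable L.
  rewrite -[L]setTI; apply: measurable_lee => //; exact: measurable_tau.
have mAL : measurable (A `&` L) by exact: measurableI.
exists (A `&` L).
  split => // t t0.
  have -> : A `&` L `&` [set w | (yule_tau E n w <= t%:E)%E] = (A `&` [set w | (yule_tau E m w <= t%:E)%E]) `&`
    ([set w | (yule_tau E n w <= t%:E)%E] `\`
     \bigcup_(q : rat) (if ((0 : R) <= ratr q) && ((ratr q : R) <= t) then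
       [set w | (yule_tau E n w <= (ratr q)%:E)%E] `\` [set w | (yule_tau E m w <= (ratr q)%:E)%E]
       else set0)).
    apply/seteqP; split => w.
      move=> [[Aw Lw] nt]; split; first by split => //=; exact: le_trans Lw nt.
      split => // -[q _]; case: ifP => // _ [/= h1 h2]; apply: h2; exact: le_trans Lw h1.
    move=> [[Aw mt] [nt nq]]; split => //; split => //.
    rewrite /L/= leNgt; apply/negP => lt.
    have n0 : (0%:E <= yule_tau E n w)%E by apply/ereal_infP => _ [s [s0 _] <-]; rewrite lee_fin.
    have [a ea] : exists a, yule_tau E n w = a%:E.
      by move: n0 nt => /=; case: (yule_tau E n w) => [a| |]//= _ _; exists a.
    have [b eb] : exists b, yule_tau E m w = b%:E.
      rewrite ea in lt; move: lt mt => /=; case: (yule_tau E m w) => [b _ _|_|].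
      - by exists b.
      - by rewrite leye_eq.
      - by rewrite ltNge leNye.
    move: lt n0 mt nt nq; rewrite /= ea eb !lee_fin lte_fin => lt n0 mt nt; apply.
    have [q] := rat_in_itvoo lt; rewrite in_itv/= => /andP[q1 q2].
    exists q => //; rewrite (le_trans n0 (ltW q1)) (le_trans (ltW q2) mt) /= ea eb !lee_fin.
    by rewrite (ltW q1); split => //; apply/negP; rewrite -ltNge.
  apply: gen_setI; first exact: hA.
  apply: gen_setD; first exact: yF_tau.
  apply: gen_countable_bigcup.
    exact: countableP.
  move=> q; case: ifPn => [/andP[q0 qt]|_]; last exact: gen_set0.
  by apply: (yF_mono qt); apply: gen_setD; exact: yF_tau.
apply/eqP; rewrite -measure_le0.
have mg := good_measurable hE; have ng : measurable (~` good E) by exact: measurableC.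
rewrite -(good_ae hE); apply: le_measure; rewrite ?inE//.
  by apply: measurableU; exact: measurableD.
move=> w [[Aw nAL]|[[Aw _] nA]] gw; last by [].
apply: nAL; split => //; rewrite /L/= !(good_tau _ gw).1 lee_fin; exact: tau_mono.
Qed.
Lemma stopped_fmn : filtration_mod_null P (stopped_filtration E).
Proof.
split; [exact: stopped_salgebra|exact: stopped_nested].
Qed.

(** Up to time t the splitting time is the minimum of itself and t, which is
measurable for the tree up to time t. *)
Lemma stopped_tau n B : measurable B -> stopped_filtration E n (tau n @^-1` B).
Proof.
move=> mB; split.
  by rewrite -[X in measurable X]setTI; exact: measurable_tauR.
move=> t t0.
pose g w := Order.min (yule_tau E n w) t%:E.
have mg : measurable_fun (setT : set (g_sigma_algebraType (yule_gen E t))) g.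
  apply: (@measurability _ _ _ _ _ _ (@ErealGenOInfty.G R) (ErealGenOInfty.measurableE R)) => //.
  move=> _ [_ [r ->] <-]; rewrite setTI.
  have [tr|rt] := leP t r.
    have -> : g @^-1` `]r%:E, +oo[%classic = set0.
      apply/seteqP; split => // w /=; rewrite in_itv/= andbT lt_min lte_fin.
      by rewrite [(r < t)]ltNge tr andbF.
    exact: gen_set0.
  have -> : g @^-1` `]r%:E, +oo[%classic = ~` [set w | (yule_tau E n w <= r%:E)%E].
    apply/seteqP; split => w /=; rewrite in_itv/= andbT lt_min lte_fin rt andbT ltNge => /negP //.
  apply: gen_setC.
  have [r0|r0] := leP (0 : R) r.
    exact: (yF_mono (ltW rt) (yF_tau _ r0)).
  have -> : [set w | (yule_tau E n w <= r%:E)%E] = set0.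
    apply/seteqP; split => // w /= h.
    have n0 : (0%:E <= yule_tau E n w)%E by apply/ereal_infP => _ [s [s0 _] <-]; rewrite lee_fin.
    by have := le_trans n0 h; rewrite lee_fin leNgt r0.
  exact: gen_set0.
have -> : tau n @^-1` B `&` [set w | (yule_tau E n w <= t%:E)%E] =
   ((fine \o g) @^-1` B) `&` [set w | (yule_tau E n w <= t%:E)%E].
  by apply/seteqP; split => w [Bw /= nt]; split => //; move: Bw; rewrite /tau/preimage/= /g min_l.
apply: gen_setI; last exact: yF_tau.
have mf : measurable_fun (setT : set (g_sigma_algebraType (yule_gen E t))) (fine \o g).
  by apply: (@measurableT_comp _ _ _ _ _ _ fine) => //; exact: fine_measurable.
by have := mf measurableT B mB; rewrite setTI.
Qed.

End stopped.

(** * Complex exponentials and powers *)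

Section complex_exp.
Context (R : realType).
Implicit Types (a b w z : R[i]) (x : R).

Lemma Re_add a b : complex.Re (a + b) = complex.Re a + complex.Re b.
Proof. by case: a; case: b. Qed.
Lemma Im_add a b : complex.Im (a + b) = complex.Im a + complex.Im b.
Proof. by case: a; case: b. Qed.
Lemma Re_opp a : complex.Re (- a) = - complex.Re a.
Proof. by case: a. Qed.
Lemma Im_opp a : complex.Im (- a) = - complex.Im a.
Proof. by case: a. Qed.
Lemma Re_mul a b : complex.Re (a * b) = complex.Re a * complex.Re b - complex.Im a * complex.Im b.
Proof. by case: a; case: b. Qed.
Lemma Im_mul a b : complex.Im (a * b) = complex.Re a * complex.Im b + complex.Im a * complex.Re b.
Proof. by case: a => a1 a2; case: b => b1 b2 /=; rewrite addrC. Qed.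
Lemma Re_nat n : complex.Re (n%:R : R[i]) = n%:R.
Proof. by elim: n => // n IH; rewrite -!natr1 Re_add IH. Qed.
Lemma Im_nat n : complex.Im (n%:R : R[i]) = 0.
Proof. by elim: n => // n IH; rewrite -!natr1 Im_add IH addr0. Qed.
Lemma complex_nat n : (n%:R : R[i]) = (n%:R)%:C.
Proof. by apply/eqP; rewrite eq_complex Re_nat Im_nat !eqxx. Qed.
Lemma complex_ext a b : complex.Re a = complex.Re b -> complex.Im a = complex.Im b -> a = b.
Proof. by case: a; case: b => /= ? ? ? ? -> ->. Qed.

Lemma cexpD a b : cexp (a + b) = cexp a * cexp b.
Proof.
apply: complex_ext; rewrite /cexp ?Re_mul ?Im_mul Re_add Im_add /= expRD.
  by rewrite cosD; ring.
by rewrite sinD; ring.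
Qed.

Lemma cexp0 : cexp 0 = 1 :> R[i].
Proof. by apply: complex_ext; rewrite /cexp /= expR0 ?cos0 ?sin0 mul1r. Qed.

Lemma cexpN a : cexp (- a) * cexp a = 1.
Proof. by rewrite -cexpD addNr cexp0. Qed.

Lemma cexp_neq0 a : cexp a != 0.
Proof. by apply/eqP => h; have := cexpN a; rewrite h mulr0 => /esym/eqP; rewrite oner_eq0. Qed.

Notation normc := ComplexField.Normc.normc.

Lemma normcE z : normc z = Num.sqrt (complex.Re z ^+ 2 + complex.Im z ^+ 2).
Proof. by case: z. Qed.

Lemma normc_ge0 z : 0 <= normc z.
Proof. by rewrite normcE sqrtr_ge0. Qed.

Lemma normc_sqr z : normc z ^+ 2 = complex.Re z ^+ 2 + complex.Im z ^+ 2.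
Proof. by rewrite normcE sqr_sqrtr// addr_ge0 ?sqr_ge0. Qed.

Lemma normc_cexp z : normc (cexp z) = expR (complex.Re z).
Proof.
rewrite normcE /cexp /= !exprMn -mulrDr cos2Dsin2 mulr1 sqrtr_sqr.
by rewrite ger0_norm// expR_ge0.
Qed.

Lemma normc_Re z : `|complex.Re z| <= normc z.
Proof. by rewrite -sqrtr_sqr normcE ler_wsqrtr// lerDl sqr_ge0. Qed.
Lemma normc_Im z : `|complex.Im z| <= normc z.
Proof. by rewrite -sqrtr_sqr normcE ler_wsqrtr// lerDr sqr_ge0. Qed.
Lemma normc_le z : normc z <= `|complex.Re z| + `|complex.Im z|.
Proof.
rewrite -[leRHS]ger0_norm; last by rewrite addr_ge0.
rewrite -sqrtr_sqr normcE ler_wsqrtr// sqrrD !real_normK ?num_real//.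
by rewrite -addrA lerD2l lerDr mulrn_wge0// mulr_ge0.
Qed.
Lemma normc_real x : normc x%:C = `|x|.
Proof. by rewrite normcE /= expr0n/= addr0 sqrtr_sqr. Qed.
Lemma normcM a b : normc (a * b) = normc a * normc b.
Proof. exact: ComplexField.Normc.normcM. Qed.
Lemma normc_gt0 z : z != 0 -> 0 < normc z.
Proof.
move=> z0; rewrite lt_def normc_ge0 andbT; apply/eqP => /ComplexField.Normc.eq0_normc h.
by rewrite h eqxx in z0.
Qed.
Lemma normr_normc z : `|z| = (normc z)%:C.
Proof. by rewrite normc_def normcE. Qed.
Lemma ccvgP (u : nat -> R[i]) (l : R[i]) :
  (u @ \oo --> (l : R[i]^o)) <->
  ((fun n => complex.Re (u n)) @ \oo --> complex.Re l /\
   (fun n => complex.Im (u n)) @ \oo --> complex.Im l).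
Proof.
split.
  move=> /(@cvgrPdist_lt R[i] R[i]^o) h; split; apply/cvgrPdist_lt => e e0;
  have := h e%:C; rewrite ltcR => /(_ e0); apply: filterS => n;
  rewrite normr_normc ltcR; apply: le_lt_trans.
    by apply: le_trans (normc_Re _); rewrite Re_add Re_opp.
  by apply: le_trans (normc_Im _); rewrite Im_add Im_opp.
move=> [/cvgrPdist_lt h1 /cvgrPdist_lt h2]; apply/(@cvgrPdist_lt R[i] R[i]^o) => e e0.
have e0' : 0 < complex.Re e by move: e0; rewrite ltcE => /andP[].
have ee : e = (complex.Re e)%:C.
  by apply: complex_ext => //=; move: e0; rewrite ltcE => /andP[/eqP -> _].
have e2 : 0 < complex.Re e / 2 by rewrite divr_gt0.
near=> n; rewrite ee normr_normc ltcR; apply: le_lt_trans (normc_le _) _.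
rewrite [ltRHS]splitr ltrD// ?Re_add ?Im_add ?Re_opp ?Im_opp.
  by near: n; exact: h1.
by near: n; exact: h2.
Unshelve. all: by end_near. Qed.

Lemma ccvgM (u v : nat -> R[i]) (l m : R[i]) :
  u @ \oo --> (l : R[i]^o) -> v @ \oo --> (m : R[i]^o) ->
  (fun n => u n * v n) @ \oo --> (l * m : R[i]^o).
Proof.
move=> /ccvgP[u1 u2] /ccvgP[v1 v2]; apply/ccvgP; split.
  under eq_fun do rewrite Re_mul.
  by rewrite Re_mul; apply: cvgB; apply: cvgM.
under eq_fun do rewrite Im_mul.
by rewrite Im_mul; apply: cvgD; apply: cvgM.
Qed.

Lemma ccvgV (u : nat -> R[i]) (l : R[i]) : l != 0 ->
  u @ \oo --> (l : R[i]^o) -> (fun n => (u n)^-1) @ \oo --> (l^-1 : R[i]^o).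
Proof. by move=> l0 hu; apply: cvgV. Qed.

Lemma ccvg_cst (l : R[i]) : (fun _ : nat => l) @ \oo --> (l : R[i]^o).
Proof. by apply/ccvgP; split; exact: cvg_cst. Qed.

Lemma ccvg_cexp (u : nat -> R[i]) (l : R[i]) :
  u @ \oo --> (l : R[i]^o) -> (fun n => cexp (u n)) @ \oo --> (cexp l : R[i]^o).
Proof.
move=> /ccvgP[u1 u2]; apply/ccvgP; split => /=; apply: cvgM.
- by apply: continuous_cvg => //; exact: continuous_expR.
- by apply: continuous_cvg => //; exact: continuous_cos.
- by apply: continuous_cvg => //; exact: continuous_expR.
- by apply: continuous_cvg => //; exact: continuous_sin.
Qed.

Lemma ccvg_normc (u : nat -> R[i]) (l : R[i]) :
  u @ \oo --> (l : R[i]^o) -> (fun n => normc (u n)) @ \oo --> normc l.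
Proof.
move=> /ccvgP[u1 u2]; rewrite normcE; under eq_fun do rewrite normcE.
apply: continuous_cvg; first exact: sqrt_continuous.
by apply: cvgD; rewrite expr2; under eq_fun do rewrite expr2; apply: cvgM.
Qed.
Lemma cpowE x w : cpow x w = cexp (complex.Re w * ln x +i* (complex.Im w * ln x)).
Proof.
by congr cexp; apply: complex_ext; rewrite ?Re_mul ?Im_mul /= ?mulr0 ?subr0 ?add0r.
Qed.

Lemma Re_cpow x w : complex.Re (cpow x w) = expR (complex.Re w * ln x) * cos (complex.Im w * ln x).
Proof. by rewrite cpowE. Qed.
Lemma Im_cpow x w : complex.Im (cpow x w) = expR (complex.Re w * ln x) * sin (complex.Im w * ln x).
Proof. by rewrite cpowE. Qed.
Lemma normc_cpow x w : normc (cpow x w) = expR (complex.Re w * ln x).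
Proof. by rewrite cpowE normc_cexp. Qed.
Lemma cpowD x v w : cpow x (v + w) = cpow x v * cpow x w.
Proof. by rewrite /cpow mulrDl cexpD. Qed.
Lemma cpow_neq0 x w : cpow x w != 0.
Proof. exact: cexp_neq0. Qed.
Lemma cpowM x y w : 0 < x -> 0 < y -> cpow (x * y) w = cpow x w * cpow y w.
Proof.
by move=> x0 y0; rewrite /cpow lnM ?posrE// -cexpD -mulrDr; congr (cexp (_ * _)); apply: complex_ext => //=; rewrite addr0.
Qed.
Lemma cpow1 x : 0 < x -> cpow x 1 = x%:C.
Proof.
move=> x0; apply: complex_ext; rewrite ?Re_cpow ?Im_cpow /= mul0r mul1r lnK ?posrE// ?cos0 ?sin0.
  by rewrite mulr1.
by rewrite mulr0.
Qed.
Lemma cpow_real x (a : R) : cpow x a%:C = (expR (a * ln x))%:C.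
Proof.
by apply: complex_ext; rewrite ?Re_cpow ?Im_cpow /= mul0r ?cos0 ?sin0 ?mulr1 ?mulr0.
Qed.

Lemma measurable_sin : measurable_fun [set: R] (@sin R).
Proof. by apply: continuous_measurable_fun; exact: continuous_sin. Qed.
Lemma measurable_cos : measurable_fun [set: R] (@cos R).
Proof. by apply: continuous_measurable_fun; exact: continuous_cos. Qed.

End complex_exp.

(** * Complex-valued integrals *)

Section cintegral_theory.
Context d (T : measurableType d) (R : realType) (mu : {measure set T -> \bar R}).
Variables (D : set T) (mD : measurable D).
Notation normc := ComplexField.Normc.normc.
Implicit Types f g : T -> R[i].

Definition cmeasurable f := measurable_fun D (fun x => complex.Re (f x)) /\
  measurable_fun D (fun x => complex.Im (f x)).

Lemma cintegrable_dom f (g : T -> R) : cmeasurable f ->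
  (forall x, D x -> normc (f x) <= g x) -> mu.-integrable D (EFin \o g) -> cintegrable mu D f.
Proof.
move=> [m1 m2] fg ig; split.
  apply: (le_integrable mD _ _ ig); first exact/measurable_EFinP.
  move=> x Dx /=; rewrite lee_fin; apply: le_trans (normc_Re _) _.
  exact: le_trans (fg x Dx) (ler_norm _).
apply: (le_integrable mD _ _ ig); first exact/measurable_EFinP.
move=> x Dx /=; rewrite lee_fin; apply: le_trans (normc_Im _) _.
exact: le_trans (fg x Dx) (ler_norm _).
Qed.

Lemma cintegralB f g : cintegrable mu D f -> cintegrable mu D g ->
  cintegral mu D (fun x => f x - g x) = cintegral mu D f - cintegral mu D g.
Proof.
move=> [f1 f2] [g1 g2]; apply: complex_ext => /=.
  by rewrite -RintegralB//; apply: eq_Rintegral => x _; rewrite Re_add Re_opp.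
by rewrite -RintegralB//; apply: eq_Rintegral => x _; rewrite Im_add Im_opp.
Qed.

Lemma cintegrableB f g : cintegrable mu D f -> cintegrable mu D g ->
  cintegrable mu D (fun x => f x - g x).
Proof.
move=> [f1 f2] [g1 g2]; split.
  rewrite (_ : _ \o _ = (fun x => (EFin \o (fun x => complex.Re (f x))) x - (EFin \o (fun x => complex.Re (g x))) x)%E).
    exact: integrableB.
  by apply/funext => x /=; rewrite Re_add Re_opp.
rewrite (_ : _ \o _ = (fun x => (EFin \o (fun x => complex.Im (f x))) x - (EFin \o (fun x => complex.Im (g x))) x)%E).
  exact: integrableB.
by apply/funext => x /=; rewrite Im_add Im_opp.
Qed.

Lemma cintegrableZ (c : R[i]) f : cintegrable mu D f -> cintegrable mu D (fun x => c * f x).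
Proof.
move=> [f1 f2]; split.
  rewrite (_ : _ \o _ = (fun x => ((complex.Re c)%:E * (complex.Re (f x))%:E) - ((complex.Im c)%:E * (complex.Im (f x))%:E))%E).
    by apply: integrableB => //; apply: integrableZl.
  by apply/funext => x /=; rewrite Re_mul.
rewrite (_ : _ \o _ = (fun x => ((complex.Re c)%:E * (complex.Im (f x))%:E) + ((complex.Im c)%:E * (complex.Re (f x))%:E))%E).
  by apply: integrableD => //; apply: integrableZl.
by apply/funext => x /=; rewrite Im_mul.
Qed.

Lemma cintegralZ (c : R[i]) f : cintegrable mu D f ->
  cintegral mu D (fun x => c * f x) = c * cintegral mu D f.
Proof.
move=> [f1 f2].
have iZ (k : R) (h : T -> R) : mu.-integrable D (EFin \o h) ->
   mu.-integrable D (EFin \o (fun x => k * h x)).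
  by move=> ih; have := integrableZl mD k ih.
apply: complex_ext; rewrite ?Re_mul ?Im_mul /= -!RintegralZl//.
  rewrite -RintegralB//; [|exact: iZ|exact: iZ].
  by apply: eq_Rintegral => x _; rewrite Re_mul.
rewrite -RintegralD//; [|exact: iZ|exact: iZ].
by apply: eq_Rintegral => x _; rewrite Im_mul.
Qed.

Lemma eq_cintegral f g : (forall x, D x -> f x = g x) -> cintegral mu D f = cintegral mu D g.
Proof.
move=> fg; apply: complex_ext => /=; apply: eq_Rintegral => x; rewrite inE => Dx; by rewrite fg.
Qed.

Lemma eq_cintegrable f g : (forall x, D x -> f x = g x) -> cintegrable mu D f -> cintegrable mu D g.
Proof.
move=> fg [i1 i2]; split.
  by apply: eq_integrable i1 => // x; rewrite inE => Dx /=; rewrite fg.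
by apply: eq_integrable i2 => // x; rewrite inE => Dx /=; rewrite fg.
Qed.

Lemma real_dominated (f_ : nat -> T -> R) (f g : T -> R) :
  (forall n, measurable_fun D (f_ n)) -> measurable_fun D f ->
  (forall x, D x -> (fun n => f_ n x) @ \oo --> f x) ->
  mu.-integrable D (EFin \o g) ->
  (forall n x, D x -> `|f_ n x| <= g x) ->
  (fun n => \int[mu]_(x in D) f_ n x) @ \oo --> (\int[mu]_(x in D) f x).
Proof.
move=> mf_ mf cf ig dom.
have [] := @dominated_convergence _ _ _ mu D mD (fun n => EFin \o f_ n) (EFin \o f) (EFin \o g).
- by move=> n; exact/measurable_EFinP.
- exact/measurable_EFinP.
- by apply: aeW => x Dx; apply: cvg_EFin; [exact: nearW|exact: cf].
- exact: ig.
- by apply: aeW => x n Dx /=; rewrite lee_fin dom.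
move=> i1 _ c; rewrite /Rintegral; apply: fine_cvg.
rewrite fineK; first exact: c.
exact: integrable_fin_num.
Qed.

Lemma cdominated (f_ : nat -> T -> R[i]) (f : T -> R[i]) (g : T -> R) :
  (forall n, cmeasurable (f_ n)) -> cmeasurable f ->
  (forall x, D x -> (fun n => f_ n x) @ \oo --> (f x : R[i]^o)) ->
  mu.-integrable D (EFin \o g) ->
  (forall n x, D x -> normc (f_ n x) <= g x) ->
  (fun n => cintegral mu D (f_ n)) @ \oo --> (cintegral mu D f : R[i]^o).
Proof.
move=> mf_ [mf1 mf2] cf ig dom; apply/ccvgP; split => /=; apply: (@real_dominated _ _ g) => //.
- by move=> n; have [] := mf_ n.
- by move=> x Dx; have /ccvgP[] := cf x Dx.
- by move=> n x Dx; apply: le_trans (normc_Re _) (dom _ _ Dx).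
- by move=> n; have [] := mf_ n.
- by move=> x Dx; have /ccvgP[] := cf x Dx.
- by move=> n x Dx; apply: le_trans (normc_Im _) (dom _ _ Dx).
Qed.

End cintegral_theory.

(** * Integrals of powers and the Beta integral *)

Section power_integrals.
Context (R : realType) (c : R).
Hypothesis c0 : 0 < c.
Notation leb := (@lebesgue_measure R).
Notation normc := ComplexField.Normc.normc.
Notation I0c := (`](0 : R)%R, c[%classic).
Notation I0cc := (`](0 : R)%R, c]%classic).

(** Change of variable x = ln t: by the fundamental theorem of calculus on
[exp (- n), c] and monotone convergence, which needs the integrand to be
nonnegative. *)
Lemma integral_ln_comp (G g : R -> R) : (forall x : R, is_derive x 1 G (g x)) ->
  continuous g -> (forall x, 0 <= g x) ->
  (fun n : nat => G (- n%:R)) @ \oo --> (0 : R) ->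
  (\int[leb]_(t in I0c) (g (ln t) / t)%:E = (G (ln c))%:E)%E.
Proof.
move=> dG cg g0 G0.
pose f t := g (ln t) / t.
pose F t := G (ln t).
have dF (t : R) : 0 < t -> is_derive t 1 F (f t).
  move=> t0; have d1 := is_derive1_ln t0; have d2 := dG (ln t).
  have := @is_derive1_comp R G (@ln R) t _ _ d2 d1.
  by rewrite /f.
have cf (t : R) : 0 < t -> {for t, continuous f}.
  move=> t0; apply: continuousM.
    apply: (@continuous_comp _ _ _ (@ln R) g); first exact: continuous_ln.
    exact: cg.
  by apply: continuousV => //; rewrite gt_eqF.
have cF (t : R) : 0 < t -> {for t, continuous F}.
  move=> t0; apply: differentiable_continuous; apply/derivable1_diffP.
  exact: (@ex_derive _ _ _ _ _ _ _ (dF t t0)).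
pose I n : set (measurableTypeR R) := `[expR (- n%:R) : R, c]%classic.
have In n : expR (- n%:R) < c -> (\int[leb]_(t in I n) (f t)%:E = (G (ln c))%:E - (G (- n%:R))%:E)%E.
  move=> e1.
  have pos t : expR (- n%:R) <= t -> 0 < t by apply: lt_le_trans; exact: expR_gt0.
  rewrite (@continuous_FTC2 _ f F)//.
  - by rewrite /F expRK.
  - apply: continuous_in_subspaceT => t; rewrite inE/= in_itv/= => /andP[/pos t0 _].
    exact: cf.
  - split.
    + move=> t; rewrite in_itv/= => /andP[/ltW/pos t0 _].
      exact: (@ex_derive _ _ _ _ _ _ _ (dF t t0)).
    + apply: cvg_at_right_filter; apply: cF; exact: expR_gt0.
    + by apply: cvg_at_left_filter; apply: cF.
  - move=> t; rewrite in_itv/= => /andP[/ltW/pos t0 _].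
    by rewrite derive1E; have := dF t t0 => /(@derive_val _ _ _ _ _ _ _).
have mf : measurable_fun (I0cc : set (measurableTypeR R)) (fun t => (f t)%:E).
  apply/measurable_EFinP; apply: subspace_continuous_measurable_fun => //.
  apply: continuous_in_subspaceT => t; rewrite inE/= in_itv/= => /andP[t0 _].
  exact: cf.
have c1 := @ge0_nondecreasing_set_cvg_integral _ (measurableTypeR R) R I (fun t => (f t)%:E) leb.
have Iu : \bigcup_n I n = I0cc.
  apply/seteqP; split => t.
    move=> [n _]; rewrite /I/= !in_itv/= => /andP[h ->]; rewrite andbT.
    by apply: lt_le_trans h; exact: expR_gt0.
  rewrite /= in_itv/= => /andP[t0 t1]; exists (Num.truncn (- ln t)).+1 => //.
  rewrite /I/= in_itv/= t1 andbT -[leRHS]lnK ?posrE// ler_expR lerNl.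
  by apply: ltW; apply: truncnS_gt.
have sub n : I n `<=` I0cc by rewrite -Iu; exact: bigcup_sup.
have {c1} : (\int[leb]_(x in I i) (f x)%:E)%E @[i --> \oo] --> (\int[leb]_(x in I0cc) (f x)%:E)%E.
  rewrite -Iu; apply: c1.
  - move=> m n mn; apply/subsetPset => t; rewrite /I/= !in_itv/= => /andP[h ->]; rewrite andbT.
    by apply: le_trans h; rewrite ler_expR lerN2 ler_nat.
  - by move=> n; exact: measurable_itv.
  - by move=> n; apply: measurable_funS mf => //; exact: sub.
  - move=> n t /sub; rewrite /= in_itv/= => /andP[t0 _]; rewrite lee_fin /f.
    by rewrite divr_ge0// ltW.
rewrite integral_itv_bndo_bndc; last first.
  apply: measurable_funS mf => // t; by rewrite /= !in_itv/= => /andP[-> /ltW].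
have c2 : (\int[leb]_(x in I i) (f x)%:E)%E @[i --> \oo] --> (G (ln c))%:E.
  have : (fun n => (G (ln c) - G (- n%:R))%:E) @ \oo --> (G (ln c))%:E.
    apply: cvg_EFin; first exact: nearW.
    rewrite -[X in _ --> X]subr0; apply: cvgB => //; exact: cvg_cst.
  apply: cvg_trans; apply: near_eq_cvg; near=> n; rewrite In//; near: n.
  exists (Num.truncn (- ln c)).+1 => //= n nc; rewrite -[ltRHS]lnK ?posrE// ltr_expR ltrNl.
  by apply: lt_le_trans (truncnS_gt _) _; rewrite ler_nat.
move=> c3; exact: (cvg_unique _ c3 c2).
Unshelve. all: by end_near. Qed.

Lemma cos_int_G (a b th : R) : 0 < a ->
  let G := fun x => expR (a * x) * (a^-1 + (a * cos (b * x + th) + b * sin (b * x + th)) / (a ^+ 2 + b ^+ 2)) in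
  forall x : R, is_derive x 1 G (expR (a * x) * (1 + cos (b * x + th))).
Proof.
move=> a0 G x.
have q0 : a ^+ 2 + b ^+ 2 != 0 by rewrite gt_eqF// ltr_pwDl// ?sqr_ge0// exprn_gt0.
rewrite /G; apply: is_derive_eq.
rewrite /GRing.scale /=; set S := sin _; set C := cos _; set X := expR _.
field.
by rewrite q0 gt_eqF.
Qed.

(** The term 1 is added to the cosine to make the integrand nonnegative, as
[integral_ln_comp] requires; it is removed in [osc_int]. *)
Lemma cos_int (a b th : R) : 0 < a ->
  (\int[leb]_(t in I0c) (expR ((a - 1) * ln t) * (1 + cos (b * ln t + th)))%:E =
   (expR (a * ln c) * (a^-1 + (a * cos (b * ln c + th) + b * sin (b * ln c + th)) / (a ^+ 2 + b ^+ 2)))%:E)%E.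
Proof.
move=> a0.
pose G := fun x => expR (a * x) * (a^-1 + (a * cos (b * x + th) + b * sin (b * x + th)) / (a ^+ 2 + b ^+ 2)).
pose g := fun x => expR (a * x) * (1 + cos (b * x + th)).
have := @integral_ln_comp G g (@cos_int_G a b th a0).
rewrite {2}/G => <-.
- apply: eq_integral => t; rewrite inE/= in_itv/= => /andP[t0 t1]; congr EFin.
  rewrite /g mulrBl mul1r expRB lnK ?posrE//; ring.
- move=> x; apply: cvgM.
    by apply: (@continuous_comp _ _ _ (fun x => a * x) expR); [exact: mulrl_continuous|exact: continuous_expR].
  apply: cvgD; first exact: cvg_cst.
  apply: (@continuous_comp _ _ _ (fun x => b * x + th) cos); last exact: continuous_cos.
  by apply: cvgD; [exact: mulrl_continuous|exact: cvg_cst].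
- move=> x; rewrite mulr_ge0 ?expR_ge0//.
set q := a ^+ 2 + b ^+ 2.
pose K := a^-1 + (a + `|b|) / q.
have q0 : 0 < q by rewrite /q ltr_pwDl// ?sqr_ge0// exprn_gt0.
have bd n : `|G (- n%:R)| <= K * expR (- a) ^+ n.
  rewrite /G normrM ger0_norm ?expR_ge0// mulrC.
  have -> : a * - n%:R = n%:R * - a by rewrite mulrN mulrN mulrC.
  rewrite expRM_natl ler_wpM2r// ?exprn_ge0 ?expR_ge0//.
  apply: le_trans (ler_normD _ _) _; rewrite /K ger0_norm ?invr_ge0 ?(ltW a0)// lerD2l.
  rewrite normrM [X in _ * X]ger0_norm ?invr_ge0 ?(ltW q0)//.
  rewrite ler_wpM2r ?invr_ge0 ?(ltW q0)//.
  apply: le_trans (ler_normD _ _) _; rewrite !normrM (ger0_norm (ltW a0)).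
  apply: lerD.
    by rewrite ler_piMr ?(ltW a0)// ler_norml cos_geN1 cos_le1.
  by rewrite ler_piMr// ler_norml sin_geN1 sin_le1.
have lim : (fun n => K * expR (- a) ^+ n) @ \oo --> (0 : R).
  rewrite -[X in _ --> X](mulr0 K); apply: cvgM; first exact: cvg_cst.
  apply: cvg_expr; rewrite ger0_norm ?expR_ge0// expR_lt1; lra.
apply/norm_cvg0P; apply: (squeeze_cvgr _ _ lim); last exact: cvg_cst.
by near=> n; rewrite normr_ge0 bd.
Unshelve. all: by end_near. Qed.

Lemma exp_int (a : R) : 0 < a ->
  (\int[leb]_(t in I0c) (expR ((a - 1) * ln t))%:E = (expR (a * ln c) / a)%:E)%E.
Proof.
move=> a0; have := @cos_int a 0 0 a0; rewrite mul0r addr0 cos0 sin0 mulr1 mulr0 addr0 expr0n/= addr0.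
have -> : a^-1 + a / a ^+ 2 = 2 * a^-1 by field; rewrite gt_eqF.
under eq_integral do rewrite mul0r addr0 cos0 mulrC EFinM.
rewrite ge0_integralZl//; last first.
  apply/measurable_EFinP; apply: measurableT_comp => //.
  by apply: measurable_funM => //; apply: measurable_funTS; exact: measurable_ln.
case: (\int[leb]_(t in _) _)%E => [r| |].
- by rewrite -EFinM => -[h]; congr EFin; move: h; set X := expR _; rewrite mulrCA; lra.
- by rewrite mulry gtr0_sg// mul1e.
- by rewrite mulrNy gtr0_sg// mul1e.
Qed.

Lemma measurable_I0c : measurable (I0c : set (measurableTypeR R)).
Proof. exact: measurable_itv. Qed.

Lemma measurable_expR_ln (a : R) : measurable_fun setT (fun t : R => expR (a * ln t)).
Proof.
apply: measurableT_comp => //; apply: measurable_funM => //; exact: measurable_ln.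
Qed.

Lemma exp_integrable (a : R) : 0 < a ->
  leb.-integrable I0c (EFin \o (fun t => expR ((a - 1) * ln t))).
Proof.
move=> a0; apply/integrableP; split.
  by apply/measurable_EFinP; apply: measurable_funTS; exact: measurable_expR_ln.
under eq_integral do rewrite /= ger0_norm ?expR_ge0//.
by rewrite exp_int// ltry.
Qed.

Lemma measurable_osc (b th : R) : measurable_fun setT (fun t : R => cos (b * ln t + th)).
Proof.
apply: (measurableT_comp (@measurable_cos R)); apply: measurable_funD => //.
apply: measurable_funM => //; exact: measurable_ln.
Qed.

(** Difference of [cos_int] and [exp_int]. *)
Lemma osc_int (a b th : R) : 0 < a ->
  (\int[leb]_(t in I0c) (expR ((a - 1) * ln t) * cos (b * ln t + th)) =
   expR (a * ln c) * ((a * cos (b * ln c + th) + b * sin (b * ln c + th)) / (a ^+ 2 + b ^+ 2)))%R.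
Proof.
move=> a0.
have i1 := exp_integrable a0.
have i2 : leb.-integrable I0c (EFin \o (fun t => expR ((a - 1) * ln t) * (1 + cos (b * ln t + th)))).
  apply/integrableP; split.
    apply/measurable_EFinP; apply: measurable_funTS; apply: measurable_funM.
      exact: measurable_expR_ln.
    apply: measurable_funD => //; exact: measurable_osc.
  under eq_integral => t _ do rewrite /= ger0_norm ?(mulr_ge0 (expR_ge0 _))//.
  by rewrite cos_int// ltry.
have -> : (\int[leb]_(t in I0c) (expR ((a - 1) * ln t) * cos (b * ln t + th)) =
  \int[leb]_(t in I0c) ((expR ((a - 1) * ln t) * (1 + cos (b * ln t + th))) - expR ((a - 1) * ln t)))%R.
  by apply: eq_Rintegral => t _; ring.
rewrite RintegralB// /Rintegral cos_int// exp_int//=.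
by ring.
Qed.

Lemma cpow_integrable (w : R[i]) : 0 < complex.Re w ->
  cintegrable leb I0c (fun t => cpow t (w - 1)).
Proof.
move=> w0; apply: (@cintegrable_dom _ _ R leb I0c measurable_I0c _
   (fun t => expR ((complex.Re w - 1) * ln t))).
- split; apply: measurable_funTS.
    under eq_fun do rewrite Re_cpow; apply: measurable_funM; first exact: measurable_expR_ln.
    by have := @measurable_osc (complex.Im (w - 1)) 0; under eq_fun do rewrite addr0.
  under eq_fun do rewrite Im_cpow; apply: measurable_funM; first exact: measurable_expR_ln.
  apply: (measurableT_comp (@measurable_sin R)); apply: measurable_funM => //; exact: measurable_ln.
- by move=> t _; rewrite normc_cpow Re_add Re_opp.
- exact: exp_integrable.
Qed.

(** Real and imaginary parts are the cases of the phases 0 and - pi / 2 of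
[osc_int]. *)
Lemma cpow_int (w : R[i]) : 0 < complex.Re w ->
  cintegral leb I0c (fun t => cpow t (w - 1)) = cpow c w / w.
Proof.
move=> w0.
have rV : complex.Re w^-1 = complex.Re w / (complex.Re w ^+ 2 + complex.Im w ^+ 2) by case: w w0.
have iV : complex.Im w^-1 = - complex.Im w / (complex.Re w ^+ 2 + complex.Im w ^+ 2).
  by case: w w0 {rV} => x y _ /=; rewrite mulNr.
apply: complex_ext.
  have := @osc_int (complex.Re w) (complex.Im w) 0 w0; rewrite addr0 => e.
  rewrite Re_mul Re_cpow Im_cpow rV iV.
  transitivity (\int[leb]_(t in I0c) (expR ((complex.Re w - 1) * ln t) * cos (complex.Im w * ln t + 0)))%R.
    by apply: eq_Rintegral => t _; rewrite Re_cpow Re_add Im_add Re_opp Im_opp /= subr0 addr0.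
  by rewrite e; ring.
have := @osc_int (complex.Re w) (complex.Im w) (- (pi / 2)) w0 => e.
rewrite Im_mul Re_cpow Im_cpow rV iV.
transitivity (\int[leb]_(t in I0c) (expR ((complex.Re w - 1) * ln t) * cos (complex.Im w * ln t + - (pi / 2))))%R.
  by apply: eq_Rintegral => t _; rewrite Im_cpow Re_add Im_add Re_opp Im_opp /= subr0 cosBpihalf.
have sB (x : R) : sin (x - pi / 2) = - cos x by rewrite sinB cos_pihalf sin_pihalf mulr0 add0r mulr1.
by rewrite e cosBpihalf sB; ring.
Qed.

Lemma beta_integrable n (w : R[i]) : 0 < complex.Re w ->
  cintegrable leb I0c (fun t => cpow t (w - 1) * ((1 - t / c) ^+ n)%:C).
Proof.
move=> w0; elim: n w w0 => [|n IH] w w0.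
  by apply: eq_cintegrable (cpow_integrable w0) => // t _; rewrite expr0 mulr1.
have w1 : 0 < complex.Re (w + 1) by rewrite Re_add addr_gt0.
have e (t : R) : I0c t -> cpow t (w - 1) * ((1 - t / c) ^+ n)%:C - (c^-1)%:C * (cpow t (w + 1 - 1) * ((1 - t / c) ^+ n)%:C) =
   cpow t (w - 1) * ((1 - t / c) ^+ n.+1)%:C.
  rewrite /= in_itv/= => /andP[t0 _]; rewrite (addrAC w) (cpowD _ (w - 1) 1) cpow1//.
  rewrite exprS; set X := cpow _ _; set Y := (1 - t / c) ^+ n.
  have -> : ((1 - t / c) * Y)%:C = (1 - t%:C * (c^-1)%:C) * Y%:C :> R[i].
    by apply: complex_ext; rewrite ?Re_mul ?Im_mul ?Re_add ?Im_add ?Re_opp ?Im_opp ?Re_mul ?Im_mul /=; ring.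
  by ring.
apply: (eq_cintegrable measurable_I0c e); apply: cintegrableB; [exact: measurable_I0c|exact: IH|].
by apply: cintegrableZ; [exact: measurable_I0c|exact: IH].
Qed.

(** By induction on n: multiplication by 1 - t / c expresses the integral at
(n + 1, w) by those at (n, w) and (n, w + 1). *)
Lemma beta_int n (w : R[i]) : 0 < complex.Re w ->
  cintegral leb I0c (fun t => cpow t (w - 1) * ((1 - t / c) ^+ n)%:C) =
  cpow c w * n`!%:R / \prod_(k < n.+1) (w + k%:R).
Proof.
elim: n w => [|n IH] w w0.
  rewrite big_ord1 addr0 fact0 mulr1 -cpow_int//; apply: eq_cintegral => t _.
  by rewrite expr0 mulr1.
have w1 : 0 < complex.Re (w + 1) by rewrite Re_add addr_gt0.
have e (t : R) : I0c t -> cpow t (w - 1) * ((1 - t / c) ^+ n)%:C - (c^-1)%:C * (cpow t (w + 1 - 1) * ((1 - t / c) ^+ n)%:C) =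
   cpow t (w - 1) * ((1 - t / c) ^+ n.+1)%:C.
  rewrite /= in_itv/= => /andP[t0 _]; rewrite (addrAC w) (cpowD _ (w - 1) 1) cpow1//.
  rewrite exprS; set X := cpow _ _; set Y := (1 - t / c) ^+ n.
  have -> : ((1 - t / c) * Y)%:C = (1 - t%:C * (c^-1)%:C) * Y%:C :> R[i].
    by apply: complex_ext; rewrite ?Re_mul ?Im_mul ?Re_add ?Im_add ?Re_opp ?Im_opp ?Re_mul ?Im_mul /=; ring.
  by ring.
have Bi := @beta_integrable n w w0; have Bi1 := @beta_integrable n (w + 1) w1.
have mI := measurable_I0c.
rewrite -(eq_cintegral leb e) cintegralB//; last exact: cintegrableZ.
rewrite cintegralZ// IH// IH//.
have nz k : w + k%:R != 0.
  apply/eqP => /(congr1 (@complex.Re R)); rewrite Re_add Re_nat => h.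
  by have := ltr_wpDr (ler0n R k) w0; rewrite h ltxx.
have p1 : \prod_(k < n.+2) (w + k%:R) = w * \prod_(k < n.+1) (w + 1 + k%:R).
  rewrite big_ord_recl /= addr0; congr (_ * _); apply: eq_bigr => k _.
  by rewrite /bump /= natrD addrA.
have p2 : \prod_(k < n.+2) (w + k%:R) = \prod_(k < n.+1) (w + k%:R) * (w + n.+1%:R).
  by rewrite big_ord_recr.
have nzp : \prod_(k < n.+1) (w + k%:R) != 0 by apply/prodf_neq0 => k _; exact: nz.
have w0' : w != 0 by have := nz 0%N; rewrite addr0.
have wn : w + n.+1%:R != 0 by exact: nz.
rewrite p2 factS natrM cpowD cpow1//.
have e2 : \prod_(k < n.+1) (w + 1 + k%:R) = \prod_(k < n.+1) (w + k%:R) * (w + n.+1%:R) / w.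
  by apply/eqP; rewrite eq_sym -(mulrC w^-1) -p2 p1 mulKf.
have cc : (c^-1)%:C * (cpow c w * c%:C * n`!%:R / \prod_(k < n.+1) (w + 1 + k%:R)) =
   cpow c w * n`!%:R / \prod_(k < n.+1) (w + 1 + k%:R).
  have h : (c^-1)%:C * c%:C = 1 :> R[i].
    by apply: complex_ext; rewrite ?Re_mul ?Im_mul /= ?mulVf ?gt_eqF//; ring.
  set Q := \prod_(k < _) _; transitivity ((c^-1)%:C * c%:C * (cpow c w * n`!%:R / Q)); first by ring.
  by rewrite h mul1r.
rewrite cc e2; field.
by rewrite nat1r wn nzp w0'.
Qed.

End power_integrals.

(** * Euler's limit formula for the Gamma function *)

Section gamma.
Context (R : realType).
Notation leb := (@lebesgue_measure R).
Notation normc := ComplexField.Normc.normc.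
Notation Iy := (`](0 : R)%R, +oo[%classic).

(** From [x <= exp x] at x = t / (2 (N + 1)). *)
Lemma pow_exp_bound (N : nat) (t : R) : 0 <= t ->
  t ^+ N.+1 <= (2 * N.+1%:R) ^+ N.+1 * expR (t / 2).
Proof.
move=> t0; have N0 : 0 < 2 * N.+1%:R :> R by rewrite mulr_gt0.
have -> : expR (t / 2) = expR (t / (2 * N.+1%:R)) ^+ N.+1.
  by rewrite -expRM_natl; congr expR; field; rewrite nat1r pnatr_eq0.
rewrite -exprMn lerXn2r ?nnegrE//.
rewrite mulrC -ler_pdivrMr//.
by apply: le_trans (expR_ge1Dx _); rewrite lerDr.
Qed.

Lemma measurable_Iy : measurable (Iy : set (measurableTypeR R)).
Proof. exact: measurable_itv. Qed.

(** Modulus of the integrand of Euler's integral. *)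
Definition gamma_ker (a t : R) : R := expR ((a - 1) * ln t) * expR (- t).

Lemma measurable_gamma_ker a : measurable_fun setT (gamma_ker a).
Proof.
apply: measurable_funM; first exact: measurable_expR_ln.
apply: measurableT_comp => //; exact: measurableT_comp.
Qed.

Lemma gamma_ker_ge0 a t : 0 <= gamma_ker a t.
Proof. by rewrite mulr_ge0// expR_ge0. Qed.

(** Dominated by a power of t near 0 and by a decreasing exponential near
infinity. *)
Lemma gamma_ker_integrable a : 0 < a -> leb.-integrable Iy (EFin \o gamma_ker a).
Proof.
move=> a0.
have mk D : measurable_fun (D : set (measurableTypeR R)) (EFin \o gamma_ker a).
  by apply/measurable_EFinP; apply: measurable_funTS; exact: measurable_gamma_ker.
have i1 : leb.-integrable `]0, 1[%classic (EFin \o gamma_ker a).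
  apply: (le_integrable (@measurable_I0c R 1) _ _ (exp_integrable ltr01 a0)) => //.
  move=> t; rewrite /= in_itv/= => /andP[t0 _]; rewrite lee_fin !ger0_norm ?expR_ge0 ?gamma_ker_ge0//.
  by rewrite /gamma_ker ler_piMr ?expR_ge0// -expR0 ler_expR oppr_le0 ltW.
have m1 : measurable (`[1, +oo[%classic : set (measurableTypeR R)) by exact: measurable_itv.
have i2 : leb.-integrable `[1, +oo[%classic (EFin \o gamma_ker a).
  (* any integer N with a - 1 <= N + 1 *)
  pose N := Num.truncn a.
  pose C : R := (2 * N.+1%:R) ^+ N.+1.
  have ie : leb.-integrable `[1, +oo[%classic (EFin \o (fun t => C * 2 * exponential_pdf (2^-1 : R) t)).
    have h : 0 < 2^-1 :> R by rewrite invr_gt0.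
    have := integrableZl m1 (C * 2) (integrableS measurableT m1 (@subsetT _ _) (integrable_exponential_pdf h)).
    exact.
  apply: (le_integrable m1 _ _ ie) => //.
  move=> t; rewrite /= in_itv/= andbT => t1; rewrite lee_fin ger0_norm ?gamma_ker_ge0//.
  apply: le_trans (ler_norm _).
  have t0 : 0 < t by apply: lt_le_trans t1.
  rewrite exponential_pdfE ?(ltW t0)// /gamma_ker.
  have e1 : expR ((a - 1) * ln t) <= t ^+ N.+1.
    rewrite -[in leRHS](@lnK _ t) ?posrE// -expRM_natl ler_expR ler_wpM2r ?ln_ge0//.
    have := truncnS_gt a; rewrite -/N; lra.
  apply: le_trans (_ : C * expR (t / 2) * expR (- t) <= _).
    rewrite ler_wpM2r ?expR_ge0//; apply: le_trans e1 _; apply: pow_exp_bound; exact: ltW.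
  rewrite -mulrA -expRD (_ : t / 2 + - t = - 2^-1 * t); last by field.
  by rewrite le_eqVlt; apply/orP; left; apply/eqP; field.
have -> : Iy = `]0, 1[%classic `|` `[1, +oo[%classic.
  apply/seteqP; split => t; rewrite /= !in_itv/= !andbT.
    by move=> t0; case: (ltP t 1) => h; [left; rewrite t0|right].
  by case=> [/andP[]//|]; apply: lt_le_trans.
move: i1 i2 => /integrableP[_ f1] /integrableP[_ f2]; apply/integrableP; split => //.
rewrite ge0_integral_setU//.
- exact: lte_add_pinfty.
- exact: measurableT_comp.
- apply/disj_setPS => t; rewrite /= !in_itv/= andbT => -[/andP[_ t1] t2].
  by have := lt_le_trans t1 t2; rewrite ltxx.
Qed.

Lemma onemXn_le_expR (n : nat) (y : R) : 0 <= y <= 1 -> (1 - y) ^+ n <= expR (- (n%:R * y)).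
Proof.
move=> /andP[y0 y1]; rewrite -mulrN expRM_natl lerXn2r ?nnegrE ?expR_ge0 ?subr_ge0//.
by have := expR_ge1Dx (- y); lra.
Qed.

(** Bernoulli's inequality, starting from [exp (- y) (1 - y^2) <= 1 - y]. *)
Lemma onemXn_ge (n : nat) (y : R) : 0 <= y <= 1 ->
  expR (- (n%:R * y)) * (1 - n%:R * y ^+ 2) <= (1 - y) ^+ n.
Proof.
move=> /andP[y0 y1].
have h : expR (- y) * (1 - y ^+ 2) <= 1 - y.
  have -> : 1 - y ^+ 2 = (1 + y) * (1 - y) by ring.
  rewrite mulrA ler_piMl ?subr_ge0// expRN mulrC ler_pdivrMr ?expR_gt0// mul1r.
  exact: expR_ge1Dx.
have h0 : 0 <= 1 - y ^+ 2 by rewrite subr_ge0 exprn_ile1.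
apply: le_trans (_ : (expR (- y) * (1 - y ^+ 2)) ^+ n <= _); last first.
  by rewrite lerXn2r ?nnegrE ?subr_ge0// mulr_ge0 ?expR_ge0.
rewrite exprMn -expRM_natl mulrN ler_wpM2l ?expR_ge0//.
elim: n => [|n IH]; first by rewrite mul0r subr0 expr0.
rewrite [leRHS]exprS -natr1.
have : (1 - y ^+ 2) * (1 - n%:R * y ^+ 2) <= (1 - y ^+ 2) * (1 - y ^+ 2) ^+ n by rewrite ler_wpM2l.
apply: le_trans.
have : 0 <= n%:R * y ^+ 2 * y ^+ 2 by rewrite !mulr_ge0// sqr_ge0.
lra.
Qed.

Lemma onemXn_cvg (t : R) : 0 <= t ->
  (fun n : nat => (1 - t / n.+1%:R) ^+ n.+1) @ \oo --> expR (- t).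
Proof.
move=> t0.
have c1 : (fun n : nat => n.+1%:R^-1 : R) @ \oo --> (0 : R) by exact: cvg_harmonic.
have c2 : (fun n : nat => expR (- t) * (1 - t ^+ 2 * n.+1%:R^-1)) @ \oo --> expR (- t).
  rewrite -[X in _ --> X](_ : expR (- t) * (1 - t ^+ 2 * 0) = _); last by rewrite mulr0 subr0 mulr1.
  apply: cvgM; first exact: cvg_cst.
  apply: cvgB; first exact: cvg_cst.
  by apply: cvgM => //; exact: cvg_cst.
apply: (squeeze_cvgr _ c2); last exact: (cvg_cst (expR (- t))).
near=> n.
have nt : t <= n.+1%:R.
  near: n; exists (Num.truncn t) => //= n /= nt.
  by apply: ltW; apply: lt_le_trans (truncnS_gt _) _; rewrite ler_nat.
have y01 : 0 <= t / n.+1%:R <= 1.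
  by rewrite divr_ge0//= ler_pdivrMr// mul1r.
have ny : n.+1%:R * (t / n.+1%:R) = t by rewrite mulrCA mulfV ?pnatr_eq0// mulr1.
have := onemXn_le_expR n.+1 y01; have := onemXn_ge n.+1 y01; rewrite ny => + ->.
rewrite andbT (_ : n.+1%:R * (t / n.+1%:R) ^+ 2 = t ^+ 2 / n.+1%:R)//.
by field; rewrite addrC natr1 pnatr_eq0.
Unshelve. all: by end_near. Qed.

(** Euler's integral is the limit of the Beta integrals on ]0, n + 1[, since
(1 - t / (n + 1))^(n + 1) tends to exp (- t) and stays below it. *)
Lemma Euler_limit (w : R[i]) : 0 < complex.Re w ->
  (fun n : nat => cpow n.+1%:R w * (n.+1)`!%:R / \prod_(k < n.+2) (w + k%:R)) @ \oo -->
  (Euler_integral w : R[i]^o).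
Proof.
move=> w0; set a := complex.Re w.
pose J n : set R := `]0, n.+1%:R[%classic.
pose f n (t : R) : R[i] := if t < n.+1%:R then cpow t (w - 1) * ((1 - t / n.+1%:R) ^+ n.+1)%:C else 0.
have fE n : cintegral leb Iy (f n) = cpow n.+1%:R w * (n.+1)`!%:R / \prod_(k < n.+2) (w + k%:R).
  rewrite -beta_int//.
  have JI : J n = Iy `&` J n.
    by apply/seteqP; split => t; rewrite /J /= !in_itv/= ?andbT; [move=> /andP[-> ->]|move=> []].
  have aux (h h' : R -> R) : (forall t, h' t = if t < n.+1%:R then h t else 0) ->
     (\int[leb]_(t in Iy) h' t = \int[leb]_(t in J n) h t)%R.
    move=> hh; rewrite JI Rintegral_mkcondr; apply: eq_Rintegral => t; rewrite inE /= in_itv/= andbT => t0.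
    by rewrite hh patchE /J mem_setE in_itv/= t0.
  apply: complex_ext; rewrite [LHS]/= [RHS]/=; apply: aux => t; rewrite /f; by case: ifP.
rewrite (_ : (fun n => _) = (fun n => cintegral leb Iy (f n))); last by apply/funext => n; rewrite fE.
have mc (g : R -> R) : measurable_fun setT g ->
   cmeasurable Iy (fun t => cpow t (w - 1) * (g t)%:C).
  move=> mg; split; apply: measurable_funTS.
    rewrite (_ : (fun x => _) = (fun t => (expR ((a - 1) * ln t) * cos (complex.Im w * ln t)) * g t)).
      apply: measurable_funM => //; apply: measurable_funM; first exact: measurable_expR_ln.
      apply: (measurableT_comp (@measurable_cos R)); apply: measurable_funM => //; exact: measurable_ln.
    by apply/funext => t; rewrite Re_mul Re_cpow /= mulr0 subr0 Re_add Im_add Re_opp Im_opp /= subr0.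
  rewrite (_ : (fun x => _) = (fun t => (expR ((a - 1) * ln t) * sin (complex.Im w * ln t)) * g t)).
    apply: measurable_funM => //; apply: measurable_funM; first exact: measurable_expR_ln.
    apply: (measurableT_comp (@measurable_sin R)); apply: measurable_funM => //; exact: measurable_ln.
  by apply/funext => t; rewrite Im_mul Im_cpow /= mulr0 add0r Re_add Im_add Re_opp Im_opp /= subr0.
apply: (@cdominated _ _ _ leb Iy measurable_Iy f _ (gamma_ker a)).
- move=> n; pose g (t : R) := if t < n.+1%:R then (1 - t / n.+1%:R) ^+ n.+1 else 0 : R.
  have -> : f n = (fun t => cpow t (w - 1) * (g t)%:C).
    by apply/funext => t; rewrite /f /g; case: ifP => // _; rewrite mulr0.
  apply: mc; apply: measurable_fun_ifT => //.
    by apply: measurable_fun_ltr.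
  apply: measurable_funX; apply: measurable_funB => //; exact: measurable_funM.
- by apply: mc; apply: measurableT_comp => //; exact: measurableT_comp.
- move=> t; rewrite /= in_itv/= andbT => t0.
  have c : (fun n : nat => cpow t (w - 1) * ((1 - t / n.+1%:R) ^+ n.+1)%:C) @ \oo -->
     (cpow t (w - 1) * (expR (- t))%:C : R[i]^o).
    apply: ccvgM; first exact: ccvg_cst.
    apply/ccvgP; split => /=; [exact/onemXn_cvg/ltW|exact: cvg_cst].
  apply: cvg_trans c; apply: near_eq_cvg; near=> n.
  rewrite /f ifT//; near: n; exists (Num.truncn t) => //= n /= nt.
  by apply: lt_le_trans (truncnS_gt _) _; rewrite ler_nat.
- exact: gamma_ker_integrable.
- move=> n t; rewrite /= in_itv/= andbT => t0; rewrite /f; case: ifP => tn; last first.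
    by rewrite ComplexField.Normc.normc0 gamma_ker_ge0.
  rewrite normcM normc_cpow normc_real Re_add Re_opp /= -/a /gamma_ker ler_wpM2l ?expR_ge0//.
  have y01 : 0 <= t / n.+1%:R <= 1.
    by rewrite divr_ge0 ?(ltW t0)//= ler_pdivrMr// mul1r ltW.
  rewrite ger0_norm; last by rewrite exprn_ge0// subr_ge0; case/andP: y01.
  have := onemXn_le_expR n.+1 y01.
  by rewrite mulrCA mulfV ?pnatr_eq0// mulr1.
Unshelve. all: by end_near. Qed.
(** The normalisation of the binary search tree martingale, at [w = 2 z]. *)
Definition rising_ratio (n : nat) (w : R[i]) : R[i] := \prod_(k < n) ((k%:R + w) / k.+1%:R).

(** The ratio divided by its order of growth. *)
Definition scaled_ratio (n : nat) (w : R[i]) : R[i] := rising_ratio n.+1 w * cpow n.+1%:R (1 - w).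

Lemma rising_ratioE n w : rising_ratio n w = \prod_(k < n) (w + k%:R) / n`!%:R.
Proof.
elim: n => [|n IH]; first by rewrite /rising_ratio !big_ord0 fact0 divr1.
rewrite /rising_ratio !big_ord_recr/= -/(rising_ratio n w) IH factS natrM.
field; rewrite nat1r !pnatr_eq0 -lt0n fact_gt0//.
Qed.

Lemma rising_ratio_neq0 n w : (forall k : nat, w + k%:R != 0) -> rising_ratio n w != 0.
Proof.
move=> h; rewrite rising_ratioE mulf_neq0 ?invr_eq0 ?pnatr_eq0 -?lt0n ?fact_gt0//.
exact/prodf_neq0.
Qed.

(** The sequence of [Euler_limit] is the inverse of [scaled_ratio n w], up to a
factor that tends to 1. *)
Lemma Euler_scaled_ratio n w : (forall k : nat, w + k%:R != 0) ->
  cpow n.+1%:R w * (n.+1)`!%:R / \prod_(k < n.+2) (w + k%:R) =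
  (scaled_ratio n w * ((w + n.+1%:R) / n.+1%:R))^-1.
Proof.
move=> h; rewrite big_ord_recr/= /scaled_ratio rising_ratioE cpowD cpow1//.
have e : cpow n.+1%:R w * cpow n.+1%:R (- w) = 1.
  by rewrite -cpowD subrr /cpow mul0r cexp0.
have n0 : (n.+1)%:R != 0 :> R[i] by rewrite pnatr_eq0.
have f0 : (n.+1)`!%:R != 0 :> R[i] by rewrite pnatr_eq0 -lt0n fact_gt0.
have p0 : \prod_(k < n.+1) (w + k%:R) != 0 by exact/prodf_neq0.
have w0 := h n.+1.
rewrite (_ : (n.+1%:R : R)%:C = n.+1%:R :> R[i]); last by rewrite complex_nat.
set X := cpow _ w in e *; set Y := cpow _ _ in e *.
have X0 : X != 0 by exact: cpow_neq0.
have -> : Y = X^-1 by apply/eqP; rewrite -(inj_eq (mulfI X0)) e mulfV.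
move: n0 w0; set N := n.+1%:R; move=> n0 w0; field.
by rewrite !nat1r -/N w0 X0 n0 p0 f0.
Qed.

Lemma ratio_cvg w : (fun n : nat => (w + n.+1%:R) / n.+1%:R) @ \oo --> (1 : R[i]^o).
Proof.
have c1 : (fun n : nat => n.+1%:R^-1 : R) @ \oo --> (0 : R) by exact: cvg_harmonic.
rewrite (_ : (fun n => _) = (fun n : nat => 1 + w * (n.+1%:R^-1 : R)%:C)); last first.
  apply/funext => n; rewrite (_ : ((n.+1%:R : R)^-1)%:C = (n.+1%:R : R[i])^-1); last first.
    by rewrite complex_nat; exact: (fmorphV (real_complex R)).
  by field; rewrite nat1r pnatr_eq0.
have cRe : (fun n : nat => 1 + complex.Re w * n.+1%:R^-1) @ \oo --> (1 + complex.Re w * 0).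
  by apply: cvgD; [exact: cvg_cst|apply: cvgM => //; exact: cvg_cst].
have cIm : (fun n : nat => complex.Im w * n.+1%:R^-1) @ \oo --> (complex.Im w * 0).
  by apply: cvgM => //; exact: cvg_cst.
rewrite mulr0 addr0 in cRe; rewrite mulr0 in cIm.
apply/ccvgP; split.
  rewrite (_ : (fun n => _) = (fun n : nat => 1 + complex.Re w * n.+1%:R^-1)); first exact: cRe.
  by apply/funext => n; rewrite Re_add Re_mul /= mulr0 subr0.
rewrite (_ : (fun n => _) = (fun n : nat => complex.Im w * n.+1%:R^-1)); first exact: cIm.
by apply/funext => n; rewrite Im_add Im_mul /= mulr0 !add0r.
Qed.

Lemma Re_gt0_neq0 (w : R[i]) : 0 < complex.Re w -> forall k : nat, w + k%:R != 0.
Proof.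
move=> w0 k; apply/eqP => /(congr1 (@complex.Re R)); rewrite Re_add Re_nat => h.
by have := ltr_wpDr (ler0n R k) w0; rewrite h ltxx.
Qed.

Lemma Euler_integral_real (a : R) : 0 < a ->
  exists2 g : R, 0 < g & Euler_integral a%:C = g%:C.
Proof.
move=> a0.
have e t : cpow t (a%:C - 1) * (expR (- t))%:C = (gamma_ker a t)%:C.
  rewrite (_ : a%:C - 1 = (a - 1)%:C); last by apply: complex_ext => //=; rewrite oppr0 addr0.
  by rewrite cpow_real; apply: complex_ext; rewrite ?Re_mul ?Im_mul /= /gamma_ker; ring.
exists (\int[leb]_(t in Iy) gamma_ker a t)%R; last first.
  rewrite (_ : Euler_integral _ = cintegral leb Iy (fun t => (gamma_ker a t)%:C)); last first.
    by apply: eq_cintegral => t _; exact: e.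
  apply: complex_ext => //=.
  by rewrite Rintegral_cst ?mul0r//; exact: measurable_Iy.
have ig := gamma_ker_integrable a0.
have i1 := exp_integrable ltr01 a0.
have m1 := @measurable_I0c R 1.
have sub : `]0, (1 : R)[%classic `<=` Iy.
  by move=> t; rewrite /= !in_itv/= andbT => /andP[].
have ig1 : leb.-integrable `]0, 1[%classic (EFin \o gamma_ker a).
  exact: (integrableS measurable_Iy m1 sub ig).
apply: (@lt_le_trans _ _ (\int[leb]_(t in `]0, 1[) gamma_ker a t)%R); last first.
  apply: fine_le; [exact: integrable_fin_num|exact: integrable_fin_num|].
  apply: ge0_subset_integral => //.
    by apply/measurable_EFinP; apply: measurable_funTS; exact: measurable_gamma_ker.
  by move=> t _; rewrite lee_fin gamma_ker_ge0.
apply: (@lt_le_trans _ _ (\int[leb]_(t in `]0, 1[) (expR (-1) * expR ((a - 1) * ln t)))%R).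
  rewrite RintegralZl// /Rintegral exp_int//=.
  by rewrite ln1 mulr0 expR0 mul1r mulr_gt0 ?expR_gt0 ?invr_gt0.
apply: le_Rintegral => //; first by have := integrableZl m1 (expR (-1)) i1.
move=> t; rewrite /= in_itv/= => /andP[t0 t1]; rewrite /gamma_ker mulrC ler_wpM2l ?expR_ge0//.
by rewrite ler_expR lerN2 ltW.
Qed.

Lemma scaled_ratio_real_bounded (a : R) : 0 < a -> exists B, forall n, normc (scaled_ratio n a%:C) <= B.
Proof.
move=> a0; have [g g0 Eg] := Euler_integral_real a0.
have wa : 0 < complex.Re a%:C by [].
have c := Euler_limit wa; rewrite Eg in c.
have nz := Re_gt0_neq0 wa.
have g0' : g%:C != 0 :> R[i].
  by apply/eqP => /(congr1 (@complex.Re R)) /= h; rewrite h ltxx in g0.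
have c2 := ccvgV g0' c.
have c3 : (fun n => scaled_ratio n a%:C) @ \oo --> (g%:C^-1 / 1 : R[i]^o).
  have := ccvgM c2 (ccvgV (oner_neq0 _) (ratio_cvg a%:C)).
  apply: cvg_trans; apply: near_eq_cvg; near=> n.
  rewrite Euler_scaled_ratio// invrK mulfK// mulf_neq0 ?invr_eq0 ?pnatr_eq0//.
have c4 := ccvg_normc c3.
have /cvg_seq_bounded[M [_ hM]] : cvgn (fun n => normc (scaled_ratio n a%:C)) by apply/cvg_ex; exists (normc (g%:C^-1 / 1)).
exists (M + 1) => n; apply: le_trans (ler_norm _) _; apply: hM => //.
by rewrite ltrDl.
Unshelve. all: by end_near. Qed.

Lemma sum_inv_sqr (a : R) n : 0 < a ->
  \sum_(k < n) ((k%:R + a) ^+ 2)^-1 <= (a ^+ 2)^-1 + 3.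
Proof.
move=> a0; case: n => [|n]; first by rewrite big_ord0 addr_ge0// invr_ge0 sqr_ge0.
rewrite big_ord_recl /= add0r lerD2l.
apply: le_trans (_ : 3 - 2 / n.+1%:R <= _); last by rewrite lerBlDr lerDl divr_ge0.
elim: n => [|n IH]; first by rewrite big_ord0 divr1; lra.
rewrite big_ord_recr /=; apply: le_trans (lerD IH (lexx _)) _.
rewrite -addrA lerD2l /bump /= add1n.
have n0 : 0 < n.+1%:R :> R by [].
have e : ((n.+1%:R + a) ^+ 2)^-1 <= (n.+1%:R * n.+1%:R)^-1 :> R.
  rewrite lef_pV2 ?posrE ?exprn_gt0 ?mulr_gt0 ?addr_gt0//.
  by rewrite expr2 ler_pM// ?lerDl ltW.
apply: le_trans (lerD (lexx _) e) _; rewrite -subr_ge0.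
have -> : - (2 / n.+2%:R) - (- (2 / n.+1%:R) + (n.+1%:R * n.+1%:R)^-1) =
   n%:R / (n.+2%:R * (n.+1%:R * n.+1%:R)) :> R.
  rewrite -!(natr1 n.+1) -!(natr1 n); field.
  by rewrite !natr1 !pnatr_eq0.
by rewrite divr_ge0// mulr_ge0// mulr_ge0.
Qed.

(** Each factor of the product satisfies
[|k + w|^2 = (k + a)^2 (1 + b^2 / (k + a)^2)], with a and b the real and
imaginary parts of w, and [1 + x <= exp x]. *)
Lemma normc_rising_ratio_le n (w : R[i]) : 0 < complex.Re w ->
  normc (rising_ratio n w) ^+ 2 <= normc (rising_ratio n (complex.Re w)%:C) ^+ 2 *
    expR (\sum_(k < n) (complex.Im w ^+ 2 / (k%:R + complex.Re w) ^+ 2)).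
Proof.
move=> w0; elim: n => [|n IH].
  by rewrite /rising_ratio !big_ord0 ComplexField.Normc.normc1 expR0 mulr1.
rewrite /rising_ratio !big_ord_recr/= -!/(rising_ratio _ _) !normcM !exprMn expRD.
set X := normc (rising_ratio n w) ^+ 2 in IH *; set X' := _ ^+ 2 in IH *.
set e := expR (\sum_(k < n) _) in IH *.
set Y := normc (n%:R + w) ^+ 2; set Y' := normc (_ + _%:C) ^+ 2.
set Z := normc _^-1 ^+ 2; set ey := expR (_ / _).
have -> : X' * (Y' * Z) * (e * ey) = (X' * e) * (Y' * ey * Z) by ring.
apply: ler_pM => //; [exact: sqr_ge0|by apply: mulr_ge0; exact: sqr_ge0|].
rewrite ler_wpM2r ?sqr_ge0//.
rewrite /Y /Y' /ey !normc_sqr !Re_add !Im_add !Re_nat !Im_nat /= !add0r expr0n/= addr0.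
set x := n%:R + _; set y := complex.Im w.
have x0 : 0 < x by rewrite /x ltr_wpDl.
have x20 : 0 < x ^+ 2 by rewrite exprn_gt0.
have := expR_ge1Dx (y ^+ 2 / x ^+ 2).
rewrite -(ler_pM2l x20); apply: le_trans.
by rewrite mulrDr mulr1 mulrCA mulfV ?gt_eqF// mulr1.
Qed.

(** Comparison with the real part of w, whose Euler integral is positive; the sum
in the exponential of [normc_rising_ratio_le] is bounded. *)
Lemma scaled_ratio_bounded (w : R[i]) : 0 < complex.Re w -> exists2 B, 0 < B & forall n, normc (scaled_ratio n w) <= B.
Proof.
move=> w0; set a := complex.Re w; set b := complex.Im w.
have [B hB] := scaled_ratio_real_bounded w0.
pose K := expR (b ^+ 2 * ((a ^+ 2)^-1 + 3)).
have K1 : 0 < K by exact: expR_gt0.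
exists (`|B| * K + 1) => [|n].
  by rewrite ltr_wpDl// mulr_ge0// ltW.
apply: le_trans (_ : normc (scaled_ratio n a%:C) * K <= _); last first.
  apply: le_trans (_ : `|B| * K <= _); last by rewrite lerDl.
  by rewrite ler_wpM2r ?(ltW K1)//; apply: le_trans (hB n) (ler_norm _).
have Ksq : K <= K ^+ 2.
  rewrite expr2 ler_peMl ?(ltW K1)// -expR0 ler_expR mulr_ge0 ?sqr_ge0// addr_ge0// invr_ge0 sqr_ge0//.
rewrite -(@ler_pXn2r _ 2) ?nnegrE ?normc_ge0 ?mulr_ge0 ?(ltW K1)//; last exact: normc_ge0.
rewrite /scaled_ratio !normcM !exprMn !normc_cpow !Re_add !Re_opp /= -/a mulrAC ler_wpM2r ?sqr_ge0//.
apply: le_trans (normc_rising_ratio_le n.+1 w0) _; rewrite ler_wpM2l ?sqr_ge0//; apply: le_trans Ksq.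
rewrite ler_expR.
under eq_bigr do rewrite -/b -/a.
by rewrite -mulr_sumr ler_wpM2l ?sqr_ge0//; exact: sum_inv_sqr.
Qed.

(** A vanishing integral would make [scaled_ratio n w] unbounded. *)
Lemma Euler_integral_neq0 (w : R[i]) : 0 < complex.Re w -> Euler_integral w != 0.
Proof.
move=> w0; apply/eqP => E0; have nz := Re_gt0_neq0 w0.
have [B B0 hB] := scaled_ratio_bounded w0.
have := ccvg_normc (Euler_limit w0); rewrite E0 ComplexField.Normc.normc0 => c.
have r1 := ccvg_normc (ratio_cvg w); rewrite ComplexField.Normc.normc1 in r1.
have c2 := cvgM c r1; rewrite mul0r in c2.
have : (B^-1 <= 0 :> R).
  apply: (cvgr_to_ge (c2 _)); near=> n => /=.
  rewrite Euler_scaled_ratio// ComplexField.Normc.normcV normcM.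
  have rn : normc ((w + n.+1%:R) / n.+1%:R) != 0.
    by rewrite gt_eqF// normc_gt0// mulf_neq0 ?invr_eq0 ?pnatr_eq0.
  rewrite invfM mulfVK// lef_pV2 ?posrE// normc_gt0// mulf_neq0 ?cpow_neq0//.
  exact: rising_ratio_neq0.
by rewrite invr_le0 leNgt B0.
Unshelve. all: by end_near. Qed.

Lemma scaled_ratio_cvg_Re_gt0 (w : R[i]) : 0 < complex.Re w ->
  (fun n => scaled_ratio n w) @ \oo --> ((Euler_integral w)^-1 : R[i]^o).
Proof.
move=> w0; have nz := Re_gt0_neq0 w0.
have c2 := ccvgV (Euler_integral_neq0 w0) (Euler_limit w0).
have := ccvgM c2 (ccvgV (oner_neq0 _) (ratio_cvg w)); rewrite invr1 mulr1.
apply: cvg_trans; apply: near_eq_cvg; near=> n.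
by rewrite Euler_scaled_ratio// invrK mulfK// mulf_neq0 ?invr_eq0 ?pnatr_eq0.
Unshelve. all: by end_near. Qed.

(** Same functional equation as that of 1 / Gamma, up to a factor that tends
to 1; it carries the limit to the left half-plane. *)
Lemma scaled_ratio_shift n (w : R[i]) : (forall k : nat, w + k%:R != 0) ->
  scaled_ratio n w = w * scaled_ratio n (w + 1) * ((w + n.+1%:R) / n.+1%:R)^-1.
Proof.
move=> h; rewrite /scaled_ratio !rising_ratioE.
have -> : 1 - (w + 1) = (1 - w) - 1 by ring.
rewrite (cpowD _ (1 - w)).
have e : cpow (n.+1%:R : R) (-1) = (n.+1%:R)^-1 :> R[i].
  have n1 : n.+1%:R != 0 :> R[i] by rewrite pnatr_eq0.
  apply/eqP; rewrite -(inj_eq (mulfI n1)) mulfV// {1}complex_nat -cpow1// -cpowD subrr.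
  by rewrite /cpow mul0r cexp0.
rewrite e.
have w0 : w != 0 by have := h 0%N; rewrite addr0.
have p1 : \prod_(k < n.+2) (w + k%:R) = w * \prod_(k < n.+1) (w + 1 + k%:R).
  rewrite big_ord_recl /= addr0; congr (_ * _); apply: eq_bigr => k _.
  by rewrite /bump /= natrD addrA.
have p2 : \prod_(k < n.+2) (w + k%:R) = \prod_(k < n.+1) (w + k%:R) * (w + n.+1%:R).
  by rewrite big_ord_recr.
have e2 : \prod_(k < n.+1) (w + 1 + k%:R) = \prod_(k < n.+1) (w + k%:R) * (w + n.+1%:R) / w.
  by apply/eqP; rewrite eq_sym -(mulrC w^-1) -p2 p1 mulKf.
have n0 : (n.+1)%:R != 0 :> R[i] by rewrite pnatr_eq0.
have f0 : (n.+1)`!%:R != 0 :> R[i] by rewrite pnatr_eq0 -lt0n fact_gt0.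
have wn := h n.+1.
rewrite e2; move: n0 wn; set N := n.+1%:R; move=> n0 wn; field.
by rewrite !nat1r -/N wn f0 n0 w0.
Qed.

Lemma scaled_ratio_cvg_shift m (w : R[i]) : (forall k : nat, w + k%:R != 0) -> 0 < complex.Re (w + m%:R) ->
  (fun n => scaled_ratio n w) @ \oo -->
  ((Euler_integral (w + m%:R) / \prod_(k < m) (w + k%:R))^-1 : R[i]^o).
Proof.
elim: m w => [|m IH] w h.
  by rewrite addr0 big_ord0 divr1; exact: scaled_ratio_cvg_Re_gt0.
move=> wm; have h1 k : w + 1 + k%:R != 0 by rewrite -addrA nat1r; exact: h.
have := IH (w + 1) h1; rewrite -addrA nat1r => /(_ wm) c.
have w0 : w != 0 by have := h 0%N; rewrite addr0.
have := ccvgM (ccvgM (@ccvg_cst R w) c) (ccvgV (oner_neq0 _) (ratio_cvg w)).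
rewrite invr1 mulr1 big_ord_recl /= addr0.
have -> : (Euler_integral (w + m.+1%:R) / (w * \prod_(i < m) (w + (bump 0 i)%:R)))^-1 =
   w * (Euler_integral (w + m.+1%:R) / \prod_(k < m) (w + 1 + k%:R))^-1.
  rewrite !invfM !invrK mulrCA; congr (_ * (_ * _)); apply: eq_bigr => k _.
  by rewrite /bump /= natrD addrA.
apply: cvg_trans; apply: near_eq_cvg; near=> n.
by rewrite [RHS]scaled_ratio_shift.
Unshelve. all: by end_near. Qed.

Lemma scaled_ratio_cvg (w : R[i]) : (forall k : nat, w + k%:R != 0) ->
  (fun n => scaled_ratio n w) @ \oo --> ((Gamma w)^-1 : R[i]^o).
Proof.
move=> h; rewrite /Gamma; apply: scaled_ratio_cvg_shift => //.
rewrite Re_add Re_nat /Gamma_shift; case: ifP => [w0|_]; first by rewrite addr0.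
by have := truncnS_gt (- complex.Re w); lra.
Qed.

End gamma.

(** * Expectation of a product of independent variables *)

Section expectation_product.
Context d (Omega : measurableType d) (R : realType) (P : probability Omega R).
Variables F G G' : {mfun Omega >-> R}.
Hypothesis FG : forall B1 B2 : set R, measurable B1 -> measurable B2 ->
  P (F @^-1` B1 `&` G @^-1` B2) = (P (F @^-1` B1) * P (G' @^-1` B2))%E.

Lemma measurable_FG : measurable_fun setT (fun w => (F w, G w)).
Proof. exact: measurable_fun_pair. Qed.

(** A measure on the plane is determined by its values on rectangles. *)
Lemma joint_law (f : R * R -> \bar R) :
  (\int[distribution P F \x distribution P G']_p f p =
   \int[pushforward P (fun w => (F w, G w))]_p f p)%E.
Proof.
pose m1f : {measure set (R * R) -> \bar R} := pushforward P (fun w => (F w, G w)).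
pose m1 := m1f measurable_FG.
apply: (@eq_measure_integral _ _ _ _ m1) => X mX _.
apply: (@product_measure_unique _ _ _ _ _ (distribution P F) (distribution P G') m1) => //.
Qed.

(** The truncations at 0 provide an integrand that is nonnegative on the whole
plane, as Tonelli's theorem requires. *)
Lemma ge0_integral_prod : (forall w, 0 <= F w) -> (forall w, 0 <= G w) -> (forall w, 0 <= G' w) ->
  (\int[P]_w (F w * G w)%:E = (\int[P]_w (F w)%:E) * (\int[P]_w (G' w)%:E))%E.
Proof.
move=> F0 G0 G'0.
pose h (p : R * R) : \bar R := (Num.max 0 p.1 * Num.max 0 p.2)%:E.
have h0 p : (0 <= h p)%E by rewrite lee_fin mulr_ge0// le_max lexx.
have mmax : measurable_fun setT (fun x : R => Num.max 0 x) by exact: measurable_maxr.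
have mh : measurable_fun setT h.
  by apply/measurable_EFinP; apply: measurable_funM; apply: measurableT_comp.
have := joint_law h.
rewrite fubini_tonelli1// (ge0_integral_pushforward measurable_FG)//.
have -> : (\int[P]_(w in (fun w => (F w, G w)) @^-1` setT) (h \o (fun w => (F w, G w))) w = \int[P]_w (F w * G w)%:E)%E.
  by rewrite preimage_setT; apply: eq_integral => w _; rewrite /h /= !max_r.
move=> <-.
rewrite /fubini_F /h /=.
under eq_integral => x _.
  under eq_integral => y _ do rewrite EFinM.
  rewrite ge0_integralZl//=; last first.
  + by rewrite lee_fin le_max lexx.
  + by move=> y _; rewrite lee_fin le_max lexx.
  + by apply/measurable_EFinP.
  rewrite (ge0_integral_pushforward (measurable_funPT G'))//=; last first.
    by move=> y _; rewrite lee_fin le_max lexx.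
    by apply/measurable_EFinP.
  rewrite preimage_setT.
  under eq_integral do rewrite /= max_r//.
  over.
rewrite ge0_integralZr//=; last first.
- by apply: integral_ge0 => w _; rewrite lee_fin.
- by move=> x _; rewrite lee_fin le_max lexx.
- by apply/measurable_EFinP.
congr (_ * _)%E.
rewrite (ge0_integral_pushforward (measurable_funPT F))//=.
- by rewrite preimage_setT; apply: eq_integral => w _ /=; rewrite max_r.
- by apply/measurable_EFinP.
- by move=> y _; rewrite lee_fin le_max lexx.
Qed.

End expectation_product.

Section expectation_product_integrable.
Context d (Omega : measurableType d) (R : realType) (P : probability Omega R).
Variables F G G' : {mfun Omega >-> R}.
Hypothesis FG : forall B1 B2 : set R, measurable B1 -> measurable B2 ->
  P (F @^-1` B1 `&` G @^-1` B2) = (P (F @^-1` B1) * P (G' @^-1` B2))%E.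
Hypothesis iF : P.-integrable setT (EFin \o F).
Hypothesis iG : P.-integrable setT (EFin \o G').

Let absm (H : {mfun Omega >-> R}) : measurable_fun setT (fun w => `|H w|).
Proof. by apply: measurableT_comp. Qed.

Let absf (H : {mfun Omega >-> R}) : {mfun Omega >-> R} :=
  HB.pack (fun w => `|H w|) (isMeasurableFun.Build _ _ _ _ _ (absm H)).

(** The previous identity for the absolute values. *)
Lemma integrable_prod : P.-integrable setT (fun w => (F w * G w)%:E).
Proof.
apply/integrableP; split.
  by apply/measurable_EFinP; apply: measurable_funM.
have := @ge0_integral_prod _ _ _ P (absf F) (absf G) (absf G').
move=> /(_ _ (fun=> normr_ge0 _) (fun=> normr_ge0 _) (fun=> normr_ge0 _)) H.
under eq_integral do rewrite abse_EFin normrM.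
rewrite H.
  have /integrableP[_ f1] := iF; have /integrableP[_ f2] := iG.
  apply: lte_mul_pinfty => //.
    by apply: integral_ge0 => w _; rewrite lee_fin; exact: normr_ge0.
  by rewrite ge0_fin_numE//; apply: integral_ge0 => w _; rewrite lee_fin; exact: normr_ge0.
move=> B1 B2 mB1 mB2.
have m (B : set R) : measurable B -> measurable ((fun x : R => `|x|) @^-1` B).
  by move=> mB; rewrite -[X in measurable X]setTI; exact: (measurableT_comp (@normr_measurable R setT) (@measurable_id _ R setT)).
exact: (FG (m _ mB1) (m _ mB2)).
Qed.

Lemma Rintegral_prod :
  (\int[P]_w (F w * G w) = (\int[P]_w F w) * (\int[P]_w G' w))%R.
Proof.
pose h (p : R * R) : \bar R := (p.1 * p.2)%:E.
have mh : measurable_fun setT h.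
  by apply/measurable_EFinP; apply: measurable_funM.
pose mFG := measurable_FG F G.
have hE : (h \o (fun w => (F w, G w))) = (fun w => (F w * G w)%:E) by [].
have ih : (distribution P F \x distribution P G')%E.-integrable setT h.
  apply/integrableP; split => //.
  rewrite (joint_law FG) (ge0_integral_pushforward mFG)//; last exact: measurableT_comp.
  rewrite preimage_setT; by have /integrableP[_] := integrable_prod.
have := integral12_prod_meas1 ih.
rewrite (joint_law FG) (integral_pushforward mFG)//; last by rewrite preimage_setT; exact: integrable_prod.
rewrite preimage_setT hE => e.
rewrite /Rintegral -e /fubini_F /h /=.
have iG' : (distribution P G').-integrable setT EFin.
  by apply: (integrable_pushforward (measurable_funPT G')) => //; rewrite preimage_setT.
have iF' : (distribution P F).-integrable setT EFin.
  by apply: (integrable_pushforward (measurable_funPT F)) => //; rewrite preimage_setT.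
have eG : (\int[distribution P G']_y y%:E = (\int[P]_w G' w)%:E)%E.
  rewrite (@integral_pushforward _ _ _ _ _ _ (measurable_funPT G') P setT EFin)//.
  by rewrite preimage_setT /Rintegral fineK//; exact: integrable_fin_num.
have eF : (\int[distribution P F]_y y%:E = (\int[P]_w F w)%:E)%E.
  rewrite (@integral_pushforward _ _ _ _ _ _ (measurable_funPT F) P setT EFin)//.
  by rewrite preimage_setT /Rintegral fineK//; exact: integrable_fin_num.
rewrite (eq_integral (fun x => (\int[P]_w G' w)%:E * x%:E)%E); last first.
  by move=> x _; rewrite -eG muleC -(integralZl _ iG').
by rewrite (integralZl _ iF')// eF /= mulrC.
Qed.
End expectation_product_integrable.

(** * Moments of the waiting times *)

Section expectation_exponential.
Context d (Omega : measurableType d) (R : realType) (P : probability Omega R).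
Variable E : seq bool -> {RV P >-> R}.
Hypothesis hE : yule_clocks E.
Notation leb := (@lebesgue_measure R).
Notation I01 := (`]0, 1[%classic : set (measurableTypeR R)).

(** The exponential of minus an exponential variable is uniform on ]0, 1[. *)
Definition unif (w : Omega) : R := expR (- E [::] w).

Lemma measurable_unif : measurable_fun setT unif.
Proof.
apply: measurableT_comp; first exact: measurable_expR.
by apply: measurableT_comp => //; exact: measurable_funPT.
Qed.

(** Compared on half-lines, after a change of sign that turns the known tails of
the clock into those of the variable. *)
Lemma unif_law B : measurable B -> P (unif @^-1` B) = leb (B `&` I01).
Proof.
move=> mB.
have mI : measurable I01 by exact: measurable_itv.
pose m1f : {measure set R -> \bar R} := pushforward P (fun w => - unif w).
have mN : measurable_fun setT (fun w => - unif w).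
  by apply: measurableT_comp => //; exact: measurable_unif.
pose m1 := m1f mN.
have mo : measurable_fun (setT : set (measurableTypeR R)) (fun x : measurableTypeR R => - x : R) by exact: measurableT_comp.
pose m2f : {measure set R -> \bar R} := pushforward (mrestr leb mI) (fun x : measurableTypeR R => - x : R).
pose m2 := m2f mo.
have mB' : measurable ((fun x : R => - x) @^-1` B).
  by rewrite -[X in measurable X]setTI; exact: (mo measurableT B mB).
have := @measure_tail_unique R m1 m2 _ _ _ mB'.
rewrite /m1 /m2 /m1f /m2f /= /pushforward /mrestr.
have -> : (fun w => - unif w) @^-1` ((fun x : R => - x) @^-1` B) = unif @^-1` B.
  by apply/seteqP; split => w /=; rewrite opprK.
have -> : (fun x : R => - x) @^-1` ((fun x : R => - x) @^-1` B) = B.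
  by apply/seteqP; split => w /=; rewrite opprK.
apply; last first.
  move=> x; apply: le_lt_trans (_ : 1 < _)%E; last exact: ltry.
  by apply: probability_le1; rewrite -[X in measurable X]setTI; exact: (mN measurableT _ (measurable_itv _)).
move=> x.
have [x0|x0] := leP 0 x.
  rewrite (_ : _ @^-1` _ = set0); last first.
    apply/seteqP; split => // w /=; rewrite in_itv/= andbT => h.
    by have := expR_gt0 (- E [::] w); rewrite -/(unif w); have := le_lt_trans x0 h; lra.
  rewrite (_ : _ `&` _ = set0) ?measure0//.
  apply/seteqP; split => // t /= []; rewrite !in_itv/= andbT => h /andP[t0 _].
  by lra.
(* the measure of ]0, - x[ in ]0, 1[ *)
pose y := Num.min 1 (- x).
have y0 : 0 < y by rewrite lt_min ltr01/= oppr_gt0.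
have y1 : y <= 1 by rewrite ge_min lexx.
have -> : ((fun x0 : R => - x0) @^-1` `]x, +oo[ `&` I01 : set R) = `]0, y[%classic.
  apply/seteqP; split => t /=; rewrite !in_itv/= andbT /y lt_min ltrNr.
    by move=> [-> /andP[-> ->]].
  by move=> /and3P[-> -> ->].
rewrite lebesgue_measure_itv/= lte_fin y0 oppr0 adde0.
have yE : y%:E = P [set w | - ln y < E [::] w].
  by rewrite clock_tail// ?opprK ?lnK ?posrE// oppr_ge0 ln_le0.
have [xN|xN] := leP (- x) 1.
  rewrite yE /y min_r//; congr (P _); apply/seteqP; split => w /=; rewrite in_itv/= andbT ltrNr /unif.
    by rewrite -[in X in _ < X -> _](@lnK _ (- x)) ?posrE ?oppr_gt0// ltr_expR ltrNl.
  by rewrite -[in X in _ -> _ < X](@lnK _ (- x)) ?posrE ?oppr_gt0// ltr_expR ltrNl.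
rewrite /y min_l ?ltW//; apply/eqP; rewrite eq_le; apply/andP; split.
  by apply: probability_le1; rewrite -[X in measurable X]setTI; exact: (mN measurableT _ (measurable_itv _)).
rewrite (_ : 1%:E = y%:E); last by rewrite /y min_l ?ltW.
rewrite yE (_ : y = 1) ?ln1 ?oppr0; last by rewrite /y min_l ?ltW.
apply: le_measure; rewrite ?inE.
- exact: measurable_gtE.
- by rewrite -[X in measurable X]setTI; exact: (mN measurableT _ (measurable_itv _)).
move=> w /= w0; rewrite in_itv/= andbT ltrNr; apply: le_lt_trans xN.
by rewrite /unif -expR0 ler_expR oppr_le0 ltW.
Qed.

Lemma ge0_integral_unif (f : R -> R) : measurable_fun setT f -> (forall x, 0 <= f x) ->
  (\int[P]_w (f (unif w))%:E = \int[leb]_(t in I01) (f t)%:E)%E.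
Proof.
move=> mf f0.
have mI : measurable I01 by exact: measurable_itv.
have mfE : measurable_fun setT (EFin \o f) by exact/measurable_EFinP.
have mU : measurable (unif @^-1` I01).
  by rewrite -[X in measurable X]setTI; exact: measurable_unif.
rewrite (@ge0_negligible_integral _ _ _ P setT (unif @^-1` (~` I01)))//.
- rewrite setDE setTI -preimage_setC setCK.
  have mu : measurable_fun setT (unif : Omega -> measurableTypeR R) := measurable_unif.
  rewrite -(@ge0_integral_pushforward _ _ _ (measurableTypeR R) _ _ mu P I01 (EFin \o f))//.
  + pose m1f : {measure set (measurableTypeR R) -> \bar R} := pushforward P (unif : Omega -> measurableTypeR R).
    pose m1 := m1f mu.
    apply: (@eq_measure_integral _ (measurableTypeR R) R I01 leb m1 (EFin \o f)) => A mA AI.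
    by rewrite /m1 /m1f /= /pushforward unif_law// setIidl.
  + exact: measurable_funTS.
  + by move=> y _; rewrite lee_fin.
- by rewrite preimage_setC; exact: measurableC.
- exact: (measurableT_comp mfE measurable_unif).
- by move=> w _; rewrite lee_fin.
have := unif_law (measurableC mI); rewrite setICl measure0; exact.
Qed.

Lemma integrable_unif (f : R -> R) : measurable_fun setT f ->
  leb.-integrable I01 (EFin \o f) -> P.-integrable setT (fun w => (f (unif w))%:E).
Proof.
move=> mf /integrableP[_ fi]; apply/integrableP; split.
  by apply/measurable_EFinP; apply: measurableT_comp => //; exact: measurable_unif.
under eq_integral do rewrite abse_EFin.
rewrite (@ge0_integral_unif (fun x => `|f x|))//; exact: measurableT_comp.
Qed.

Lemma Rintegral_unif (f : R -> R) : measurable_fun setT f ->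
  leb.-integrable I01 (EFin \o f) -> (\int[P]_w f (unif w) = \int[leb]_(t in I01) f t)%R.
Proof.
move=> mf fi; congr fine.
have mI : measurable I01 by exact: measurable_itv.
rewrite integralE [RHS]integralE; congr (_ - _)%E.
  have m1 : measurable_fun setT (fun x => Num.max (f x) 0) by exact: measurable_maxr.
  have p1 x : 0 <= Num.max (f x) 0 by rewrite le_max lexx orbT.
  have := ge0_integral_unif m1 p1;
  by move=> h; apply: etrans (etrans h _); apply: eq_integral => t _; rewrite funeposE EFin_max.
have m1 : measurable_fun setT (fun x => Num.max (- f x) 0).
  by apply: measurable_maxr => //; exact: measurableT_comp.
have p1 x : 0 <= Num.max (- f x) 0 by rewrite le_max lexx orbT.
have := ge0_integral_unif m1 p1;
by move=> h; apply: etrans (etrans h _); apply: eq_integral => t _; rewrite funenegE EFin_max EFinN.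
Qed.
(** Exponential moments of the waiting time are integrals of powers on ]0, 1[. *)
Lemma exp_gap_unif (x : R) n w : x * exp_gap E n w = (- (x / n.+1%:R)) * ln (unif w).
Proof. by rewrite /unif expRK /exp_gap; field; rewrite nat1r pnatr_eq0. Qed.

Lemma exp_gap_moment (s : R) n : s < n.+1%:R ->
  (\int[P]_w (expR (s * exp_gap E n w))%:E = (n.+1%:R / (n.+1%:R - s))%:E)%E.
Proof.
move=> sn; pose a := 1 - s / n.+1%:R.
have a0 : 0 < a by rewrite subr_gt0 ltr_pdivrMr// mul1r.
have e w : expR (s * exp_gap E n w) = expR ((a - 1) * ln (unif w)).
  by rewrite exp_gap_unif; congr expR; rewrite /a; ring.
under eq_integral do rewrite e.
rewrite (ge0_integral_unif (f := fun t => expR ((a - 1) * ln t)))//; last exact: measurable_expR_ln.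
rewrite exp_int// ln1 mulr0 expR0; congr EFin; rewrite /a; field.
by rewrite nat1r pnatr_eq0/= subr_eq0 gt_eqF.
Qed.

Lemma exp_gap_cexp_re (al : R[i]) n w :
  cexp ((exp_gap E n w)%:C * al) = cpow (unif w) ((1 - al / n.+1%:R) - 1).
Proof.
rewrite /cpow /unif expRK; congr cexp; rewrite /exp_gap complex_nat.
have -> : (E [::] w / n.+1%:R)%:C = (E [::] w)%:C / (n.+1%:R)%:C :> R[i].
  by rewrite rmorphM/= fmorphV.
rewrite rmorphN /=; field.
by rewrite nat1r pnatr_eq0.
Qed.

Lemma exp_gap_cexp (al : R[i]) n : complex.Re al < n.+1%:R ->
  cintegrable P setT (fun w => cexp ((exp_gap E n w)%:C * al)) /\
  cintegral P setT (fun w => cexp ((exp_gap E n w)%:C * al)) = n.+1%:R / (n.+1%:R - al).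
Proof.
move=> sn; pose b : R[i] := 1 - al / n.+1%:R.
have n0 : n.+1%:R != 0 :> R[i] by rewrite pnatr_eq0.
have Rb : complex.Re b = 1 - complex.Re al / n.+1%:R.
  rewrite /b Re_add Re_opp Re_mul complex_nat -fmorphV/=; by rewrite mulr0 subr0.
have b0 : 0 < complex.Re b.
  by rewrite Rb subr_gt0 ltr_pdivrMr// mul1r.
have e : (fun w => cexp ((exp_gap E n w)%:C * al)) = (fun w => cpow (unif w) (b - 1)).
  by apply/funext => w; rewrite exp_gap_cexp_re.
have mRe : measurable_fun setT (fun t : R => complex.Re (cpow t (b - 1))).
  under eq_fun do rewrite Re_cpow; apply: measurable_funM; first exact: measurable_expR_ln.
  apply: (measurableT_comp (@measurable_cos R)); apply: measurable_funM => //; exact: measurable_ln.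
have mIm : measurable_fun setT (fun t : R => complex.Im (cpow t (b - 1))).
  under eq_fun do rewrite Im_cpow; apply: measurable_funM; first exact: measurable_expR_ln.
  apply: (measurableT_comp (@measurable_sin R)); apply: measurable_funM => //; exact: measurable_ln.
have [i1 i2] := cpow_integrable (@ltr01 R) b0.
rewrite e; split.
  by split; [exact: (integrable_unif mRe i1)|exact: (integrable_unif mIm i2)].
have <- : cpow 1 b / b = n.+1%:R / (n.+1%:R - al).
  have -> : cpow 1 b = 1 by rewrite /cpow ln1 mulr0 cexp0.
  have b1 : b != 0 by apply: contraTneq b0 => ->; rewrite ltxx.
  have -> : n.+1%:R - al = n.+1%:R * b by rewrite /b mulrBr mulr1 mulrCA mulfV// mulr1.
  by rewrite invfM mulrA mulfV// mul1r.
rewrite -(cpow_int (@ltr01 R) b0) /cintegral; congr (_ +i* _).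
  exact: (Rintegral_unif mRe i1).
exact: (Rintegral_unif mIm i2).
Qed.
End expectation_exponential.

(** * The martingale property *)

Section martingale.
Context d (Omega : measurableType d) (R : realType) (P : probability Omega R).
Variable E : seq bool -> {RV P >-> R}.
Hypothesis hE : yule_clocks E.
Notation past := (past E).
Notation tau := (tau E).
Notation gap := (gap E).
Notation exp_gap := (exp_gap E).
Notation normc := ComplexField.Normc.normc.

Lemma pastC n A : past n A -> past n (~` A).
Proof.
move=> [mA hA]; split; first exact: measurableC.
move=> h hh sh; have [D sD e] := hA h hh sh; exists (~` D).
  exact: gen_setC.
apply/seteqP; split => w [nA hw]; split => // aw; apply: nA.
  by have : (D `&` hevent E h) w by []; rewrite -e => -[].
by have : (A `&` hevent E h) w by []; rewrite e => -[].
Qed.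

Lemma pastU n A B : past n A -> past n B -> past n (A `|` B).
Proof.
by move=> hA hB; rewrite -[A `|` B]setCK setCU; apply/pastC/pastI; exact: pastC.
Qed.

Lemma past_le m n A : (m <= n)%N -> past m A -> past n A.
Proof.
move=> /subnK <-; elim: (n - m)%N => // k IH hA; rewrite addSn; exact/pastS/IH.
Qed.

Definition past_fun n (F : Omega -> R) := forall B : set R, measurable B -> past n (F @^-1` B).

Lemma past_fun_measurable n F : past_fun n F -> measurable_fun setT F.
Proof. by move=> hF _ B mB; rewrite setTI; case: (hF B mB). Qed.

Lemma past_fun_tau n A (f : R -> R) : past n A -> measurable_fun setT f ->
  past_fun n (fun w => \1_A w * f (tau n w)).
Proof.
move=> hA mf B mB.
have hf : past n (tau n @^-1` (f @^-1` B)).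
  by apply: past_tau; rewrite -[X in measurable X]setTI; exact: mf.
have -> : (fun w => \1_A w * f (tau n w)) @^-1` B =
    (A `&` tau n @^-1` (f @^-1` B)) `|` (~` A `&` [set _ | B 0]).
  apply/seteqP; split => w /=; rewrite indicE.
    case: (boolP (w \in A)) => [/set_mem|/negP] aw; rewrite ?(mul1r, mul0r) => fw; [by left|right].
    by split => // /mem_set.
  case=> [[aw fw]|[aw fw]]; first by rewrite mem_set// mul1r.
  by rewrite memNset// mul0r.
apply: pastU; first exact: pastI.
apply: pastI; first exact: pastC.
have [B0|B0] := pselect (B 0).
  by rewrite (_ : mkset _ = setT); [exact: pastT|apply/seteqP; split].
rewrite (_ : mkset _ = ~` setT); [exact/pastC/pastT|].
by apply/seteqP; split => // w []; exact.
Qed.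

Definition mfun_of (f : Omega -> R) (mf : measurable_fun setT f) : {mfun Omega >-> R} :=
  HB.pack f (isMeasurableFun.Build _ _ _ _ _ mf).

(** [gap_indep] for functions; the waiting time and [exp_gap n] have the same
law. *)
Lemma gap_law n F (g : R -> R) : past_fun n F -> measurable_fun setT g ->
  forall B1 B2 : set R, measurable B1 -> measurable B2 ->
  P (F @^-1` B1 `&` (fun w => g (gap n w)) @^-1` B2) =
  (P (F @^-1` B1) * P ((fun w => g (exp_gap n w)) @^-1` B2))%E.
Proof.
move=> hF mg B1 B2 mB1 mB2.
have mgB : measurable (g @^-1` B2) by rewrite -[X in measurable X]setTI; exact: mg.
exact: (gap_indep hE (hF _ mB1) mgB).
Qed.

Lemma gap_prod n F (g : R -> R) : past_fun n F -> measurable_fun setT g ->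
  P.-integrable setT (fun w => (F w)%:E) -> P.-integrable setT (fun w => (g (exp_gap n w))%:E) ->
  P.-integrable setT (fun w => (F w * g (gap n w))%:E) /\
  (\int[P]_w (F w * g (gap n w)) = (\int[P]_w F w) * (\int[P]_w g (exp_gap n w)))%R.
Proof.
move=> hF mg iF ig.
have mF := past_fun_measurable hF.
have m1 : measurable_fun setT (fun w => g (gap n w)) by apply: measurableT_comp => //; exact: measurable_gap.
have m2 : measurable_fun setT (fun w => g (exp_gap n w)) by apply: measurableT_comp => //; exact: measurable_exp_gap.
have H := gap_law hF mg.
split.
  exact: (@integrable_prod _ _ _ P (mfun_of mF) (mfun_of m1) (mfun_of m2) H iF ig).
exact: (@Rintegral_prod _ _ _ P (mfun_of mF) (mfun_of m1) (mfun_of m2) H iF ig).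
Qed.

Lemma ge0_gap_prod n F (g : R -> R) : past_fun n F -> measurable_fun setT g ->
  (forall w, 0 <= F w) -> (forall x, 0 <= g x) ->
  (\int[P]_w (F w * g (gap n w))%:E = (\int[P]_w (F w)%:E) * (\int[P]_w (g (exp_gap n w))%:E))%E.
Proof.
move=> hF mg F0 g0.
have mF := past_fun_measurable hF.
have m1 : measurable_fun setT (fun w => g (gap n w)) by apply: measurableT_comp => //; exact: measurable_gap.
have m2 : measurable_fun setT (fun w => g (exp_gap n w)) by apply: measurableT_comp => //; exact: measurable_exp_gap.
exact: (@ge0_integral_prod _ _ _ P (mfun_of mF) (mfun_of m1) (mfun_of m2) (gap_law hF mg) F0 (fun=> g0 _) (fun=> g0 _)).
Qed.

Lemma tauS n w : tau n.+1 w = tau n w + gap n w.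
Proof. by rewrite /gap addrCA subrr addr0. Qed.

Lemma tau0 w : good E w -> tau 0 w = 0.
Proof.
by move=> /(_ 0%N)[h [hh /size0nil h0 hw]]; rewrite h0 in hh hw; rewrite -[0%N]/(size (Nil (seq bool))) tau_hist.
Qed.

Lemma measurable_expM (s : R) : measurable_fun setT (fun x : R => expR (s * x)).
Proof. by apply: measurableT_comp => //; exact: measurable_funM. Qed.

Lemma integral_good (f g : Omega -> \bar R) : measurable_fun setT f -> measurable_fun setT g ->
  (forall w, good E w -> f w = g w) -> (\int[P]_w f w = \int[P]_w g w)%E.
Proof.
move=> mf mg fg; apply: ae_eq_integral => //.
exists (~` good E); split; [exact/measurableC/good_measurable|exact: good_ae|].
by move=> w /= nfg gw; apply: nfg => _; exact: fg.
Qed.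

Lemma integral1 : (\int[P]_w 1 = 1)%E.
Proof. by rewrite integral_cst// mul1e; exact: probability_setT. Qed.

(** The splitting time is a sum of independent waiting times. *)
Lemma tau_moment (s : R) n : s < 1 ->
  (\int[P]_w (expR (s * tau n w))%:E = (\prod_(k < n) (k.+1%:R / (k.+1%:R - s)))%:E)%E.
Proof.
move=> s1; have mE := measurable_expM s; elim: n => [|n IH].
  rewrite big_ord0 (@integral_good _ (cst 1%E)).
  - exact: integral1.
  - by apply/measurable_EFinP; apply: (measurableT_comp mE); exact: measurable_tauR.
  - by [].
  - by move=> w gw; rewrite tau0// mulr0 expR0.
have sn : s < n.+1%:R by apply: lt_le_trans s1 _; rewrite ler1n.
rewrite big_ord_recr /= EFinM -IH -(exp_gap_moment hE sn).
have := @ge0_gap_prod n (fun w => \1_setT w * expR (s * tau n w)) _ (past_fun_tau (pastT E n) mE) mE.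
move=> H; rewrite (eq_integral (fun w => (\1_setT w * expR (s * tau n w) * expR (s * gap n w))%:E)).
  rewrite H; first last.
  - by move=> x; exact: expR_ge0.
  - by move=> w; rewrite indicT mul1r expR_ge0.
  by congr (_ * _)%E; apply: eq_integral => w _; rewrite indicT mul1r.
by move=> w _; rewrite indicT mul1r tauS mulrDr expRD.
Qed.

Definition cexp_tau (al : R[i]) n w := cexp ((tau n w)%:C * al).

Lemma Re_Cmul (x : R) al : complex.Re (x%:C * al) = complex.Re al * x.
Proof. by rewrite Re_mul /= mul0r subr0 mulrC. Qed.
Lemma Im_Cmul (x : R) al : complex.Im (x%:C * al) = complex.Im al * x.
Proof. by rewrite Im_mul /= mul0r addr0 mulrC. Qed.

Lemma measurable_Re_cexpM (al : R[i]) : measurable_fun setT (fun x : R => complex.Re (cexp (x%:C * al))).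
Proof.
rewrite (_ : (fun x => _) = (fun x : R => expR (complex.Re al * x) * cos (complex.Im al * x))); last first.
  by apply/funext => x; rewrite /cexp Re_Cmul Im_Cmul.
apply: measurable_funM; first exact: measurable_expM.
apply: (measurableT_comp (@measurable_cos R)); exact: measurable_funM.
Qed.
Lemma measurable_Im_cexpM (al : R[i]) : measurable_fun setT (fun x : R => complex.Im (cexp (x%:C * al))).
Proof.
rewrite (_ : (fun x => _) = (fun x : R => expR (complex.Re al * x) * sin (complex.Im al * x))); last first.
  by apply/funext => x; rewrite /cexp Re_Cmul Im_Cmul.
apply: measurable_funM; first exact: measurable_expM.
apply: (measurableT_comp (@measurable_sin R)); exact: measurable_funM.
Qed.

Lemma cexp_tau_cmeasurable al n : cmeasurable setT (cexp_tau al n).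
Proof.
split; first exact: (measurableT_comp (measurable_Re_cexpM al) (measurable_tauR E n)).
exact: (measurableT_comp (measurable_Im_cexpM al) (measurable_tauR E n)).
Qed.

Lemma normc_cexp_tau al n w : normc (cexp_tau al n w) = expR (complex.Re al * tau n w).
Proof. by rewrite normc_cexp Re_Cmul. Qed.

Lemma tau_moment_integrable s n : s < 1 -> P.-integrable setT (fun w => (expR (s * tau n w))%:E).
Proof.
move=> s1; apply/integrableP; split.
  by apply/measurable_EFinP; apply: (measurableT_comp (measurable_expM s)); exact: measurable_tauR.
under eq_integral do rewrite gee0_abs ?lee_fin ?expR_ge0//.
by rewrite tau_moment// ltry.
Qed.

Lemma cexp_tau_integrable al n : complex.Re al < 1 -> cintegrable P setT (cexp_tau al n).
Proof.
move=> al1; apply: (cintegrable_dom _ (cexp_tau_cmeasurable al n) _ (tau_moment_integrable n al1)) => //.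
by move=> w _; rewrite normc_cexp_tau.
Qed.

Lemma cexp_tauS al n w : cexp_tau al n.+1 w = cexp_tau al n w * cexp ((gap n w)%:C * al).
Proof. by rewrite /cexp_tau tauS rmorphD mulrDl cexpD. Qed.

Lemma Rintegral_indic A (f : Omega -> R) : measurable A ->
  (\int[P]_(w in A) f w = \int[P]_w (\1_A w * f w))%R.
Proof.
move=> mA; rewrite Rintegral_mkcond; apply: eq_Rintegral => w _.
by rewrite patchE indicE; case: ifP; rewrite ?mul1r ?mul0r.
Qed.

Lemma integrable_indicM A (f : Omega -> R) : measurable A ->
  P.-integrable setT (EFin \o f) -> P.-integrable setT (fun w => (\1_A w * f w)%:E).
Proof.
move=> mA i; have mf := measurable_int _ i; apply: (le_integrable _ _ _ i) => //.
  apply/measurable_EFinP; apply: measurable_funM => //; exact/measurable_EFinP.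
move=> w _; rewrite lee_fin normrM indicE; case: (_ \in _); rewrite ?normr1 ?mul1r//.
by rewrite normr0 mul0r.
Qed.

(** The real and imaginary parts of the product of the exponentials of
[tau n] and [gap n] are sums of products of independent real variables. *)
Lemma cexp_tau_step al n A : complex.Re al < 1 -> past n A ->
  cintegral P A (cexp_tau al n.+1) = cintegral P A (cexp_tau al n) * (n.+1%:R / (n.+1%:R - al)).
Proof.
move=> al1 hA; have mA : measurable A by case: hA.
have aln : complex.Re al < n.+1%:R by apply: lt_le_trans al1 _; rewrite ler1n.
have [[ier iei] <-] := exp_gap_cexp hE aln.
have [iTr iTi] := cexp_tau_integrable n al1.
pose fr x := complex.Re (cexp (x%:C * al)); pose fi x := complex.Im (cexp (x%:C * al)).
have mr : measurable_fun setT fr := measurable_Re_cexpM al.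
have mi : measurable_fun setT fi := measurable_Im_cexpM al.
have hr := past_fun_tau hA mr; have hi := past_fun_tau hA mi.
have ir : P.-integrable setT (fun w => (\1_A w * fr (tau n w))%:E) := integrable_indicM mA iTr.
have ii : P.-integrable setT (fun w => (\1_A w * fi (tau n w))%:E) := integrable_indicM mA iTi.
have [rr1 rr2] := gap_prod hr mr ir ier.
have [ri1 ri2] := gap_prod hr mi ir iei.
have [ir1 ir2] := gap_prod hi mr ii ier.
have [ii1 ii2] := gap_prod hi mi ii iei.
rewrite /cintegral !(Rintegral_indic _ mA); apply: complex_ext; rewrite ?Re_mul ?Im_mul.
  rewrite -[LHS]/(\int[P]_w (\1_A w * complex.Re (cexp_tau al n.+1 w)))%R.
  rewrite -[X in _ = X * _ - _]/(\int[P]_w (\1_A w * fr (tau n w)))%R.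
  rewrite -[X in _ = _ - X * _]/(\int[P]_w (\1_A w * fi (tau n w)))%R.
  rewrite -rr2 -ii2 -RintegralB//; apply: eq_Rintegral => w _.
  by rewrite cexp_tauS Re_mul mulrBr !mulrA.
rewrite -[LHS]/(\int[P]_w (\1_A w * complex.Im (cexp_tau al n.+1 w)))%R.
rewrite -[X in _ = X * _ + _]/(\int[P]_w (\1_A w * fr (tau n w)))%R.
rewrite -[X in _ = _ + X * _]/(\int[P]_w (\1_A w * fi (tau n w)))%R.
rewrite -ri2 -ir2 -RintegralD//; apply: eq_Rintegral => w _.
by rewrite cexp_tauS Im_mul mulrDr !mulrA.
Qed.

Lemma frakCE n z w : frakC E n z w = bst_C n z * cexp_tau (1 - 2 * z) n w.
Proof. by rewrite /frakC mulrC. Qed.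

Lemma bst_CS n (z : R[i]) : bst_C n.+1 z = bst_C n z * ((n%:R + 2 * z) / n.+1%:R).
Proof. by rewrite /bst_C big_ord_recr. Qed.

Lemma Re_al (z : R[i]) : 0 < complex.Re z -> complex.Re (1 - 2 * z) < 1.
Proof.
by move=> z0; rewrite Re_add Re_opp Re_mul Re_nat Im_nat /= mul0r subr0; lra.
Qed.

Lemma cintegrable_frakC n z : 0 < complex.Re z -> cintegrable P setT (frakC E n z).
Proof.
move=> z0; apply: (@eq_cintegrable _ _ _ P setT _ (fun w => bst_C n z * cexp_tau (1 - 2 * z) n w)) => //.
  by move=> w _; rewrite frakCE.
by apply: cintegrableZ => //; apply: cexp_tau_integrable; exact: Re_al.
Qed.

Lemma cintegrableS (A : set Omega) (f : Omega -> R[i]) : measurable A -> cintegrable P setT f -> cintegrable P A f.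
Proof.
by move=> mA [i1 i2]; split; [exact: (integrableS measurableT mA _ i1)|exact: (integrableS measurableT mA _ i2)].
Qed.

(** The mean (n + 1) / (n + w) of the new factor cancels the ratio of the
normalisations. *)
Lemma frakC_step n z A : 0 < complex.Re z -> past n A ->
  cintegral P A (frakC E n.+1 z) = cintegral P A (frakC E n z).
Proof.
move=> z0 hA; have mA : measurable A by case: hA.
have al1 := Re_al z0.
have e m : cintegral P A (frakC E m z) = bst_C m z * cintegral P A (cexp_tau (1 - 2 * z) m).
  rewrite -cintegralZ//; first by apply: eq_cintegral => w _; rewrite frakCE.
  exact/cintegrableS/cexp_tau_integrable.
rewrite !e cexp_tau_step// bst_CS.
have nz : n%:R + 2 * z != 0.
  apply/eqP => /(congr1 (@complex.Re R)); rewrite Re_add Re_nat Re_mul Re_nat Im_nat /= mul0r subr0 => h.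
  by have := ler0n R n; lra.
have -> : n.+1%:R - (1 - 2 * z) = n%:R + 2 * z by rewrite -natr1; ring.
have n0 : n.+1%:R != 0 :> R[i] by rewrite pnatr_eq0.
by rewrite mulrACA (_ : _ / _ * _ = 1) ?mulr1// mulrA mulfVK// mulfV.
Qed.

Lemma frakC_le m n z A : 0 < complex.Re z -> (m <= n)%N -> past m A ->
  cintegral P A (frakC E n z) = cintegral P A (frakC E m z).
Proof.
move=> z0 /subnK <- hA; elim: (n - m)%N => [|k IH]; first by rewrite add0n.
rewrite addSn (frakC_step z0); first exact: IH.
by apply: past_le hA; rewrite leq_addl.
Qed.

Lemma frakC_mean n z : 0 < complex.Re z -> cintegral P setT (frakC E n z) = 1.
Proof.
move=> z0; rewrite (frakC_le z0 (leq0n n) (pastT E 0)).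
have [m1 m2] := cexp_tau_cmeasurable (1 - 2 * z) 0.
rewrite (@eq_cintegral _ _ _ P setT _ (cexp_tau (1 - 2 * z) 0)); last first.
  by move=> w _; rewrite frakCE /bst_C big_ord0 mul1r.
apply: complex_ext.
  rewrite -[LHS]/(\int[P]_w complex.Re (cexp_tau (1 - 2 * z) 0 w))%R.
  have -> : (\int[P]_w complex.Re (cexp_tau (1 - 2 * z) 0 w) = \int[P]_w 1)%R.
    congr fine; apply: integral_good; [exact/measurable_EFinP|by []|].
    by move=> w gw; rewrite /cexp_tau tau0// mul0r cexp0.
  by rewrite /Rintegral integral1.
rewrite -[LHS]/(\int[P]_w complex.Im (cexp_tau (1 - 2 * z) 0 w))%R.
have -> : (\int[P]_w complex.Im (cexp_tau (1 - 2 * z) 0 w) = \int[P]_w 0)%R.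
  congr fine; apply: integral_good; [exact/measurable_EFinP|by []|].
  by move=> w gw; rewrite /cexp_tau tau0// mul0r cexp0.
by rewrite Rintegral_cst// mul0r.
Qed.

Lemma frakC_adapted n z : cmeasurable_wrt (stopped_filtration E n) (frakC E n z).
Proof.
pose f x := cexp (x%:C * (1 - 2 * z)) * bst_C n z.
have mr := measurable_Re_cexpM (1 - 2 * z); have mi := measurable_Im_cexpM (1 - 2 * z).
have key (g : R -> R) (B : set R) : measurable_fun setT g -> measurable B ->
    stopped_filtration E n ((fun w => g (tau n w)) @^-1` B).
  move=> mg mB; rewrite -[_ @^-1` B]/(tau n @^-1` (g @^-1` B)).
  by apply: stopped_tau; rewrite -[X in measurable X]setTI; exact: mg.
move=> _ [B mB [] ->].
- apply: (key (fun x => complex.Re (f x))) => //.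
  rewrite /f; under eq_fun do rewrite Re_mul.
  by apply: measurable_funB; apply: measurable_funM.
- apply: (key (fun x => complex.Im (f x))) => //.
  rewrite /f; under eq_fun do rewrite Im_mul.
  by apply: measurable_funD; apply: measurable_funM.
Qed.

Lemma frakC_martingale z : 0 < complex.Re z ->
  martingale P (stopped_filtration E) (fun n => frakC E n z).
Proof.
move=> z0; split.
- exact: stopped_fmn.
- move=> n; exact: frakC_adapted.
- move=> n; exact: cintegrable_frakC.
move=> m n mn; split; [exact: frakC_adapted|exact: cintegrable_frakC|].
by move=> A /stopped_past hA; rewrite (frakC_le z0 mn hA).
Qed.
End martingale.

(** * Almost sure limit *)

Section limits.
Context d (Omega : measurableType d) (R : realType) (P : probability Omega R).
Variable E : seq bool -> {RV P >-> R}.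
Hypothesis hE : yule_clocks E.
Notation past := (past E).
Notation tau := (tau E).
Notation normc := ComplexField.Normc.normc.

Lemma fatou_bound (Y : nat -> Omega -> R) (B : R) :
  (forall n, measurable_fun setT (Y n)) -> (forall n w, 0 <= Y n w) ->
  (forall n, \int[P]_w (Y n w)%:E <= B%:E)%E ->
  (\int[P]_w limn_einf (fun n => (Y n w)%:E) <= B%:E)%E.
Proof.
move=> mY Y0 hB.
have mYE n : measurable_fun setT (EFin \o Y n) by exact/measurable_EFinP.
have := @fatou _ _ _ P setT measurableT (fun n w => (Y n w)%:E) mYE _.
move=> /(_ (fun n w _ => Y0 n w)) /le_trans; apply.
apply: le_trans (limn_einf_sup _) _; rewrite limn_esup_lim.
apply: lime_le; first exact: is_cvg_esups.
by apply: nearW => n; apply: ge_ereal_sup => _ [k _ <-].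
Qed.

(** By Fatou's lemma the lower limit of a sequence bounded in L1 is integrable,
hence finite almost everywhere. *)
Lemma ae_not_pinfty (Y : nat -> Omega -> R) (B : R) :
  (forall n, measurable_fun setT (Y n)) -> (forall n w, 0 <= Y n w) ->
  (forall n, \int[P]_w (Y n w)%:E <= B%:E)%E ->
  {ae P, forall w, ~ (Y n w @[n --> \oo] --> +oo)}.
Proof.
move=> mY Y0 hB; have h := fatou_bound mY Y0 hB.
pose g w := limn_einf (fun n => (Y n w)%:E).
have g0 w : (0 <= g w)%E.
  rewrite /g limn_einf_lim; apply: lime_ge; first exact: is_cvg_einfs.
  by apply: nearW => n; apply: le_ereal_inf_tmp => _ [k _ <-]; rewrite lee_fin.
have ig : P.-integrable setT g.
  apply/integrableP; split.
    rewrite /g /limn_einf; apply: measurableT_comp => //.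
    by apply: measurable_fun_limn_esup => n; apply: measurableT_comp => //; exact/measurable_EFinP.
  under eq_integral do rewrite gee0_abs//.
  by apply: le_lt_trans h _; exact: ltry.
have := integrable_ae measurableT ig; apply: filterS => w /(_ I) gf c.
have : (fun n => (Y n w)%:E) @ \oo --> +oo%E by exact/cvgeryP.
by move=> /cvg_limn_einf_sup[e _]; rewrite /g e in gf.
Qed.
(** The number of leaves at the split n + 1, minus one, divided by the growth of
the mean population. *)
Definition scaled_size n w : R := n.+1%:R * expR (- tau n.+1 w).

Lemma scaled_size_gt0 n w : 0 < scaled_size n w.
Proof. by rewrite mulr_gt0// expR_gt0. Qed.

Lemma ln_scaled_size n w : ln (scaled_size n w) = ln n.+1%:R - tau n.+1 w.
Proof. by rewrite lnM ?posrE ?expR_gt0// expRK. Qed.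

Lemma measurable_scaled_size n : measurable_fun setT (scaled_size n).
Proof.
apply: measurable_funM => //; apply: measurableT_comp => //.
by apply: measurableT_comp => //; exact: measurable_tauR.
Qed.

Lemma measurable_ln_comp (s : R) (F : Omega -> R) : measurable_fun setT F -> measurable_fun setT (fun w => expR (s * ln (F w))).
Proof. by move=> mF; exact: (measurableT_comp (measurable_expR_ln s) mF). Qed.

(** The product formula of [tau_moment] is the inverse of [scaled_ratio] at
1 - s. *)
Lemma scaled_size_moment_eq (s : R) n : s < 1 ->
  (\int[P]_w (expR (- s * ln (scaled_size n w)))%:E = (normc (scaled_ratio n (1 - s)%:C))^-1%:E)%E.
Proof.
move=> s1; have c0 : 0 < 1 - s by rewrite subr_gt0.
have e w : (expR (- s * ln (scaled_size n w)))%:E = ((expR (- s * ln n.+1%:R))%:E * (expR (s * tau n.+1 w))%:E)%E.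
  by rewrite -EFinM -expRD ln_scaled_size; congr (expR _)%:E; ring.
under eq_integral do rewrite e.
rewrite ge0_integralZl//; last first.
  by apply/measurable_EFinP; apply: (measurableT_comp (measurable_expM s)); exact: measurable_tauR.
rewrite (tau_moment hE _ s1) -EFinM; congr EFin.
rewrite /scaled_ratio normcM normc_cpow (_ : complex.Re (1 - (1 - s)%:C) = s); last first.
  by rewrite Re_add Re_opp /=; ring.
rewrite invfM -expRN -mulNr mulrC; congr (_ * _).
rewrite /rising_ratio.
elim: n.+1 => [|m IH]; first by rewrite !big_ord0 ComplexField.Normc.normc1 invr1.
rewrite !big_ord_recr /= normcM invfM -IH; congr (_ * _).
have -> : (m%:R + (1 - s)%:C) / m.+1%:R = ((m.+1%:R - s) / m.+1%:R)%:C :> R[i].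
  by rewrite [RHS]rmorphM /= fmorphV /= -complex_nat !complex_nat -rmorphD /= -natr1; congr (_%:C / _); ring.
rewrite normc_real ger0_norm; first by rewrite invf_div.
by rewrite divr_ge0// subr_ge0; apply: le_trans (ltW s1) _; rewrite ler1n.
Qed.

Lemma scaled_size_moment (s : R) : s < 1 ->
  exists B : R, forall n, (\int[P]_w (expR (- s * ln (scaled_size n w)))%:E <= B%:E)%E.
Proof.
move=> s1; have c0 : 0 < complex.Re (1 - s)%:C by rewrite /= subr_gt0.
have c := ccvg_normc (ccvgV (invr_neq0 (Euler_integral_neq0 c0)) (scaled_ratio_cvg_Re_gt0 c0)).
have /cvg_seq_bounded[M [_ hM]] : cvgn (fun n => normc (scaled_ratio n (1 - s)%:C)^-1) by apply/cvg_ex; eexists; exact: c.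
exists (M + 1) => n; rewrite scaled_size_moment_eq// lee_fin.
rewrite -ComplexField.Normc.normcV; apply: le_trans (ler_norm _) _; apply: hM => //.
by rewrite ltrDl.
Qed.

(** If the increasing sequence of the splitting times were bounded,
[scaled_size] would tend to infinity, although its mean is bounded. *)
Lemma tau_pinfty : {ae P, forall w, tau n w @[n --> \oo] --> +oo}.
Proof.
have good_ae' : {ae P, forall w, good E w}.
  by exists (~` good E); split; [exact/measurableC/good_measurable|exact: good_ae|].
have [B hB] : exists B : R, forall n, (\int[P]_w (scaled_size n w)%:E <= B%:E)%E.
  have h : -1 < 1 :> R by lra.
  have [B hB] := scaled_size_moment h; exists B => n; apply: le_trans (hB n).
  rewrite le_eqVlt; apply/orP; left; apply/eqP; apply: eq_integral => w _.
  by rewrite opprK mul1r lnK ?posrE ?scaled_size_gt0.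
have := ae_not_pinfty measurable_scaled_size (fun n w => ltW (scaled_size_gt0 n w)) hB.
apply: filterS2 good_ae' => w gw nW.
apply/cvgryPge => A; apply: contrapT => nA; apply: nW.
have tA n : tau n w <= A.
  rewrite leNgt; apply/negP => An; apply: nA; exists n => // m /= nm.
  by apply: le_trans (ltW An) _; exact: tau_mono.
apply/cvgryPge => K; near=> n.
apply: le_trans (_ : n.+1%:R * expR (- A) <= _); last first.
  by rewrite ler_wpM2l// ler_expR lerN2.
rewrite -ler_pdivrMr ?expR_gt0//; near: n.
exists (Num.truncn (K / expR (- A))) => // n /= Kn.
by apply: ltW; apply: lt_le_trans (truncnS_gt _) _; rewrite ler_nat.
Unshelve. all: by end_near. Qed.

Lemma yule_N_tau n w : good E w -> yule_N E (tau n w) w = n.+1.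
Proof.
move=> /(_ n)[h [hh hn hw]]; rewrite -hn tau_hist//.
by case: hw => ho hl; apply: yule_N_hist.
Qed.

Variable xi : {RV P >-> R}.
Hypothesis hxi : {ae P, forall w,
  expR (- t) * (yule_N E t w)%:R @[t --> +oo] --> xi w}.

(** The hypothesis on the number of leaves along the times [tau n]. *)
Lemma scaled_size_cvg : {ae P, forall w, scaled_size n w @[n --> \oo] --> xi w}.
Proof.
have good_ae' : {ae P, forall w, good E w}.
  by exists (~` good E); split; [exact/measurableC/good_measurable|exact: good_ae|].
apply: filterS3 good_ae' tau_pinfty hxi => w gw ct cx.
have c1 : (fun n => expR (- tau n w) * (yule_N E (tau n w) w)%:R) @ \oo --> xi w.
  exact: (cvg_comp _ _ ct cx).
have c2 : (fun n => expR (- tau n.+1 w) * n.+2%:R) @ \oo --> xi w.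
  have := c1; rewrite -(cvg_shiftn 1%N) /=.
  by under eq_fun do rewrite yule_N_tau// addn1.
have c3 : (fun n => expR (- tau n.+1 w)) @ \oo --> (0 : R).
  have := ct; rewrite -(cvg_shiftn 1%N) /=.
  under eq_fun do rewrite addn1.
  by move=> c; exact: (cvg_comp _ _ c (@cvgr_expR R)).
have c4 : (fun n => expR (- tau n.+1 w) * n.+2%:R - expR (- tau n.+1 w)) @ \oo --> xi w.
  by rewrite -[X in _ --> X]subr0; exact: cvgB.
rewrite (_ : (fun n => _) = (fun n => expR (- tau n.+1 w) * n.+2%:R - expR (- tau n.+1 w)))//.
by apply/funext => n; rewrite /scaled_size -(natr1 n.+1); ring.
Qed.

(** If the limit were 0, the power - 1 / 2 of [scaled_size] would tend to
infinity, although its mean is bounded. *)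
Lemma xi_gt0 : {ae P, forall w, 0 < xi w}.
Proof.
have h : 2^-1 < 1 :> R by rewrite invf_lt1// ltr1n.
have [B hB] := scaled_size_moment h.
have mY n : measurable_fun setT (fun w => expR (- 2^-1 * ln (scaled_size n w))) by apply: measurable_ln_comp; exact: measurable_scaled_size.
have := ae_not_pinfty mY (fun n w => expR_ge0 _) hB.
apply: filterS2 scaled_size_cvg => w c nY; rewrite ltNge; apply/negP => x0; apply: nY.
have xe : xi w = 0.
  apply/eqP; rewrite eq_le x0/=; apply: (cvgr_to_ge c); apply: nearW => n; exact/ltW/scaled_size_gt0.
rewrite xe in c.
apply/cvgryPge => K.
have e0 : 0 < expR (- 2 * K) by exact: expR_gt0.
near=> n.
have Wl : scaled_size n w < expR (- 2 * K).
  by near: n; exact: (cvgr_lt _ c).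
have : ln (scaled_size n w) < - 2 * K by rewrite -[ltRHS]expRK ltr_ln ?posrE ?scaled_size_gt0.
have := expR_ge1Dx (- 2^-1 * ln (scaled_size n w)); lra.
Unshelve. all: by end_near. Qed.

Lemma cpow_cvg (u : nat -> R) (l : R) (a : R[i]) : 0 < l -> u @ \oo --> l ->
  (fun n => cpow (u n) a) @ \oo --> (cpow l a : R[i]^o).
Proof.
move=> l0 c; rewrite /cpow; apply: ccvg_cexp; apply: ccvgM; first exact: ccvg_cst.
apply/ccvgP; split => /=; last exact: cvg_cst.
exact: (cvg_comp _ _ c (continuous_ln l0)).
Qed.

Lemma frakC_scaled_size n z w : frakC E n.+1 z w = scaled_ratio n (2 * z) * cpow (scaled_size n w) (2 * z - 1).
Proof.
rewrite /frakC /scaled_ratio cpowM ?expR_gt0//.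
have -> : cpow (expR (- tau n.+1 w)) (2 * z - 1) = cexp ((tau n.+1 w)%:C * (1 - 2 * z)).
  by rewrite /cpow expRK rmorphN; congr cexp; rewrite /=; ring.
have -> : bst_C n.+1 z = rising_ratio n.+1 (2 * z) by [].
have e : cpow n.+1%:R (1 - 2 * z) * cpow (n.+1%:R : R) (2 * z - 1) = 1.
  by rewrite -cpowD addrA subrK subrr /cpow mul0r cexp0.
by rewrite mulrA -(mulrA (rising_ratio _ _)) e mulr1 mulrC.
Qed.

Lemma neq_half (z : R[i]) : (forall k : nat, z != - (k%:R / 2)) -> forall k : nat, 2 * z + k%:R != 0.
Proof.
move=> hz k; apply: contra (hz k); rewrite addr_eq0 => /eqP e; apply/eqP.
by apply: (@mulfI _ 2); rewrite ?pnatr_eq0// e mulrN mulrCA mulfV ?mulr1// pnatr_eq0.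
Qed.

Lemma frakC_cvg z : (forall k : nat, z != - (k%:R / 2)) ->
  {ae P, forall w, frakC E n z w @[n --> \oo] --> (cpow (xi w) (2 * z - 1) / Gamma (2 * z) : R[i]^o)}.
Proof.
move=> hz; apply: filterS2 scaled_size_cvg xi_gt0 => w c x0.
have h : (fun n => frakC E n.+1 z w) @ \oo --> (cpow (xi w) (2 * z - 1) / Gamma (2 * z) : R[i]^o).
  under eq_fun do rewrite frakC_scaled_size.
  by rewrite mulrC; apply: ccvgM; [exact: scaled_ratio_cvg (neq_half hz)|exact: cpow_cvg].
have := @cvg_shiftS (R[i]^o) (fun n => frakC E n z w) (nbhs (cpow (xi w) (2 * z - 1) / Gamma (2 * z) : R[i]^o)).
by rewrite propeqE => -[H _]; exact: H.
Qed.

End limits.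

(** * Convergence in L1 *)

Section uniform_integrability.
Context d (Omega : measurableType d) (R : realType) (P : probability Omega R).
Variables (D q : nat -> Omega -> R) (qoo : Omega -> R) (C B r : R).
Hypotheses (C0 : 0 < C) (r0 : 0 < r).
Hypotheses (mD : forall n, measurable_fun setT (D n)) (mq : forall n, measurable_fun setT (q n)).
Hypothesis mqoo : measurable_fun setT qoo.
Hypothesis D0 : forall n w, 0 <= D n w.
Hypothesis Dq : forall n w, D n w <= C * (expR (q n w) + expR (qoo w)).
Hypothesis Dcvg : {ae P, forall w, D n w @[n --> \oo] --> (0 : R)}.
Hypothesis hB : forall n, (\int[P]_w (expR ((1 + r) * q n w))%:E <= B%:E)%E.
Hypothesis hBoo : (\int[P]_w (expR ((1 + r) * qoo w))%:E <= B%:E)%E.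

(** Above the level 2 C exp j, the maximum m of the exponents exceeds j, so that
exp m is at most exp (- r j) exp ((1 + r) m). *)
Lemma trunc_bound j n w :
  D n w <= Num.min (D n w) (2 * C * expR j) +
    2 * C * expR (- (r * j)) * (expR ((1 + r) * q n w) + expR ((1 + r) * qoo w)).
Proof.
have c0 : 0 <= 2 * C * expR (- (r * j)) by rewrite !mulr_ge0 ?expR_ge0// ltW.
have t0 : 0 <= expR ((1 + r) * q n w) + expR ((1 + r) * qoo w) by rewrite addr_ge0 ?expR_ge0.
have [Dj|jD] := leP (D n w) (2 * C * expR j); first by rewrite lerDl mulr_ge0.
pose m := Num.max (q n w) (qoo w).
have Dm : D n w <= 2 * C * expR m.
  apply: le_trans (Dq n w) _; rewrite (mulrC 2) -mulrA ler_pM2l//.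
  have : expR (q n w) <= expR m by rewrite ler_expR le_max lexx.
  have : expR (qoo w) <= expR m by rewrite ler_expR le_max lexx orbT.
  lra.
have jm : j < m.
  by rewrite -ltr_expR -(ltr_pM2l (_ : 0 < 2 * C)) ?mulr_gt0//; apply: lt_le_trans Dm.
apply: le_trans Dm _; apply: ler_wpDl; first by rewrite !mulr_ge0 ?expR_ge0// ltW.
rewrite -[leRHS]mulrA ler_pM2l ?mulr_gt0//.
apply: le_trans (_ : expR (- (r * j)) * expR ((1 + r) * m) <= _).
  rewrite -expRD ler_expR mulrDl mul1r addrCA lerDl addrC -mulrBr.
  by rewrite mulr_ge0 ?(ltW r0)// subr_ge0 ltW.
rewrite ler_pM2l ?expR_gt0// /m.
by case: (leP (q n w) (qoo w)) => _; [rewrite lerDr|rewrite lerDl]; exact: expR_ge0.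
Qed.

Lemma trunc_cvg j : 0 <= j ->
  (\int[P]_w Num.min (D n w) j)%R @[n --> \oo] --> (0 : R).
Proof.
move=> j0.
pose f_ n w := (Num.min (D n w) j)%:E.
have mf n : measurable_fun setT (f_ n).
  by apply/measurable_EFinP; apply: measurable_minr.
have c : {ae P, forall w, setT w -> f_ ^~ w @ \oo --> 0%E}.
  apply: filterS Dcvg => w c _; apply/cvg_EFin; first by near=> n.
  rewrite (_ : fine \o _ = fun n => Num.min (D n w) j); last by [].
  apply: (squeeze_cvgr _ (cvg_cst (0 : R)) c); apply: nearW => n.
  by rewrite le_min D0 j0 ge_min lexx.
have g : {ae P, forall w n, setT w -> (`|f_ n w| <= (cst j%:E) w)%E}.
  apply: aeW => w n _; rewrite /f_ /= lee_fin ger0_norm ?le_min ?D0//.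
  by rewrite ge_min lexx orbT.
have ig : P.-integrable setT (cst j%:E) by exact: finite_measure_integrable_cst.
have [_ _] := dominated_convergence measurableT mf (measurable_cst 0%E) c ig g.
by rewrite integral0 => /fine_cvg.
Unshelve. all: by end_near. Qed.

(** The truncated part tends to 0 by dominated convergence; the rest is small
uniformly in n because the moments of order 1 + r are bounded. *)
Lemma L1_cvg : (\int[P]_w (D n w)%:E)%E @[n --> \oo] --> 0%E.
Proof.
have mp (f : Omega -> R) : measurable_fun setT f -> measurable_fun setT (fun w => (expR ((1 + r) * f w))%:E).
  move=> mf; apply/measurable_EFinP; exact: (measurableT_comp (measurable_expM (1 + r)) mf).
have fin0 x : (0 <= (expR x)%:E)%E by rewrite lee_fin expR_ge0.
have B0 : 0 <= B by rewrite -lee_fin; apply: le_trans hBoo; exact: integral_ge0.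
have key j n : 0 <= j -> (\int[P]_w (D n w)%:E <=
   (\int[P]_w Num.min (D n w) (2 * C * expR j))%:E + (2 * C * expR (- (r * j)) * (B + B))%:E)%E.
  move=> j0; have j1 : 0 <= 2 * C * expR j by rewrite !mulr_ge0 ?expR_ge0// ltW.
  have c0 : 0 <= 2 * C * expR (- (r * j)) by rewrite !mulr_ge0 ?expR_ge0// ltW.
  have mm : measurable_fun setT (fun w => (Num.min (D n w) (2 * C * expR j))%:E).
    by apply/measurable_EFinP; apply: measurable_minr.
  have mpos w : (0 <= (Num.min (D n w) (2 * C * expR j))%:E)%E by rewrite lee_fin le_min D0.
  apply: le_trans (_ : \int[P]_w ((Num.min (D n w) (2 * C * expR j))%:E +
     ((2 * C * expR (- (r * j)))%:E * ((expR ((1 + r) * q n w))%:E + (expR ((1 + r) * qoo w))%:E))) <= _)%E.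
    apply: ge0_le_integral => //.
    - by move=> w _; rewrite lee_fin.
    - exact/measurable_EFinP.
    - apply: emeasurable_funD => //; apply: emeasurable_funM => //; apply: emeasurable_funD; exact: mp.
    - by move=> w _; have := trunc_bound j n w; rewrite -lee_fin EFinD EFinM EFinD.
  rewrite ge0_integralD//; first last.
  - by apply: emeasurable_funM => //; apply: emeasurable_funD; exact: mp.
  - by move=> w _; rewrite mule_ge0// adde_ge0.
  apply: leeD.
    rewrite /Rintegral fineK// ge0_fin_numE ?integral_ge0//.
    apply: (@le_lt_trans _ _ (\int[P]_w (cst (2 * C * expR j)%:E) w)%E).
      by apply: ge0_le_integral => // w _; rewrite lee_fin ge_min lexx orbT.
    rewrite integral_cst// [X in (_ * X)%E](_ : _ = 1%E) ?mule1 ?ltry//; exact: probability_setT.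
  rewrite ge0_integralZl//; first last.
  - by move=> w _; rewrite adde_ge0.
  - by apply: emeasurable_funD; exact: mp.
  rewrite [leRHS]EFinM; apply: lee_wpmul2l; first by rewrite lee_fin.
  rewrite ge0_integralD//; [|exact: mp|exact: mp].
  by rewrite EFinD leeD.
have small e : 0 < e -> \forall n \near \oo, (\int[P]_w (D n w)%:E <= e%:E)%E.
  move=> e0.
  have [j j0 hj] : exists2 j, 0 <= j & 2 * C * expR (- (r * j)) * (B + B) <= e / 2.
    pose M := 2 * C * (B + B).
    have M0 : 0 <= M by rewrite !mulr_ge0 ?addr_ge0// ltW.
    (* then exp (r j) >= 1 + 2 M / e *)
    exists (2 * M / e / r); first by rewrite !divr_ge0 ?(ltW e0) ?(ltW r0)// mulr_ge0.
    rewrite (_ : r * _ = 2 * M / e); last by field; rewrite !gt_eqF.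
    rewrite mulrAC -/M expRN ler_pdivrMr ?expR_gt0//.
    apply: le_trans (_ : e / 2 * (1 + 2 * M / e) <= _).
      by rewrite (_ : e / 2 * (1 + 2 * M / e) = e / 2 + M) ?lerDr ?divr_ge0 ?ltW//; field; rewrite gt_eqF.
    by rewrite ler_pM2l ?divr_gt0// expR_ge1Dx.
  have j1 : 0 <= 2 * C * expR j by rewrite !mulr_ge0 ?expR_ge0// ltW.
  have e2 : 0 < e / 2 by rewrite divr_gt0.
  near=> n.
  apply: le_trans (key j n j0) _; rewrite -EFinD lee_fin.
  rewrite (splitr e) lerD//; apply: ltW.
  by near: n; exact: (cvgr_lt _ (trunc_cvg j1)).
have pos n : (0 <= \int[P]_w (D n w)%:E)%E by apply: integral_ge0 => w _; rewrite lee_fin.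
apply/fine_cvgP; split.
  apply: filterS (small 1 ltr01) => n h; rewrite ge0_fin_numE//.
  by apply: le_lt_trans h (ltry _).
apply/cvgr0Pnorm_le => e e0; near=> n => /=.
rewrite ger0_norm ?fine_ge0// -lee_fin fineK; first by near: n; exact: small.
rewrite ge0_fin_numE//; apply: (@le_lt_trans _ _ e%:E); last exact: ltry.
by near: n; exact: small.
Unshelve. all: by end_near. Qed.
End uniform_integrability.

Section L1_convergence.
Context d (Omega : measurableType d) (R : realType) (P : probability Omega R).
Variable E : seq bool -> {RV P >-> R}.
Hypothesis hE : yule_clocks E.
Variable xi : {RV P >-> R}.
Hypothesis hxi : {ae P, forall w,
  expR (- t) * (yule_N E t w)%:R @[t --> +oo] --> xi w}.
Notation normc := ComplexField.Normc.normc.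
Variable z : R[i].
Hypothesis z0 : 0 < complex.Re z.
Hypothesis hz : forall k : nat, z != - (k%:R / 2).

Let L w := cpow (xi w) (2 * z - 1) / Gamma (2 * z).

Lemma measurable_normc (f : Omega -> R[i]) : cmeasurable setT f ->
  measurable_fun setT (fun w => normc (f w)).
Proof.
move=> [m1 m2]; under eq_fun do rewrite normcE.
apply: (measurableT_comp (continuous_measurable_fun (@sqrt_continuous R))).
by apply: measurable_funD; apply: measurable_funX.
Qed.

Lemma cmeasurableM_cst (f : Omega -> R[i]) c : cmeasurable setT f -> cmeasurable setT (fun w => f w * c).
Proof.
move=> [m1 m2]; split.
  under eq_fun do rewrite Re_mul.
  by apply: measurable_funB; apply: measurable_funM.
under eq_fun do rewrite Im_mul.
by apply: measurable_funD; apply: measurable_funM.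
Qed.

Lemma cmeasurable_L : cmeasurable setT L.
Proof.
apply: cmeasurableM_cst; split.
  under eq_fun do rewrite Re_cpow.
  apply: measurable_funM; first by apply: measurable_ln_comp.
  apply: (measurableT_comp (@measurable_cos R)); apply: measurable_funM => //.
  by apply: measurableT_comp => //; exact: measurable_ln.
under eq_fun do rewrite Im_cpow.
apply: measurable_funM; first by apply: measurable_ln_comp.
apply: (measurableT_comp (@measurable_sin R)); apply: measurable_funM => //.
by apply: measurableT_comp => //; exact: measurable_ln.
Qed.

Lemma cmeasurable_frakC n : cmeasurable setT (frakC E n z).
Proof.
have := cmeasurableM_cst (bst_C n z) (cexp_tau_cmeasurable E (1 - 2 * z) n).
by move=> [m1 m2]; split.
Qed.

(** [L1_cvg] with 1 + r = 1 + a / 2, where a is the real part of w: the moment of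
order 1 + r of [frakC] is that of order - s of [scaled_size], with
s = (1 + a / 2) (1 - a) < 1.  Fatou's lemma bounds the moment of the limit. *)
Lemma frakC_L1 : cvg_L1 P (fun n => frakC E n z) L.
Proof.
pose a := complex.Re (2 * z).
have a0 : 0 < a by rewrite /a Re_mul Re_nat Im_nat mul0r subr0 mulr_gt0.
have Ra : complex.Re (2 * z - 1) = a - 1 by rewrite Re_add Re_opp.
pose r := a / 2; have r0 : 0 < r by rewrite divr_gt0.
pose s := (1 + r) * (1 - a).
have s1 : s < 1.
  have : 0 < a * a by rewrite mulr_gt0.
  by rewrite /s /r; nra.
have es x : (1 + r) * ((a - 1) * x) = - s * x by rewrite /s; ring.
have [B hB] := scaled_size_moment hE s1.
have [C1 C10 hC1] := scaled_ratio_bounded a0.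
pose C := C1 + normc (Gamma (2 * z))^-1.
have C0 : 0 < C by rewrite ltr_wpDr ?normc_ge0.
pose D n w := normc (frakC E n.+1 z w - L w).
pose q n w := (a - 1) * ln (scaled_size E n w).
pose qoo w := (a - 1) * ln (xi w).
have mD n : measurable_fun setT (D n).
  apply: measurable_normc; have [m1 m2] := cmeasurable_frakC n.+1; have [m3 m4] := cmeasurable_L.
  split.
    under eq_fun do rewrite Re_add Re_opp; exact: measurable_funB.
  under eq_fun do rewrite Im_add Im_opp; exact: measurable_funB.
have mln (F : Omega -> R) : measurable_fun setT F -> measurable_fun setT (fun w => (a - 1) * ln (F w)).
  by move=> mF; apply: measurable_funM => //; apply: measurableT_comp => //; exact: measurable_ln.
have mq n : measurable_fun setT (q n) by apply: mln; exact: measurable_scaled_size.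
have mqoo : measurable_fun setT qoo by apply: mln.
have Dq n w : D n w <= C * (expR (q n w) + expR (qoo w)).
  apply: le_trans (_ : normc (frakC E n.+1 z w) + normc (L w) <= _).
    rewrite /D; have := le_normcD (frakC E n.+1 z w) (- L w).
    by rewrite (_ : normc (- L w) = normc (L w))// !normcE Re_opp Im_opp !sqrrN.
  rewrite frakC_scaled_size /L (normcM (scaled_ratio _ _)) (normcM (cpow _ _)) !normc_cpow Ra mulrDr.
  apply: lerD; first by rewrite ler_wpM2r ?expR_ge0//; apply: le_trans (hC1 n) _; rewrite lerDl normc_ge0.
  by rewrite mulrC ler_wpM2r ?expR_ge0// lerDr ltW.
have Dcvg : {ae P, forall w, D n w @[n --> \oo] --> (0 : R)}.
  apply: filterS (frakC_cvg hE hxi hz) => w c.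
  have c1 : (fun n => frakC E n.+1 z w) @ \oo --> (L w : R[i]^o).
    have := @cvg_shiftS (R[i]^o) (fun n => frakC E n z w) (nbhs (L w : R[i]^o)).
    by rewrite propeqE => -[_ H]; exact: H.
  have c2 : (fun n => frakC E n.+1 z w - L w) @ \oo --> (0 : R[i]^o).
    move: c1 => /ccvgP[c1 c2]; apply/ccvgP; split => /=.
      rewrite -[X in _ --> X](subrr (complex.Re (L w))).
      by under eq_fun do rewrite Re_add Re_opp; apply: cvgB => //; exact: cvg_cst.
    rewrite -[X in _ --> X](subrr (complex.Im (L w))).
    by under eq_fun do rewrite Im_add Im_opp; apply: cvgB => //; exact: cvg_cst.
  by have := ccvg_normc c2; rewrite ComplexField.Normc.normc0.
have hB' n : (\int[P]_w (expR ((1 + r) * q n w))%:E <= B%:E)%E.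
  by apply: le_trans (hB n); rewrite /q; under eq_integral do rewrite es.
have hBoo : (\int[P]_w (expR ((1 + r) * qoo w))%:E <= B%:E)%E.
  have mE (f : Omega -> R) : measurable_fun setT f -> measurable_fun setT (fun w => expR ((1 + r) * f w)).
    by move=> mf; exact: (measurableT_comp (measurable_expM (1 + r)) mf).
  have := fatou_bound (fun n => mE _ (mq n)) (fun n w => expR_ge0 _) hB'.
  apply: le_trans; rewrite le_eqVlt; apply/orP; left; apply/eqP.
  apply: ge0_ae_eq_integral => //.
  - by apply/measurable_EFinP; exact: mE.
  - rewrite /limn_einf; apply: measurableT_comp => //.
    apply: measurable_fun_limn_esup => n; apply: measurableT_comp => //.
    by apply/measurable_EFinP; exact: mE.
  - move=> w _; rewrite limn_einf_lim; apply: lime_ge; first exact: is_cvg_einfs.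
    by apply: nearW => n; apply: le_ereal_inf_tmp => _ [k _ <-]; rewrite lee_fin expR_ge0.
  apply: filterS2 (scaled_size_cvg hE hxi) (xi_gt0 hE hxi) => w c x0 _.
  apply/esym.
  have cc : (fun n => (expR ((1 + r) * q n w))%:E) @ \oo --> (expR ((1 + r) * qoo w))%:E.
    apply/cvg_EFin; first by near=> n.
    have c1 : (fun n => (1 + r) * q n w) @ \oo --> (1 + r) * qoo w.
      apply: cvgM; first exact: cvg_cst.
      apply: cvgM; first exact: cvg_cst.
      exact: (cvg_comp _ _ c (continuous_ln x0)).
    exact: (cvg_comp _ _ c1 (@continuous_expR R _)).
  by have [-> _] := cvg_limn_einf_sup cc.
have := L1_cvg C0 r0 mD mq mqoo (fun n w => normc_ge0 _) Dq Dcvg hB' hBoo.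
rewrite /D /cvg_L1 => H.
have := @cvg_shiftS (\bar R) (fun n => \int[P]_w (normc (frakC E n z w - L w))%:E)%E (nbhs 0%E).
by rewrite propeqE => -[H1 _]; exact: H1.
Unshelve. all: by end_near. Qed.
End L1_convergence.

(** * Independence of the times and of the shape *)

Section independence.
Context d (Omega : measurableType d) (R : realType) (P : probability Omega R).
Variable E : seq bool -> {RV P >-> R}.
Hypothesis hE : yule_clocks E.
Notation past := (past E).
Notation tau := (tau E).
Notation gap := (gap E).
Notation exp_gap := (exp_gap E).
Notation hevent := (hevent E).

Lemma hevent_disj_size h h' w : hist h -> hist h' -> size h = size h' ->
  hevent h w -> hevent h' w -> h = h'.
Proof.
elim: h h' => [[|//]//|v h IH [//|v' h'] hh hh' [sh] hw hw'].
have e : h = h'.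
  move: (hh) (hh') => /= /andP[_ hh1] /andP[_ hh2].
  by apply: IH => //; [exact: (hevent_cons hh)|exact: (hevent_cons hh')].
subst h'; congr cons; apply/eqP; apply: contraT => vv'; exfalso.
by move: hh hh' => /= /andP[vh hh] /andP[v'h _]; exact: (hevent_disj hh vh v'h vv' hw hw').
Qed.

Lemma hevent_drop k h w : hist h -> hevent h w -> hist (drop k h) /\ hevent (drop k h) w.
Proof.
elim: k h => [|k IH] [|v h] //= hh hw.
by apply: IH; [case/andP: hh|exact: (hevent_cons hh)].
Qed.

(** The events of two histories are nested when one extends the other, and
disjoint otherwise. *)
Lemma heventI h h' : hist h -> hist h' -> (size h <= size h')%N ->
  hevent h `&` hevent h' = set0 \/ hevent h `&` hevent h' = hevent h'.
Proof.
move=> hh hh' sh; have [e|e] := eqVneq (drop (size h' - size h) h') h.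
  by right; apply/seteqP; split => w; [case|move=> hw; split => //; rewrite -e; case: (hevent_drop (size h' - size h) hh' hw)].
left; apply/seteqP; split => // w [hw hw'].
have [d1 d2] := hevent_drop (size h' - size h) hh' hw'.
by move/eqP: e; apply; apply: hevent_disj_size d2 hw; rewrite ?size_drop ?subKn.
Qed.

Lemma past_hevent h : hist h -> past (size h) (hevent h).
Proof.
move=> hh; split; first exact: hevent_measurable.
move=> h' hh' sh; have [<-|nh] := eqVneq h h'.
  exists setT; first exact: gen_setT.
  by rewrite setTI setIid.
exists set0; first exact: gen_set0.
rewrite set0I; apply/seteqP; split => // w [hw hw'].
by move/eqP: nh; apply; apply: hevent_disj_size hw hw'.
Qed.
Definition gaps (N : nat) (B : nat -> set R) : set Omega :=
  [set w | forall k, (k < N)%N -> B k (gap k w)].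

Lemma gapsS N B : gaps N.+1 B = gaps N B `&` gap N @^-1` B N.
Proof.
apply/seteqP; split => w /=.
  by move=> h; split => [k kN|]; apply: h; rewrite // ltnS ltnW.
by move=> [h1 h2] k; rewrite ltnS leq_eqVlt => /orP[/eqP ->//|]; exact: h1.
Qed.

Lemma past_gaps N B : (forall k, measurable (B k)) -> past N (gaps N B).
Proof.
move=> mB; elim: N => [|N IH].
  by rewrite (_ : gaps 0 B = setT); [exact: pastT|apply/seteqP; split].
by rewrite gapsS; apply: pastI; [exact: pastS|exact: past_gap].
Qed.

(** Induction on the history with [jump_step]. *)
Lemma gaps_hevent_same h B : (forall k, measurable (B k)) -> hist h ->
  P (gaps (size h) B `&` hevent h) = (P (gaps (size h) B) * P (hevent h))%E.
Proof.
move=> mB; elim: h => [_|v h IH hh].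
  by rewrite (_ : gaps 0 B = setT) ?setTI ?probability_setT ?mul1e//; apply/seteqP; split.
have hh1 : hist h by move: hh => /= /andP[].
have hA := past_gaps (size h) mB.
have mA : measurable (gaps (size h) B) by case: hA.
rewrite gapsS setIAC (jump_step hE hh erefl hA (mB _)) (gap_indep hE hA (mB _)).
have e : P (hevent (v :: h)) = ((pr P (hevent h) / (size h).+1%:R)%:E)%E.
  by rewrite prE; [rewrite (pr_hevent_cons hE hh)|exact: hevent_measurable].
rewrite e muleAC; congr (_ * _)%E.
rewrite EFinM -prE; last by apply: measurableI => //; exact: hevent_measurable.
by rewrite IH// -muleA (prE P (hevent_measurable E hh1)) -EFinM.
Qed.

(** The waiting times after the splits of h are independent of the past. *)
Lemma gaps_hevent_ge h N B : (forall k, measurable (B k)) -> hist h -> (size h <= N)%N ->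
  P (gaps N B `&` hevent h) = (P (gaps N B) * P (hevent h))%E.
Proof.
move=> mB hh; move=> /subnK <-; elim: (N - size h)%N => [|k IH].
  by rewrite add0n gaps_hevent_same.
rewrite addSn gapsS setIAC (gap_indep hE _ (mB _)).
  by rewrite IH (gap_indep hE (past_gaps _ mB) (mB _)) muleAC.
apply: pastI; first exact: past_gaps.
by apply: past_le (past_hevent hh); rewrite leq_addl.
Qed.

(** Finitely many waiting times are constrained; they are indexed by all
integers, with trivial constraints from some rank on, to make intersections
plain. *)
Definition gap_sets : set (set Omega) :=
  [set A | exists N B, (forall k, measurable (B k)) /\ (forall k, (N <= k)%N -> B k = setT) /\
     A = [set w | forall k, B k (gap k w)]].

Definition hevent_sets : set (set Omega) :=
  [set A | A = set0 \/ A = setT \/ exists2 h, hist h & A = hevent h].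

Lemma gap_setsE N M (B : nat -> set R) : (forall k, (N <= k)%N -> B k = setT) -> (N <= M)%N ->
  [set w | forall k, B k (gap k w)] = gaps M B.
Proof.
move=> hB NM; apply/seteqP; split => w /= h k; first by move=> _; exact: h.
by case: (ltnP k M) => kM; [exact: h|rewrite hB//; exact: leq_trans kM].
Qed.

Lemma indep_gap_hevent A B : <<s gap_sets >> A -> <<s hevent_sets >> B -> P (A `&` B) = (P A * P B)%E.
Proof.
apply: indep_gen.
- move=> _ _ [N [B1 [m1 [h1 ->]]]] [N' [B2 [m2 [h2 ->]]]].
  exists (maxn N N'), (fun k => B1 k `&` B2 k); split; first by move=> k; exact: measurableI.
  split; first by move=> k; rewrite geq_max => /andP[k1 k2]; rewrite h1// h2// setTI.
  apply/seteqP; split => w /=; first by move=> [a b] k; split.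
  by move=> a; split => k; case: (a k).
- by exists 0%N, (fun=> setT); split => //; split => //; apply/seteqP; split.
- move=> _ [N [B1 [m1 [h1 ->]]]]; rewrite (gap_setsE h1 (leqnn _)).
  by case: (past_gaps N m1).
- move=> A1 A2 [->|[->|[h hh ->]]]; first by rewrite set0I; left.
    by rewrite setTI.
  move=> [->|[->|[h' hh' ->]]]; first by rewrite setI0; left.
    by rewrite setIT; right; right; exists h.
  have [l|l] := leqP (size h) (size h').
    by case: (heventI hh hh' l) => ->; [left|right; right; exists h'].
  by rewrite setIC; case: (heventI hh' hh (ltnW l)) => ->; [left|right; right; exists h].
- by right; left.
- by move=> _ [->|[->|[h hh ->]]] //; exact: hevent_measurable.
- move=> _ A2 [N [B1 [m1 [h1 ->]]]] [->|[->|[h hh ->]]].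
  + by rewrite setI0 measure0 mule0.
  + by rewrite setIT (@probability_setT _ _ _ P) mule1.
  by rewrite (gap_setsE h1 (leq_maxl N (size h))) gaps_hevent_ge// leq_maxr.
Qed.

(** The events that agree on K with some event of <<s H>> form a sigma-algebra, so
that it is enough to consider generators. *)
Lemma trace_sigma (G H : set (set Omega)) (K : set Omega) :
  (forall A, G A -> exists2 A', <<s H >> A' & A `&` K = A' `&` K) ->
  forall A, <<s G >> A -> exists2 A', <<s H >> A' & A `&` K = A' `&` K.
Proof.
move=> GH A; apply: (@smallest_sub _ _ _ [set A | exists2 A', <<s H >> A' & A `&` K = A' `&` K]) => //.
have [s0 sD sU] := smallest_sigma_algebra setT H.
split => /=.
- by exists set0.
- move=> B [B' hB' e]; exists (setT `\` B'); first exact: sD.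
  by rewrite !setTD; apply/seteqP; split => w [nb kw]; split => // bw; apply: nb;
    [have : (B `&` K) w by rewrite e|have : (B' `&` K) w by rewrite -e]; case.
- move=> F hF; pose F' n := sval (cid2 (hF n)).
  exists (\bigcup_n F' n); first by apply: sU => n; rewrite /F'; case: (cid2 _).
  rewrite !setI_bigcupl; apply: eq_bigcupr => n _.
  by rewrite /F'; case: (cid2 _).
Qed.

Lemma pr_good A : measurable A -> P (A `&` good E) = P A.
Proof.
move=> mA; have mg := good_measurable hE.
have z0 : P (A `\` good E) = 0%E.
  apply/eqP; rewrite -measure_le0 -(good_ae hE); apply: le_measure; rewrite ?inE.
  - exact: measurableD.
  - exact: measurableC.
  - by move=> w [].
apply: esym; apply: etrans (measureDI P mA mg) _.
by apply: etrans (congr1 (fun x => x + _)%E z0) _; exact: add0e.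
Qed.

Notation gapT := (g_sigma_algebraType gap_sets).

Lemma measurable_gap_gen k : measurable_fun (setT : set gapT) (gap k : gapT -> R).
Proof.
move=> _ B mB; rewrite setTI; apply: sub_sigma_algebra.
exists k.+1, (fun j => if j == k then B else setT); split; first by move=> j; case: ifP.
split; first by move=> j kj; rewrite gtn_eqF.
apply/seteqP; split => w /=; last by move=> /(_ k); rewrite eqxx.
by move=> h j; case: ifP => [/eqP ->|].
Qed.

Lemma tau_gaps n w : good E w -> tau n w = \sum_(k < n) gap k w.
Proof.
move=> gw; elim: n => [|n IH]; first by rewrite big_ord0 tau0.
by rewrite big_ord_recr /= -IH tauS.
Qed.

Lemma tau_trace n (g : R -> R) B : measurable_fun setT g -> measurable B ->
  exists2 A', <<s gap_sets >> A' & (fun w => g (tau n w)) @^-1` B `&` good E = A' `&` good E.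
Proof.
move=> mg mB; exists ((fun w => g (\sum_(k < n) gap k w)) @^-1` B).
  have ms : measurable_fun (setT : set gapT) (fun w => \sum_(k < n) gap k w : R).
    by apply: measurable_sum => k; exact: measurable_gap_gen.
  by have := (measurableT_comp mg ms) measurableT B mB; rewrite setTI.
by apply/seteqP; split => w [h gw]; split => //; move: h; rewrite /= tau_gaps.
Qed.

(** On good paths the tree is that of the history, and there are finitely many
histories at each level. *)
Lemma leaf_trace n (Q : set (set (seq bool))) :
  exists2 A', <<s hevent_sets >> A' &
    [set w | Q (leaves (bst E n w))] `&` good E = A' `&` good E.
Proof.
exists (\bigcup_(h : seq (seq bool))
   (if `[< [/\ hist h, size h = n & Q [set` hleaves h]] >] then hevent h else set0)).
  apply: gen_countable_bigcup; first exact: countableP.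
  move=> h; case: asboolP => [[hh _ _]|_]; last exact: gen_set0.
  by apply: sub_sigma_algebra; right; right; exists h.
have e h w : hist h -> hevent h w -> leaves (bst E (size h) w) = [set` hleaves h].
  by move=> hh hw; rewrite bst_hist// leaves_tree_of.
apply/seteqP; split => w [].
  move=> /= q gw; split => //; have [h [hh sh hw]] := gw n; exists h => //.
  rewrite asboolT//; split => //; move: q; by rewrite -sh e.
move=> [h _]; case: asboolP => // -[hh sh q] hw gw; split => //=.
by rewrite -sh e.
Qed.

Lemma measurable_leaf n u : measurable [set w | leaves (bst E n w) u].
Proof.
have mle v : measurable [set w | ring_time E v w <= tau n w].
  have m : measurable_fun setT (fun w => tau n w - ring_time E v w).
    by apply: measurable_funB; [exact: measurable_tauR|exact: measurable_ring].
  have := m measurableT `[0, +oo[%classic (measurable_itv _); rewrite setTI.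
  by congr measurable; apply/seteqP; split => w /=; rewrite in_itv/= andbT subr_ge0.
rewrite (_ : mkset _ = (\bigcap_(k in `I_(size u)) [set w | ring_time E (take k u) w <= tau n w]) `&`
   ~` [set w | ring_time E u w <= tau n w]).
  by apply: measurableI; [exact: bigcap_measurableType|exact: measurableC].
apply/seteqP; split => w /=.
  move=> /leavesE[Tu lt]; split; first by move=> k ku; exact: Tu.
  by apply/negP; rewrite -ltNge.
move=> [Tu lt]; apply/leavesE; split; first by move=> k ku; exact: Tu.
by rewrite ltNge; apply/negP.
Qed.

Lemma measurable_leaves_eq n (S : set (seq bool)) : measurable [set w | leaves (bst E n w) = S].
Proof.
rewrite (_ : mkset _ = ~` (\bigcup_(u : seq bool) [set w | ~ (leaves (bst E n w) u <-> S u)])).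
  apply/measurableC/countable_bigcupT_measurable; first exact: countableP.
  move=> u; have [Su|Su] := pselect (S u).
    rewrite (_ : mkset _ = ~` [set w | leaves (bst E n w) u]); first exact/measurableC/measurable_leaf.
    by apply/seteqP; split => w /=; tauto.
  rewrite (_ : mkset _ = [set w | leaves (bst E n w) u]); first exact/measurable_leaf.
  apply/seteqP; split => w /=; last by tauto.
  by move=> h; apply: contrapT => nl; apply: h; tauto.
apply/seteqP; split => w /=; first by move=> e [u _] /=; rewrite e; tauto.
by move=> h; apply/seteqP; split => u hu; apply: contrapT => nu; apply: h; exists u => //=; tauto.
Qed.

(** The finite sets of leaves are countably many; the sets of infinitely many
leaves, which may occur on a null event, are not told apart by Q. *)
Lemma measurable_leaf_event n (Q : set (set (seq bool))) (c : Prop) :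
  (forall S, infinite_set S -> (Q S <-> c)) -> measurable [set w | Q (leaves (bst E n w))].
Proof.
move=> hc; pose L (s : seq (seq bool)) := [set w | leaves (bst E n w) = [set` s]].
have mL s : measurable (L s) by exact: measurable_leaves_eq.
have e0 : [set w | infinite_set (leaves (bst E n w))] = ~` (\bigcup_(s : seq (seq bool)) L s).
  apply/seteqP; split => w /=.
    by move=> iw [s _ ls]; apply: iw; rewrite ls; exact: finite_seq.
  by move=> h /finite_seqP[s ls]; apply: h; exists s.
rewrite (_ : mkset _ = (\bigcup_(s : seq (seq bool)) (if `[< Q [set` s] >] then L s else set0)) `|`
   ([set w | infinite_set (leaves (bst E n w))] `&` [set _ | c])).
  apply: measurableU.
    apply: countable_bigcupT_measurable; first exact: countableP.
    by move=> s; case: asboolP.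
  rewrite e0; apply: measurableI.
    by apply/measurableC/countable_bigcupT_measurable; first exact: countableP.
  have [hc'|hc'] := pselect c.
    by rewrite (_ : mkset _ = setT)//; apply/seteqP; split.
  by rewrite (_ : mkset _ = set0)//; apply/seteqP; split.
apply/seteqP; split => w /=.
  move=> q; have [/finite_seqP[s ls]|iw] := pselect (finite_set (leaves (bst E n w))).
    by left; exists s => //; rewrite asboolT// -ls.
  by right; split => //; apply/(hc _ iw).
by move=> [[s _]|[iw hcc]]; [case: asboolP => // q; rewrite /L /= => ->|apply/(hc _ iw)].
Qed.
(** The sum of [yule_M] and [bst_M] as a function of the set of leaves. *)
Definition psum (z : R[i]) (S : set (seq bool)) : R[i] := \sum_(u \in S) z ^+ size u.

(** A sum with infinite support is 0 by convention, and no term vanishes. *)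
Lemma psum_infinite z S : z != 0 -> infinite_set S -> psum z S = 0.
Proof.
move=> z0 iS; rewrite /psum; case: finite_supportP; rewrite ?big_nil// => X XS F0 e.
exfalso; apply: iS; have -> : S = [set` X].
  rewrite e; apply/seteqP; split => u; last by case.
  by move=> Su; split => //=; apply/eqP; rewrite expf_neq0.
exact: finite_fset.
Qed.

Variable z : R[i].
Hypothesis hz : forall k : nat, z != - (k%:R / 2).

Lemma z_neq0 : z != 0.
Proof. by have := hz 0; rewrite mul0r oppr0. Qed.

(** Events of [frakC] agree on good paths with events of the waiting times, those
of [bst_M] with events of the histories; [indep_gap_hevent] concludes. *)
Lemma independent_frakC_bst : independent_seqs P (fun n => frakC E n z) (fun n => bst_M E n z).
Proof.
have mX : sigma_seq (fun n => frakC E n z) `<=` measurable.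
  apply: sigma_sub_measurable => A [n _ [B mB]].
  have [m1 m2] := cmeasurable_frakC E z n.
  by case=> ->; rewrite -[X in measurable X]setTI; [exact: m1|exact: m2].
have mY : sigma_seq (fun n => bst_M E n z) `<=` measurable.
  apply: sigma_sub_measurable => A [n _ [B mB]].
  pose Q (g : R[i] -> R) : set (set (seq bool)) := [set S | B (g ((bst_C n z)^-1 * psum z S))].
  have hQ g : measurable [set w | Q g (leaves (bst E n w))].
    apply: (@measurable_leaf_event _ _ (B (g 0))) => S iS.
    by rewrite /Q /= (psum_infinite z_neq0 iS) mulr0.
  by case=> ->; [exact: (hQ (@complex.Re R))|exact: (hQ (@complex.Im R))].
split=> // A B hA hB.
have [|A' hA' eA] := @trace_sigma _ gap_sets (good E) _ A hA.
  move=> A0 [n _ [B' mB']].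
  have mr := measurable_Re_cexpM (1 - 2 * z); have mi := measurable_Im_cexpM (1 - 2 * z).
  case=> ->.
    apply: (@tau_trace n (fun x => complex.Re (cexp (x%:C * (1 - 2 * z)) * bst_C n z))) => //.
    under eq_fun do rewrite Re_mul.
    by apply: measurable_funB; apply: measurable_funM.
  apply: (@tau_trace n (fun x => complex.Im (cexp (x%:C * (1 - 2 * z)) * bst_C n z))) => //.
  under eq_fun do rewrite Im_mul.
  by apply: measurable_funD; apply: measurable_funM.
have [|B' hB' eB] := @trace_sigma _ hevent_sets (good E) _ B hB.
  move=> A0 [n _ [B0 mB0]] [] ->.
    exact: (leaf_trace n [set S | B0 (complex.Re ((bst_C n z)^-1 * psum z S))]).
  exact: (leaf_trace n [set S | B0 (complex.Im ((bst_C n z)^-1 * psum z S))]).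
have mA := mX _ hA; have mB := mY _ hB.
have mA' : measurable A'.
  apply: sigma_sub_measurable hA' => _ [N [B1 [m1 [h1 ->]]]]; rewrite (gap_setsE h1 (leqnn _)).
  by case: (past_gaps N m1).
have mB' : measurable B'.
  by apply: sigma_sub_measurable hB' => _ [->|[->|[h hh ->]]] //; exact: hevent_measurable.
rewrite -pr_good; last exact: measurableI.
rewrite -(pr_good mA) -(pr_good mB) setIIl eA eB -setIIl !pr_good//; last exact: measurableI.
exact: indep_gap_hevent.
Qed.

Lemma bst_C_neq0 n : bst_C n z != 0.
Proof.
apply/prodf_neq0 => k _; rewrite mulf_neq0 ?invr_eq0 ?pnatr_eq0//.
by rewrite addrC; exact: neq_half hz k.
Qed.

Lemma yule_M_frakC n w : yule_M E (fine (yule_tau E n w)) z w = frakC E n z w * bst_M E n z w.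
Proof.
rewrite /yule_M -mulr_fsuml /frakC /bst_M mulrC -[RHS]mulrA mulVKf ?bst_C_neq0//.
Qed.
End independence.

Theorem proposition2p2 (d : measure_display) (Omega : measurableType d)
    (R : realType) (P : probability Omega R)
    (E : seq bool -> {RV P >-> R}) (hE : yule_clocks E)
    (xi : {RV P >-> R})
    (hxi : {ae P, forall w,
       expR (- t) * (yule_N E t w)%:R @[t --> +oo] --> xi w})
    (z : R[i]) (hz : forall k : nat, z != - (k%:R / 2)) :
  ([/\ forall n, cmeasurable_wrt (stopped_filtration E n) (frakC E n z),
       0 < complex.Re z ->
         martingale P (stopped_filtration E) (fun n => frakC E n z) /\
         (forall n, cintegral P setT (frakC E n z) = 1),
       {ae P, forall w,
         frakC E n z w @[n --> \oo] -->
           (cpow (xi w) (2 * z - 1) / Gamma (2 * z) : R[i]^o)} &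
       0 < complex.Re z ->
         cvg_L1 P (fun n => frakC E n z)
           (fun w => cpow (xi w) (2 * z - 1) / Gamma (2 * z))]) /\
  (independent_seqs P (fun n => frakC E n z) (fun n => bst_M E n z) /\
   forall n w, yule_M E (fine (yule_tau E n w)) z w =
     frakC E n z w * bst_M E n z w).
Proof.
split.
  split.
  - move=> n; exact: frakC_adapted.
  - move=> z0; split; first exact: frakC_martingale.
    by move=> n; exact: frakC_mean.
  - exact: frakC_cvg.
  - move=> z0; exact: frakC_L1.
split; first exact: independent_frakC_bst.
by move=> n w; exact: yule_M_frakC.
Qed.
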